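(* For every $c>0$, $c\ne1$, there exists a number $\nu(c)\in(0,1)$, depending only on $c$, such that the following holds. Let $p\in S^1$ and let $g\in B^\omega(p,c)$ be a linear fractional circle homeomorphism with irrational rotation number $\rho$. Then there exists a family of circle homeomorphisms $f_\varepsilon\in B^\omega(p,c)$, $\varepsilon\in\mathbb R$, such that $f_0=g$, $f_\varepsilon$ is continuous in $\varepsilon$ in the $C^\infty([p,p+1])$ topology, $\rho(f_\varepsilon)=\rho$ for all $\varepsilon\in\mathbb R$, but none of the maps $f_\varepsilon$, $\varepsilon\ne0$, is $C^{1+\alpha}$ conjugate to $g$ with $\alpha>1-\nu(c)$ (where $\alpha\le1$). Moreover, $f_\varepsilon$ depends continuously on $\varepsilon$ as an analytic map of some neighborhood of $[p,p+1]$ in $\mathbb C$.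
   Context: $S^1=\mathbb R/\mathbb Z$; circle homeomorphisms are orientation preserving, and $\rho(f)$ denotes the rotation number. A circle homeomorphism $f$ is of class $B^\omega(p,c)$ ($c>0$, $c\neq1$) if it is real analytic everywhere except at the unique break point $p$, and $f'(p-0)/f'(p+0)=c$; precisely, a lift of $f$ restricted to $[p,p+1]$ is real analytic up to the endpoints (i.e. extends analytically to a neighborhood of $[p,p+1]$ in $\mathbb C$) with $f'>0$ on $[p,p+1]$. It is linear fractional if its lift restricted to $[p,p+1]$ is a linear fractional (Möbius) function. Continuity of $f_\varepsilon$ in $\varepsilon$ refers to (suitably chosen) lifts restricted to $[p,p+1]$; continuity as analytic maps refers to uniform convergence on compact subsets of the neighborhood. A map is $C^{1+\alpha}$, $0<\alpha\le 1$, if it is continuously differentiable and its derivative is Hölder continuous with exponent $\alpha$. Two circle homeomorphisms $f,g$ are $C^{1+\alpha}$ conjugate if there is a circle diffeomorphism $h$ of class $C^{1+\alpha}$ with $h\circ f=g\circ h$. *)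

(* Defs.v *)
From HB Require Import structures.
From mathcomp Require Import all_boot all_order all_algebra complex.
From mathcomp Require Import all_classical all_reals all_analysis.

Set Implicit Arguments.
Unset Strict Implicit.
Unset Printing Implicit Defensive.

Import Order.TTheory GRing.Theory Num.Theory.
Import numFieldNormedType.Exports.

Local Open Scope classical_set_scope.
Local Open Scope ring_scope.
Local Open Scope complex_scope.

(* The circle is R/Z.  An orientation-preserving circle homeomorphism is
   represented by any one of its lifts F : R -> R, a point of the circle by any
   one of its real representatives. *)

Definition circle_homeo (R : realType) (F : R -> R) : Prop :=
  [/\ continuous F,
      {homo F : x y / x < y} &
      forall x, F (x + 1) = F x + 1].

Definition eq_mod1 (R : realType) (x y : R) : Prop :=
  exists k : int, x = y + k%:~R.

Definition same_circle_map (R : realType) (F G : R -> R) : Prop :=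
  forall x, eq_mod1 (F x) (G x).

(* R/Z is identified with [0, 1[, so that the value does not depend on the
   lift F. *)
Definition rotation_number (R : realType) (F : R -> R) : R :=
  let t : R := limn (fun n : nat => iter n F 0 / n%:R) in
  t - (Num.floor t)%:~R.

(* Derivative of f as a function on [a, b]: one-sided at the endpoints. *)
Definition derive_itv (R : realType) (a b : R) (f : R -> R) (x : R) : R :=
  lim ((f y - f x) / (y - x) @[y --> within `[a, b] x^']).

Definition derive_itvn (R : realType) (a b : R) (n : nat) (f : R -> R) :
  R -> R := iter n (derive_itv a b) f.

(* R[i] as a numFieldType, from which it gets its topology and norm. *)
Definition Cplx (R : realType) : numFieldType := R[i].

(* Analyticity on an open set, as complex differentiability at each point. *)
Definition holomorphic_on (R : realType) (U : set (Cplx R))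
    (phi : Cplx R -> Cplx R) : Prop :=
  forall z, U z -> derivable (phi : (Cplx R)^o -> (Cplx R)^o) z 1.

Definition itv_nbhd (R : realType) (a b : R) (U : set (Cplx R)) : Prop :=
  open U /\ forall x : R, x \in `[a, b] -> U (x%:C : Cplx R).

Definition extends_itv (R : realType) (a b : R) (phi : Cplx R -> Cplx R)
    (F : R -> R) : Prop :=
  forall x : R, x \in `[a, b] -> phi (x%:C : Cplx R) = ((F x)%:C : Cplx R).

Definition analytic_itv (R : realType) (a b : R) (F : R -> R) : Prop :=
  exists (U : set (Cplx R)) (phi : Cplx R -> Cplx R),
    [/\ itv_nbhd a b U, holomorphic_on U phi & extends_itv a b phi F].

(* derive1 is the two-sided derivative, so its one-sided limits at p are f'(p-0)
   and f'(p+0); both exist by analyticity on [p, p+1] and periodicity. *)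
Definition B_omega (R : realType) (p c : R) (F : R -> R) : Prop :=
  [/\ circle_homeo F,
      analytic_itv p (p + 1) F,
      (forall x, x \in `[p, p + 1] -> 0 < derive_itv p (p + 1) F x) &
      lim (derive1 F x @[x --> p^'-]) / lim (derive1 F x @[x --> p^'+]) = c].

Definition linear_fractional (R : realType) (p : R) (F : R -> R) : Prop :=
  exists a b c d : R, a * d - b * c != 0 /\
    forall x, x \in `[p, p + 1] ->
      c * x + d != 0 /\ F x = (a * x + b) / (c * x + d).

(* A lift of a circle map is C^(1 + alpha) iff the circle map is. *)
Definition C1_holder (R : realType) (alpha : R) (h : R -> R) : Prop :=
  [/\ forall x, derivable h x 1,
      continuous (derive1 h) &
      exists M : R, forall x y,
        `|derive1 h x - derive1 h y| <= M * `|x - y| `^ alpha].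

Definition circle_diffeo_C1_holder (R : realType) (alpha : R) (h : R -> R) :
  Prop :=
  circle_homeo h /\
  exists k : R -> R,
    [/\ cancel h k, cancel k h, C1_holder alpha h & C1_holder alpha k].

Definition C1_holder_conjugate (R : realType) (alpha : R) (F G : R -> R) :
  Prop :=
  exists h : R -> R,
    circle_diffeo_C1_holder alpha h /\ same_circle_map (h \o F) (G \o h).

Definition Cinfty_continuous_family (R : realType) (a b : R)
    (F : R -> R -> R) : Prop :=
  forall (k : nat) (e0 : R),
    {uniform `[a, b]%classic, (fun e => derive_itvn a b k (F e)) @ e0
                     --> derive_itvn a b k (F e0)}.

(* One neighborhood U serves all parameters; the topology on analytic maps of
   U is that of uniform convergence on compact subsets. *)
Definition analytic_continuous_family (R : realType) (a b : R)
    (F : R -> R -> R) : Prop :=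
  exists (U : set (Cplx R)) (Phi : R -> Cplx R -> Cplx R),
    [/\ itv_nbhd a b U,
        (forall e, holomorphic_on U (Phi e) /\ extends_itv a b (Phi e) (F e)) &
        forall (e0 : R) (K : set (Cplx R)), compact K -> K `<=` U ->
          {uniform K, Phi @ e0 --> Phi e0}].

(* Main.v *)
(** Write [c = s^2].  On [[p, p + 1]] the map [g] is, up to a translation, the
Moebius map [y / (s + (1 - s) y)] of [[0, 1]]; [f_e] precomposes it with a
quadratic map of [[0, 1]], compensates the effect on the break by changing [s],
and adds the only constant that restores the rotation number.

Moebius maps preserve cross ratios, whereas [f_e] multiplies the cross ratio of
four points in an arc [I] by at most [exp (- kappa |I|^2)].  If [h f_e = g h]
with [h] of class [C^(1 + alpha)], then summing over the orbit of an arc [I]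
under [g] up to the next return time gives [sum |g^i I|^2 <= C |I|^alpha].  Let
[k / q] be a convergent of the translation number [t] of [g],
[theta = |q t - k|], and [I] the shortest arc between a point [x] and
[g^q x - k].  By Denjoy's distortion bound the sum is at least a multiple of
[theta].  As [c <> 1], the return maps of [g] away from the break are uniformly
curved, so the displacement [g^q x - k - x] is small only near one point; this
makes [|I| / theta] drop by a definite factor along the scales, so that
[|I| <= C theta^(1 + delta)] for infinitely many convergents.  This is
impossible when [(1 + delta) alpha > 1], and [nu = delta / (1 + delta)]. *)
Require Import Defs.
From HB Require Import structures.
From mathcomp Require Import all_boot all_order all_algebra complex.
From mathcomp Require Import all_classical all_reals all_analysis.
From mathcomp Require Import ring lra zify.

Import Order.TTheory GRing.Theory Num.Theory.
Import numFieldNormedType.Exports.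

Local Open Scope classical_set_scope.
Local Open Scope ring_scope.

(** A drop of [width / th] by a fixed factor at each scale does not yield a power of [th] when a
    partial quotient is large, since [th] may then fall arbitrarily far in a single step. This
    obstacle splits the argument. Over ratios of [th] bounded below, [width_drop] gives a factor
    [1 - eps]. Over a small ratio the displacement has to pass a uniformly curved minimum, where
    many points of an orbit crowd together, and [width_sharp_ratio] gives [W'^2 <= C ratio^3 W^2],
    that is, a gain of the square root of the ratio in [width / th]. Both gains are powers of the
    ratio, with an exponent that depends on [s] alone, because neither [p] nor [t] nor the additive
    constant of [g] enters the distortion and curvature constants. Arcs of two steps [d *+ 2] are
    used so that a [g']-step of either direction, taken from a suitable half of the arc, stays
    inside it. Slopes are secant slopes throughout, so that the breaks of the iterates matter only
    as places where arcs are cut. *)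

(** * The action of pairs of integers on the line, ordered by [th] *)

Section Action.
Variable R : realType.

(** The translation number [t] enters without any limit: the sign of [n t - k] decides, for all [x]
    at once, whether [G^n] moves [x] by more or by less than [k]. The inverse is carried along to
    have integer powers. *)
Record irrational_lift (G Gi : R -> R) (t : R) : Prop := IrrationalLift {
  il_homo : {homo G : x y / x < y};
  il_cont : continuous G;
  il_per : forall x, G (x + 1) = G x + 1;
  il_K : cancel G Gi;
  il_Ki : cancel Gi G;
  il_lt : forall n (k : int), (0 < n)%N -> n%:R * t < k%:~R ->
    forall x, iter n G x < x + k%:~R;
  il_gt : forall n (k : int), (0 < n)%N -> k%:~R < n%:R * t ->
    forall x, x + k%:~R < iter n G x;
  il_irr : forall n (k : int), (0 < n)%N -> n%:R * t <> k%:~R }.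

Definition iterz (G Gi : R -> R) (q : int) : R -> R :=
  match q with Posz n => iter n G | Negz n => iter n.+1 Gi end.

Variables (G Gi : R -> R) (t : R).
Hypothesis GL : irrational_lift G Gi t.

(* The pair (q, k) acts as x |-> G^q x - k, and th (q, k) is the length of the
   arc of the rotation by t between a point and its image. *)
Definition act (g : int * int) (x : R) : R := iterz G Gi g.1 x - g.2%:~R.

Definition th (g : int * int) : R := g.1%:~R * t - g.2%:~R.

Let Ghomo := il_homo _ _ _ GL.
Let GK := il_K _ _ _ GL.
Let GiK := il_Ki _ _ _ GL.
Let Gper := il_per _ _ _ GL.

Lemma lift_le : {mono G : x y / x <= y}.
Proof. exact: (le_mono Ghomo). Qed.

Lemma lift_inv_homo : {homo Gi : x y / x < y}.
Proof.
move=> x y xy; rewrite ltNge; apply/negP => h.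
by move: h; rewrite -lift_le !GiK leNgt xy.
Qed.

Lemma lift_inv_per x : Gi (x + 1) = Gi x + 1.
Proof. by apply: (can_inj GK); rewrite GiK Gper GiK. Qed.

Lemma iterz_succ q x : iterz G Gi (q + 1) x = G (iterz G Gi q x).
Proof.
case: q => [n|[|n]].
- by have -> : n%:Z + 1 = n.+1%:Z by lia.
- by rewrite /= GiK.
- by have -> : Negz n.+1 + 1 = Negz n; [lia|rewrite /= GiK].
Qed.

Lemma iterz_pred q x : iterz G Gi (q - 1) x = Gi (iterz G Gi q x).
Proof. by apply: (can_inj GK); rewrite GiK -iterz_succ subrK. Qed.

Lemma iterzD q q' x : iterz G Gi (q + q') x = iterz G Gi q (iterz G Gi q' x).
Proof.
elim: q => [|n ih|n ih]; first by rewrite add0r.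
- by rewrite intS [1 + _]addrC iterz_succ -ih -iterz_succ; congr iterz; lia.
- have -> : - n.+1%:Z = - n%:Z - 1 by lia.
  by rewrite iterz_pred -ih -iterz_pred; congr iterz; lia.
Qed.

Lemma iterz_homo q : {homo iterz G Gi q : x y / x < y}.
Proof.
case: q => n x y xy; first by elim: n => //= n; exact: Ghomo.
by apply: lift_inv_homo; elim: n => //= n; exact: lift_inv_homo.
Qed.

Lemma per_int (f : R -> R) : (forall x, f (x + 1) = f x + 1) ->
  forall (k : int) x, f (x + k%:~R) = f x + k%:~R.
Proof.
move=> fper; elim=> [|n ih|n ih] x; first by rewrite !addr0.
- by rewrite intS [1 + _]addrC !rmorphD /= !addrA fper ih.
- have -> : f x = f (x + (- n%:Z)%:~R) + n%:R.
    by rewrite ih rmorphN /= -pmulrn subrK.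
  have -> : x + (- n%:Z)%:~R = x + (- n.+1%:Z)%:~R + 1.
    by rewrite -addrA; congr +%R; rewrite !rmorphN /= -!pmulrn -natr1; ring.
  by rewrite fper !rmorphN /= -!pmulrn -natr1; ring.
Qed.

Lemma iterz_per q x : iterz G Gi q (x + 1) = iterz G Gi q x + 1.
Proof.
case: q => n; first by elim: n => //= n ->; exact: Gper.
by elim: n => [|n]; rewrite ?[iterz _ _ _ _]/= ?lift_inv_per // => ->;
  rewrite lift_inv_per.
Qed.

Lemma act0 x : act 0 x = x.
Proof. by rewrite /act subr0. Qed.

Lemma actD g g' x : act (g + g') x = act g (act g' x).
Proof.
rewrite /act /= iterzD -[- g'.2%:~R]rmorphN per_int; last exact: iterz_per.
by rewrite rmorphN rmorphD /= opprD -!addrA; congr +%R; rewrite addrC.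
Qed.

Lemma actK g x : act (- g) (act g x) = x.
Proof. by rewrite -actD addNr act0. Qed.

Lemma actNK g x : act g (act (- g) x) = x.
Proof. by rewrite -actD addrN act0. Qed.

Lemma act_homo g : {homo act g : x y / x < y}.
Proof. by move=> x y xy; rewrite ltrD2r iterz_homo. Qed.

Lemma act_le g : {mono act g : x y / x <= y}.
Proof. exact: (le_mono (act_homo g)). Qed.

Lemma act_lt g : {mono act g : x y / x < y}.
Proof. exact: (leW_mono (act_le g)). Qed.

Lemma act_per g x : act g (x + 1) = act g x + 1.
Proof. by rewrite /act iterz_per addrAC. Qed.

Lemma act_nat n x : act (n%:Z, 0) x = iter n G x.
Proof. by rewrite /act /= subr0. Qed.

Lemma act_posE n k x : act (n%:Z, k) x = iter n G x - k%:~R.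
Proof. by []. Qed.

Lemma thD g g' : th (g + g') = th g + th g'.
Proof. by rewrite /th /= !rmorphD /=; ring. Qed.

Lemma thN g : th (- g) = - th g.
Proof. by rewrite /th /= !rmorphN /=; ring. Qed.

Lemma th0 : th 0 = 0.
Proof. by rewrite /th /= mul0r subr0. Qed.

Lemma thMn g n : th (g *+ n) = th g *+ n.
Proof. by elim: n => [|n ih]; rewrite ?th0 // !mulrS thD ih. Qed.

Lemma thMr g n : th (g *+ n) = n%:R * th g.
Proof. by rewrite thMn mulr_natl. Qed.

(** Through this lemma every comparison of images of a point becomes a linear inequality between
    values of [th]. *)
Lemma th_gt0_act g x : 0 < th g -> x < act g x.
Proof.
case: g => -[[|n]|n] k; rewrite /th /act /= => h.
- by move: h; rewrite mul0r; lra.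
- rewrite ltrBrDr; apply: (il_gt _ _ _ GL n.+1) => //.
  by move: h; rewrite -pmulrn; lra.
(* For a negative power, applying [G^(n+1)] to both sides reduces the claim to [il_lt]. *)
- have := @act_lt (n.+1%:Z, 0) x (iter n.+1 Gi x - k%:~R).
  rewrite -[iter n.+1 Gi x - _]/(act (Negz n, k) x) -actD.
  rewrite (_ : _ + _ = (0, k)); last by apply/eqP; rewrite xpair_eqE /=; lia.
  rewrite act_nat /act /= => <-.
  have := il_lt _ _ _ GL n.+1 (- k) isT _ x; rewrite rmorphN; apply.
  by move: h; rewrite NegzE rmorphN /= -pmulrn; lra.
Qed.

Lemma th_lt_act g g' x : th g < th g' -> act g x < act g' x.
Proof.
move=> h; rewrite -[g'](subrK g) actD; apply: th_gt0_act.
by rewrite thD thN subr_gt0.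
Qed.

Lemma th_eq0 g : (th g == 0) = (g == 0).
Proof.
apply/idP/eqP => [|->]; last by rewrite th0.
case: g => -[[|n]|n] k; rewrite /th /= subr_eq0 => /eqP.
- by rewrite mul0r => /esym/eqP; rewrite intr_eq0 => /eqP ->.
- by rewrite -pmulrn => /(il_irr _ _ _ GL n.+1 k isT).
- rewrite NegzE rmorphN /= -pmulrn mulNr => h.
  by case: (il_irr _ _ _ GL n.+1 (- k) isT); rewrite rmorphN /= -h opprK.
Qed.

Lemma th_le_act g g' x : th g <= th g' -> act g x <= act g' x.
Proof.
rewrite le_eqVlt => /orP[/eqP h|/th_lt_act -/(_ x)/ltW//].
have : th (g - g') == 0 by rewrite thD thN h subrr.
by rewrite th_eq0 subr_eq0 => /eqP ->.
Qed.

Lemma act_cont g : continuous (act g).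
Proof.
have Gicont : continuous Gi.
  move=> x; apply/cvgrPdist_lt => e e0.
  have h1 : G (Gi x - e) < x by rewrite -{2}[x]GiK; apply: Ghomo; lra.
  have h2 : x < G (Gi x + e) by rewrite -{1}[x]GiK; apply: Ghomo; lra.
  near=> y.
  have y1 : G (Gi x - e) < y by near: y; exact: lt_nbhsr.
  have y2 : y < G (Gi x + e) by near: y; exact: lt_nbhsl.
  have := lift_inv_homo _ _ y1; have := lift_inv_homo _ _ y2; rewrite !GK.
  by move=> a b; rewrite ltr_norml; apply/andP; split; lra.
have cI (f : R -> R) n : continuous f -> continuous (iter n f).
  move=> fc; elim: n => [|n ih] x /=; first exact: cvg_id.
  by apply: (@continuous_comp _ _ _ (iter n f) f); [exact: ih|exact: fc].
move=> x; rewrite /act; apply: cvgB; last exact: cvg_cst.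
by case: g.1 => n; [exact: (cI _ _ (il_cont _ _ _ GL))|exact: (cI _ n.+1)].
Unshelve. all: by end_near. Qed.

(** The displacement has period 1, so its minimum over [[0, 1]] is global. *)
Lemma min_step_ex g : exists x, forall y, act g x - x <= act g y - y.
Proof.
have [|x _ xm] := @EVT_min R (fun x => act g x - x) 0 1 ler01.
  apply: continuous_subspaceT => x.
  by apply: cvgB; [exact: act_cont|exact: cvg_id].
exists x => y.
have := xm (y - (Num.floor y)%:~R).
rewrite -[- (Num.floor y)%:~R]rmorphN per_int; last exact: act_per.
rewrite (_ : act g y + (- Num.floor y)%:~R - (y + (- Num.floor y)%:~R) =
  act g y - y); last by ring.
apply; rewrite in_itv /= rmorphN /= subr_ge0 floor_le /=.
by rewrite lerBlDr addrC ltW // -[1]/(1%:~R) -rmorphD floorD1_gt.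
Qed.

Definition argmin g : R := sval (cid (min_step_ex g)).

Definition width g : R := act g (argmin g) - argmin g.

Lemma width_le g x : width g <= act g x - x.
Proof. by rewrite /width /argmin; case: cid => y. Qed.

Lemma width_gt0 g : 0 < th g -> 0 < width g.
Proof. by move=> h; rewrite subr_gt0 th_gt0_act. Qed.

Lemma widthD g g' : width g + width g' <= width (g + g').
Proof.
rewrite {3}/width actD; set x := argmin _.
by have := width_le g (act g' x); have := width_le g' x; lra.
Qed.

Lemma width_mono g g' : th g <= th g' -> width g <= width g'.
Proof.
move=> /th_le_act h; rewrite {2}/width.
by apply: le_trans (width_le _ (argmin g')) _; rewrite lerD2r.
Qed.

Lemma widthMn g n : (0 < n)%N -> width g *+ n <= width (g *+ n).
Proof.
case: n => // n _; elim: n => [|n ih]; first by rewrite !mulr1n.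
by rewrite mulrS [g *+ _]mulrS; apply: le_trans (widthD _ _); rewrite lerD2l.
Qed.

(** The largest multiple of [g] below [g'] in the order of [th] is compared with [g'], and [width]
    is superadditive; the [- 1] pays for the rounding. *)
Lemma width_floor g g' : 0 < th g -> th g <= th g' ->
  (th g' / th g - 1) * width g <= width g'.
Proof.
move=> g0 gg'; have r1 : 1 <= th g' / th g by rewrite ler_pdivlMr ?mul1r.
pose n := Num.truncn (th g' / th g).
have /andP[n1 n2] := truncn_itv (le_trans ler01 r1).
have n0 : (0 < n)%N by rewrite truncn_gt0.
have : th (g *+ n) <= th g'.
  by rewrite thMn -mulr_natr mulrC -ler_pdivlMr.
move=> /width_mono; apply: le_trans; apply: le_trans (widthMn _ _ n0).
rewrite -[_ *+ n]mulr_natl ler_wpM2r ?(ltW (width_gt0 _ _)) //.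
by rewrite lerBlDr natr1 ltW.
Qed.

End Action.

(** * The continued fraction expansion of [t] *)

Section Levels.
Variable R : realType.
Variable t : R.
Hypothesis tirr : forall n (k : int), (0 < n)%N -> n%:R * t <> k%:~R.

Local Notation th := (th R t).

(* (q, k) and (q', k') are consecutive convergents k / q, k' / q' of t; lv_det
   says that q k' - q' k is 1 or -1. *)
Record level (q : nat) (k : int) (q' : nat) (k' : int) : Prop := Level {
  lv_le : (q <= q')%N;
  lv_gt0 : (0 < q')%N;
  lv_sgn : th (q%:Z, k) * th (q'%:Z, k') < 0;
  lv_lt : `|th (q'%:Z, k')| < `|th (q%:Z, k)|;
  lv_det : q'%:R * `|th (q%:Z, k)| + q%:R * `|th (q'%:Z, k')| = 1 }.

Lemma th_nat q k : th (q%:Z, k) = q%:R * t - k%:~R.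
Proof. by rewrite -[LHS]/(q%:~R * t - k%:~R) -pmulrn. Qed.

(** The expansion starts at the formal convergent 1/0; this is why [level] allows [q = 0]. *)
Lemma level_ex0 : level 0 1 1 (Num.floor t).
Proof.
have h1 : (Num.floor t)%:~R <= t := floor_le t.
have h2 : t < (Num.floor t)%:~R + 1.
  by rewrite -[1]/(1%:~R) -rmorphD floorD1_gt.
have h3 : (Num.floor t)%:~R != t.
  by apply/eqP => /esym; rewrite -[t in t = _]mul1r; exact: (tirr 1).
have h4 : 0 < t - (Num.floor t)%:~R by rewrite subr_gt0 lt_neqAle h3.
have e0 : th (0%:Z, 1) = - 1 by rewrite th_nat mul0r sub0r.
have e1 : th (1%:Z, Num.floor t) = t - (Num.floor t)%:~R by rewrite th_nat mul1r.
by split=> //; rewrite e0 e1 ?normrN ?normr1 ?(gtr0_norm h4); lra.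
Qed.

(** One Euclidean division of [|th g|] by [|th g'|]. The quotient is at least 1 and the remainder is
    below the divisor, so the remainder is less than half of the dividend. *)
Lemma level_next q k q' k' : level q k q' k' ->
  exists q'' k'', level q' k' q'' k'' /\
    2 * `|th (q''%:Z, k'')| < `|th (q%:Z, k)|.
Proof.
move=> [qq' q'0 sg lt det].
set a := th (q%:Z, k) in sg lt det *; set b := th (q'%:Z, k') in sg lt det *.
have b0 : 0 < `|b|.
  by rewrite normr_gt0; apply: contraTneq sg => ->; rewrite mulr0 ltxx.
pose n := Num.truncn (`|a| / `|b|).
have r1 : 1 < `|a| / `|b| by rewrite ltr_pdivlMr ?mul1r.
have /andP[n1 n2] := truncn_itv (le_trans ler01 (ltW r1)).
have n0 : (0 < n)%N by rewrite truncn_gt0 ltW.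
rewrite -/n in n1 n2.
rewrite ler_pdivlMr // in n1; rewrite ltr_pdivrMr // -natr1 mulrDl mul1r in n2.
have n1' : 1 <= n%:R :> R by rewrite ler1n.
exists (q + n * q')%N, (k + n%:Z * k').
have e : th ((q + n * q')%:Z, k + n%:Z * k') = a + n%:R * b.
  rewrite /a /b !th_nat natrD natrM rmorphD rmorphM /= -pmulrn; ring.
have ne : a + n%:R * b != 0.
  rewrite -e th_nat subr_eq0; apply/eqP/tirr.
  by rewrite addn_gt0 muln_gt0 n0 q'0 orbT.
have : `|a + n%:R * b| = `|a| - n%:R * `|b| /\ b * (a + n%:R * b) < 0.
  have [b'|b'|b'] := ltgtP 0 b; last by rewrite -b' normr0 ltxx in b0.
  - have a' : a < 0 by rewrite -(pmulr_llt0 _ b').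
    rewrite (ltr0_norm a') (gtr0_norm b') in n1 n2 *.
    have h : a + n%:R * b < 0 by rewrite lt_neqAle ne /=; lra.
    by rewrite (ltr0_norm h); split; [lra|rewrite pmulr_rlt0].
  - have a' : 0 < a by rewrite -(nmulr_llt0 _ b').
    rewrite (gtr0_norm a') (ltr0_norm b') in n1 n2 *.
    have h : 0 < a + n%:R * b by rewrite lt_neqAle eq_sym ne /=; lra.
    by rewrite (gtr0_norm h); split; [lra|rewrite nmulr_rlt0].
move=> [eN sg'].
split; last by rewrite e eN; nra.
split; rewrite ?e ?eN -/b ?addn_gt0 ?muln_gt0 ?n0 ?q'0 ?orbT //.
- by rewrite (leq_trans _ (leq_addl _ _)) // leq_pmull.
- by lra.
- by rewrite natrD natrM -[RHS]det; ring.
Qed.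

Lemma levels_ex : exists (q : nat -> nat) (k : nat -> int),
  forall n, level (q n) (k n) (q n.+1) (k n.+1) /\
    2 * `|th ((q n.+2)%:Z, k n.+2)| < `|th ((q n)%:Z, k n)|.
Proof.
pose T := {x : (nat * int) * (nat * int) | level x.1.1 x.1.2 x.2.1 x.2.2}.
have next_ex (x : T) : exists y : T, (sval y).1 = (sval x).2 /\
    2 * `|th ((sval y).2.1%:Z, (sval y).2.2)| <
    `|th ((sval x).1.1%:Z, (sval x).1.2)|.
  case: x => -[[q k] [q' k']] /= l.
  have [q'' [k'' [l' h]]] := level_next _ _ _ _ l.
  by exists (exist _ ((q', k'), (q'', k'')) l').
have [next nextP] := choice next_ex.
pose x n := iter n next (exist _ ((0%N, 1), (1%N, Num.floor t)) level_ex0).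
exists (fun n => (sval (x n)).1.1), (fun n => (sval (x n)).1.2) => n.
have [/= e1 l1] := nextP (x n); have [/= e2 _] := nextP (x n.+1).
rewrite e2 e1; split; last by [].
by case: (x n).
Qed.

Lemma levels_th_lt (q : nat -> nat) (k : nat -> int) :
  (forall n, 2 * `|th ((q n.+2)%:Z, k n.+2)| < `|th ((q n)%:Z, k n)|) ->
  forall e N, 0 < e -> exists2 n, (N <= n)%N & `|th ((q n)%:Z, k n)| < e.
Proof.
move=> h e N e0.
have hj j : 2 ^+ j * `|th ((q (N + j.*2)%N)%:Z, k (N + j.*2)%N)| <=
    `|th ((q N)%:Z, k N)|.
  elim: j => [|j ih]; first by rewrite mul1r addn0.
  apply: le_trans ih; rewrite doubleS !addnS exprSr -mulrA.
  by rewrite ler_wpM2l ?exprn_ge0 // ltW.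
pose A := `|th ((q N)%:Z, k N)| / e.
have A0 : 0 <= A by rewrite divr_ge0 // ltW.
pose j := (Num.truncn A).+1.
have Aj : A < 2 ^+ j.
  by apply: lt_le_trans (truncnS_gt A) _; rewrite -natrX ler_nat ltnW // ltn_expl.
exists (N + j.*2)%N; first by rewrite leq_addr.
have p0 : 0 < 2 ^+ j :> R by rewrite exprn_gt0.
rewrite -(ltr_pM2l p0); apply: le_lt_trans (hj j) _.
by rewrite -ltr_pdivrMr.
Qed.

Section Level.
Variables (q q' : nat) (k k' : int).
Hypothesis lv : level q k q' k'.

Local Notation g := (q%:Z, k).
Local Notation g' := (q'%:Z, k').

Lemma level_th_neq0 : th g != 0.
Proof. by apply: contraTneq (lv_sgn _ _ _ _ lv) => ->; rewrite mul0r ltxx. Qed.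

Lemma level_det_int : exists2 s : int, (s == 1) || (s == -1) &
  s%:~R * th g = `|th g| /\ q%:Z * k' - q'%:Z * k = s.
Proof.
have [qq' q'0 sg lt det] := lv.
have e : (q%:Z * k' - q'%:Z * k)%:~R = q'%:R * th g - q%:R * th g' :> R.
  by rewrite !th_nat rmorphB !rmorphM /= -!pmulrn; ring.
have [a0|a0|a0] := ltgtP 0 (th g); last first.
- by move: level_th_neq0; rewrite -a0 eqxx.
- have b0 : 0 < th g' by rewrite -(nmulr_rlt0 _ a0).
  rewrite (ltr0_norm a0) (gtr0_norm b0) in det *.
  exists (-1); rewrite ?eqxx ?orbT //; split; first by rewrite mulN1r.
  by apply/eqP; rewrite -(eqr_int R) e; apply/eqP; lra.
- have b0 : th g' < 0 by rewrite -(pmulr_rlt0 _ a0).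
  rewrite (gtr0_norm a0) (ltr0_norm b0) in det *.
  exists 1; rewrite ?eqxx //; split; first by rewrite mul1r.
  by apply/eqP; rewrite -(eqr_int R) e; apply/eqP; lra.
Qed.

(** Cramer's rule writes [(i, l)] as [u g + v g'] with integers [u] and [v]. The range of [i] forces
    [u <> 0] and excludes that [u] and [v] have the same sign; as [th g] and [th g'] have opposite
    signs, the two contributions to [th] cannot cancel. *)
Lemma level_best (i : nat) (l : int) : (0 < i < q')%N ->
  `|th g| <= `|th (i%:Z, l)|.
Proof.
move=> /andP[i0 iq'].
have [qq' q'0 sg lt det] := lv.
have [s s1 [_ ds]] := level_det_int.
have ss : s * s = 1 by case/orP: s1 => /eqP ->.
pose u := s * (i%:Z * k' - l * q'%:Z); pose v := s * (q%:Z * l - k * i%:Z).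
have e1 : i%:Z = u * q%:Z + v * q'%:Z.
  transitivity (s * s * i%:Z); first by rewrite ss mul1r.
  by rewrite -{2}ds /u /v; ring.
have e2 : l = u * k + v * k'.
  transitivity (s * s * l); first by rewrite ss mul1r.
  by rewrite -{2}ds /u /v; ring.
have e : th (i%:Z, l) = u%:~R * th g + v%:~R * th g'.
  have e1' : i%:R = u%:~R * q%:R + v%:~R * q'%:R :> R.
    by rewrite 3!pmulrn e1 rmorphD !rmorphM.
  by rewrite !th_nat e1' e2 rmorphD !rmorphM /=; ring.
have u0 : u != 0.
  apply/eqP => u0; move: e1; rewrite u0 mul0r add0r => e1.
  have v0 : 0 < v by nia.
  by move: iq'; nia.
have [uv|uv] := ltP (u * v) 0; last first.
  case: (eqVneq v 0) => [v0|v0].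
    rewrite e v0 mul0r addr0 normrM ler_peMl // -intr_norm.
    by rewrite -[1]/(1%:~R) ler_int; lia.
  exfalso.
  have [u0'|u0'] := ltP 0 u.
    have v0' : 0 < v by nia.
    by move: iq' e1; nia.
  have v0' : v < 0 by nia.
  by move: i0 e1; nia.
have v1 : (1 <= `|u|)%R by lia.
have u1 : 1 <= `|u%:~R| :> R by rewrite -intr_norm -[1]/(1%:~R) ler_int.
have : `|u%:~R * th g + v%:~R * th g'| =
    `|u%:~R| * `|th g| + `|v%:~R| * `|th g'|.
  rewrite -!normrM; have : 0 <= u%:~R * th g * (v%:~R * th g') :> R.
    rewrite mulrACA mulr_le0 ?(ltW sg) // -rmorphM /= ltW //.
    by rewrite -[0]/(0%:~R) ltr_int.
  have [/= x0|/= x0] := leP 0 (u%:~R * th g : R) => h.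
    have [/= y0|/= y0] := leP 0 (v%:~R * th g' : R); first by rewrite !ger0_norm ?addr_ge0.
    have -> : u%:~R * th g = 0 :> R by nra.
    by rewrite !add0r normr0 add0r.
  have y0 : v%:~R * th g' <= 0 :> R by nra.
  by rewrite !ler0_norm; lra.
rewrite -e => ->.
have := normr_ge0 (th g); have := normr_ge0 (th g').
have := normr_ge0 (v%:~R : R); move: u1.
move: `|u%:~R| `|v%:~R| `|th g| `|th g'| => *.
by nra.
Qed.

Lemma level_th_le : q'%:R * `|th g| <= 1.
Proof. by rewrite -[leRHS](lv_det _ _ _ _ lv) lerDl mulr_ge0. Qed.

End Level.
End Levels.

(** * Distortion and curvature of a map with one break *)

Section BreakLaw.
Variable R : realType.

Definition slope (f : R -> R) (u v : R) : R := (f v - f u) / (v - u).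

Definition lnslope (f : R -> R) (u v : R) : R := ln (slope f u v).

(** The ends may be breaks, so cutting an arc at a break leaves two admissible pieces. *)
Definition break_free (p u v : R) : Prop :=
  exists m : int, p + m%:~R <= u /\ v <= p + m%:~R + 1.

(** Logarithms of secant slopes add up along orbits ([lnslope_iter]) without any derivative at the
    break. The sign in [bl_curved] is the same for all break free arcs: curvatures along an orbit
    accumulate instead of cancelling. *)
Record break_law (G : R -> R) (p V K0 K1 : R) : Prop := BreakLaw {
  bl_slope : forall u v, u < v -> `|lnslope G u v| <= V;
  bl_smooth : forall a b u v u' v', break_free p a b ->
    a <= u -> u < v -> v <= b -> a <= u' -> u' < v' -> v' <= b ->
    `|lnslope G u v - lnslope G u' v'| <= K1 * (b - a);
  bl_curved : exists2 s : R, s = 1 \/ s = -1 &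
    forall y1 y2 y3, break_free p y1 y3 -> y1 < y2 -> y2 < y3 ->
    K0 * (y3 - y1) <= s * (lnslope G y2 y3 - lnslope G y1 y2) }.

Lemma break_freeS p a b u v :
  break_free p a b -> a <= u -> v <= b -> break_free p u v.
Proof. by move=> [m [m1 m2]] au vb; exists m; lra. Qed.

Lemma nbreak_free p a b : ~ break_free p a b -> exists m : int,
  a < p + m%:~R < b.
Proof.
move=> nb; pose m := Num.floor (a - p).
have h1 : m%:~R <= a - p := floor_le _.
have h2 : a - p < m%:~R + 1 by rewrite -[1]/(1%:~R) -rmorphD floorD1_gt.
exists (m + 1); rewrite rmorphD /=; apply/andP; split; first by lra.
by rewrite ltNge; apply/negP => h; apply: nb; exists m; lra.
Qed.

(** Both sides telescope to the same difference of sums. It trades [q'] displacements under [G^q]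
    for [q] displacements under [G^q']. *)
Lemma sum_shift_swap (X : nat -> R) m n :
  \sum_(i < m) (X (i + n)%N - X i) = \sum_(j < n) (X (j + m)%N - X j).
Proof.
elim: m => [|m ih].
  by rewrite big_ord0 big1 // => j _; rewrite addn0 subrr.
rewrite big_ord_recr /= ih.
have -> : X (m + n)%N - X m = \sum_(j < n) (X (j + m.+1)%N - X (j + m)%N).
  rewrite -(big_mkord xpredT (fun j => X (j + m.+1)%N - X (j + m)%N)).
  rewrite (eq_bigr (fun j => X (j.+1 + m)%N - X (j + m)%N)); last first.
    by move=> j _; rewrite addnS addSn.
  by rewrite telescope_sumr // addnC add0n.
by rewrite -big_split /=; apply: eq_bigr => j _; ring.
Qed.

Lemma sum_unique_le (P : nat -> Prop) n (c : R) : 0 <= c ->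
  (forall i j, (i < j < n)%N -> P i -> P j -> False) ->
  \sum_(i < n) (if `[< P i >] then c else 0) <= c.
Proof.
move=> c0 uP; case: (pickP (fun i : 'I_n => `[< P i >])) => [i Pi|nP]; last first.
  by rewrite big1 // => i _; rewrite nP.
rewrite (bigD1 i) //= Pi big1 ?addr0 // => j ji.
case: asboolP => // Pj; have /asboolP Pi' := Pi.
have [ij|ij|/val_inj ij] := ltngtP i j; last by rewrite ij eqxx in ji.
- by case: (uP i j); rewrite ?ij ?ltn_ord.
- by case: (uP j i); rewrite ?ij ?ltn_ord.
Qed.

Lemma lnslope_iter (G : R -> R) : {homo G : x y / x < y} ->
  forall n u v, u < v -> lnslope (iter n G) u v =
    \sum_(i < n) lnslope G (iter i G u) (iter i G v).
Proof.
move=> Gh n u v uv.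
have Ih i : iter i G u < iter i G v by elim: i => //= i; exact: Gh.
elim: n => [|n ih]; first by rewrite big_ord0 /lnslope /slope divff ?ln1 // subr_eq0 gt_eqF.
rewrite big_ord_recr /= -ih /lnslope /slope /=.
have h1 : 0 < iter n G v - iter n G u by rewrite subr_gt0.
have h2 : 0 < G (iter n G v) - G (iter n G u) by rewrite subr_gt0 Gh.
have h3 : 0 < v - u by rewrite subr_gt0.
rewrite -lnM ?posrE ?divr_gt0 //; congr ln.
by field; rewrite !gt_eqF.
Qed.

End BreakLaw.

(** * The orbit of an arc up to the return time *)

Section Sums.
Variable R : realType.
Variables (G Gi : R -> R) (t : R).
Hypothesis GL : irrational_lift R G Gi t.
Variables (q q' : nat) (k k' : int).
Hypothesis lv : level R t q k q' k'.

Local Notation th := (th R t).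
Local Notation act := (act R G Gi).
Local Notation g := (q%:Z, k).
Local Notation g' := (q'%:Z, k').

(** The one of [a] and [- a] that moves points to the right, when [th a] is not zero. *)
Definition pos (a : int * int) : int * int := if 0 < th a then a else - a.

Lemma th_pos a : th (pos a) = `|th a|.
Proof.
by rewrite /pos; case: ltP => h; rewrite ?(gtr0_norm h) // thN (ler0_norm h).
Qed.

Local Notation d := (pos g).

Lemma iter_act i a x : iter i G (act a x) = act a (iter i G x).
Proof. by rewrite -!(act_nat _ _ Gi) -!(actD _ _ _ _ GL) addrC. Qed.

(** The arcs are disjoint on the circle, but the bound is obtained from [sum_shift_swap]: the total
    [g]-displacement is the determinant of the level, which is 1 or -1 with the sign of [th g], plus
    [g']-displacements of the opposite sign. *)
Lemma sum_step_le1 x :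
  \sum_(i < q') (act d (iter i G x) - iter i G x) <= 1.
Proof.
have [qq' q'0 sg lt det] := lv.
have key y : let S := \sum_(i < q') (act g (iter i G y) - iter i G y) in
    (0 < th g -> S <= 1) /\ (th g < 0 -> -1 <= S).
  have -> /= : \sum_(i < q') (act g (iter i G y) - iter i G y) =
      \sum_(j < q) (act g' (iter j G y) - iter j G y) +
      (q%:Z * k' - q'%:Z * k)%:~R.
    pose X i := iter i G y.
    transitivity (\sum_(i < q') (X (i + q)%N - X i) - \sum_(i < q') k%:~R).
      by rewrite -sumrB; apply: eq_bigr => i _; rewrite act_posE /X (addnC i q) iterD addrAC.
    rewrite (sum_shift_swap _ X q' q).
    rewrite (eq_bigr (fun j : 'I_q => act g' (X j) - X j + k'%:~R)); last first.
      by move=> j _; rewrite act_posE /X (addnC j _) iterD; ring.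
    rewrite big_split /= !sumr_const !card_ord rmorphB !rmorphM /=.
    by rewrite -!pmulrn -[k'%:~R *+ q]mulr_natl -[k%:~R *+ q']mulr_natl; ring.
  have [s s1 [h1 h2]] := level_det_int _ _ _ _ _ _ lv; rewrite h2.
  split=> h.
  - have g'0 : th g' < 0 by rewrite -(pmulr_rlt0 _ h).
    have -> : s = 1.
      by case/orP: s1 h1 => /eqP -> //; rewrite mulN1r (gtr0_norm h) => ?; exfalso; lra.
    rewrite -subr_ge0 opprD addrA addrAC subrr add0r -sumrN.
    apply: sumr_ge0 => i _; rewrite opprB subr_ge0 -[leRHS](act0 _ G Gi).
    by apply: (th_le_act _ _ _ _ GL); rewrite th0 ltW.
  - have g'0 : 0 < th g' by rewrite -(nmulr_rlt0 _ h).
    have -> : s = -1.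
      by case/orP: s1 h1 => /eqP -> //; rewrite mul1r (ltr0_norm h) => ?; exfalso; lra.
    rewrite lerDr; apply: sumr_ge0 => i _; rewrite subr_ge0 ltW //.
    exact: (th_gt0_act _ _ _ _ GL).
rewrite /pos; case: ltP => h; first by have [] := key x; tauto.
have h' : th g < 0 by rewrite lt_neqAle h andbT (level_th_neq0 _ _ _ _ _ _ lv).
(* Here [d] is [- g], and a [d]-step from a point is the reversed [g]-step from its image under
   [- g]. *)
have [_ /(_ h')] := key (act (- g) x).
rewrite lerNl -sumrN; apply: le_trans; rewrite le_eqVlt; apply/orP; left.
apply/eqP/eq_bigr => i _.
by rewrite iter_act (actNK _ _ _ _ GL) opprB.
Qed.

(** The arcs cover the circle. The computation is that of [sum_step_le1] with [g' + g] in place of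
    [g']; by [lv_lt] it moves points in the same direction as [g]. *)
Lemma sum_step_ge1 x :
  1 <= \sum_(i < q' + q) (act d (iter i G x) - iter i G x).
Proof.
have [qq' q'0 sg lt det] := lv.
have key y : let S := \sum_(i < q' + q) (act g (iter i G y) - iter i G y) in
    (0 < th g -> 1 <= S) /\ (th g < 0 -> S <= -1).
  have -> /= : \sum_(i < q' + q) (act g (iter i G y) - iter i G y) =
      \sum_(j < q) (act (g' + g) (iter j G y) - iter j G y) +
      (q%:Z * k' - q'%:Z * k)%:~R.
    pose X i := iter i G y.
    transitivity (\sum_(i < q' + q) (X (i + q)%N - X i) -
        \sum_(i < q' + q) k%:~R).
      by rewrite -sumrB; apply: eq_bigr => i _; rewrite act_posE /X (addnC i q) iterD addrAC.
    rewrite (sum_shift_swap _ X (q' + q) q).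
    rewrite (eq_bigr (fun j : 'I_q =>
      act (g' + g) (X j) - X j + (k' + k)%:~R)); last first.
      move=> j _; rewrite (_ : g' + g = ((q' + q)%N%:Z, k' + k)) // act_posE.
      by rewrite /X (addnC j _) iterD; ring.
    rewrite big_split /= !sumr_const !card_ord rmorphB !rmorphM /=.
    rewrite -!pmulrn -[_ *+ q]mulr_natl -[k%:~R *+ _]mulr_natl rmorphD natrD /=.
    by ring.
  have [s s1 [h1 h2]] := level_det_int _ _ _ _ _ _ lv; rewrite h2.
  split=> h.
  - have g'0 : th g' < 0 by rewrite -(pmulr_rlt0 _ h).
    have gg'0 : 0 < th (g' + g).
      by move: lt; rewrite thD (gtr0_norm h) (ltr0_norm g'0); lra.
    have -> : s = 1.
      by case/orP: s1 h1 => /eqP -> //; rewrite mulN1r (gtr0_norm h) => ?; exfalso; lra.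
    rewrite lerDr; apply: sumr_ge0 => i _; rewrite subr_ge0 ltW //.
    exact: (th_gt0_act _ _ _ _ GL).
  - have g'0 : 0 < th g' by rewrite -(nmulr_rlt0 _ h).
    have gg'0 : th (g' + g) < 0.
      by move: lt; rewrite thD (ltr0_norm h) (gtr0_norm g'0); lra.
    have -> : s = -1.
      by case/orP: s1 h1 => /eqP -> //; rewrite mul1r (ltr0_norm h) => ?; exfalso; lra.
    rewrite -subr_ge0 opprD addrA addrAC subrr add0r -sumrN.
    apply: sumr_ge0 => i _; rewrite opprB subr_ge0 -[leRHS](act0 _ G Gi).
    by apply: (th_le_act _ _ _ _ GL); rewrite th0 ltW.
rewrite /pos; case: ltP => h; first by have [] := key x; tauto.
have h' : th g < 0 by rewrite lt_neqAle h andbT (level_th_neq0 _ _ _ _ _ _ lv).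
have [_ /(_ h')] := key (act (- g) x).
rewrite lerNr -sumrN => /le_trans; apply; rewrite le_eqVlt; apply/orP; left.
apply/eqP/eq_bigr => i _.
by rewrite iter_act (actNK _ _ _ _ GL) opprB.
Qed.

(** By [level_best] the step from the [i]-th arc to any translate of the [j]-th is at least as long
    as the arc, so the arcs are disjoint on the circle. *)
Lemma hit_unique (P x : R) i j : (i < j < q')%N ->
  (exists m : int, iter i G x <= P + m%:~R < act d (iter i G x)) ->
  (exists m : int, iter j G x <= P + m%:~R < act d (iter j G x)) -> False.
Proof.
move=> /andP[ij jq'] [m /andP[m1 m2]] [n /andP[n1 n2]].
pose a := ((j - i)%N%:Z, n - m).
have ea : act a (iter i G x) = iter j G x - (n - m)%:~R.
  by rewrite act_posE -iterD subnK // ltnW.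
have : th d <= `|th a|.
  rewrite th_pos; apply: (level_best _ _ _ _ _ _ lv).
  by rewrite subn_gt0 ij (leq_ltn_trans (leq_subr _ _)).
have [a0|a0] := leP 0 (th a).
- rewrite (ger0_norm a0) => /(th_le_act _ _ _ _ GL _ _ (iter i G x)); rewrite ea rmorphB /=.
  by lra.
- rewrite (ltr0_norm a0) -thN => /(th_le_act _ _ _ _ GL _ _ (act a (iter i G x))).
  rewrite (actK _ _ _ _ GL) ea.
  have -> : act d (iter j G x - (n - m)%:~R) = act d (iter j G x) - (n - m)%:~R.
    rewrite -[- (n - m)%:~R]rmorphN; apply: per_int => y.
    exact: (act_per _ _ _ _ GL).
  by rewrite rmorphB /=; lra.
Qed.

Section Distortion.
Variables (p V K0 K1 : R).
Hypotheses (V0 : 0 <= V) (K10 : 0 <= K1).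
Hypothesis BL : break_law R G p V K0 K1.

Let Ghomo : {homo G : x y / x < y}. Proof. exact: il_homo GL. Qed.

Lemma iter_homo i : {homo iter i G : x y / x < y}.
Proof. by move=> x y xy; elim: i => //= i; exact: Ghomo. Qed.

Lemma iter_le i : {mono iter i G : x y / x <= y}.
Proof. exact: (le_mono (iter_homo i)). Qed.

Lemma act2 a x : act (a *+ 2) x = act a (act a x).
Proof. by rewrite mulr2n (actD _ _ _ _ GL). Qed.

Lemma th_pos_gt0 : 0 < th d.
Proof. by rewrite th_pos normr_gt0 (level_th_neq0 _ _ _ _ _ _ lv). Qed.

Lemma act_pos_gt x : x < act d x.
Proof. exact: (th_gt0_act _ _ _ _ GL _ _ th_pos_gt0). Qed.

Lemma distortion x u v u' v' n : (n <= q')%N ->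
  x <= u -> u < v -> v <= act (d *+ 2) x ->
  x <= u' -> u' < v' -> v' <= act (d *+ 2) x ->
  `|lnslope R (iter n G) u v - lnslope R (iter n G) u' v'| <= 2 * K1 + 4 * V.
Proof.
move=> nq' xu uv vx xu' uv' vx'.
rewrite !(lnslope_iter _ _ Ghomo) // -sumrB.
pose hit z i := exists m : int, iter i G z <= p + m%:~R < act d (iter i G z).
pose B i := K1 * ((act d (iter i G x) - iter i G x) +
   (act d (iter i G (act d x)) - iter i G (act d x))) +
   (if `[< hit x i >] then 2 * V else 0) +
   (if `[< hit (act d x) i >] then 2 * V else 0).
have V2 : 0 <= 2 * V by move: V0; lra.
have K20 i : 0 <= K1 * (act d (iter i G x) - iter i G x +
    (act d (iter i G (act d x)) - iter i G (act d x))).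
  by apply: mulr_ge0 => //; apply: addr_ge0; rewrite subr_ge0 ltW ?act_pos_gt.
have B0 i : 0 <= B i.
  by apply: addr_ge0; [apply: addr_ge0 => //|]; case: ifP.
have bound (i : nat) : `|lnslope R G (iter i G u) (iter i G v) -
    lnslope R G (iter i G u') (iter i G v')| <= B i.
  have e : act d (iter i G x) - iter i G x +
    (act d (iter i G (act d x)) - iter i G (act d x)) =
    iter i G (act (d *+ 2) x) - iter i G x.
    by rewrite -!iter_act -act2; ring.
  have big : hit x i \/ hit (act d x) i -> 2 * V <= B i.
    have k2 := K20 i; case=> h; rewrite /B (asboolT h); case: ifP => _; lra.
  case: (pselect (hit x i \/ hit (act d x) i)) => [/big|nh].
    apply: le_trans; apply: le_trans (ler_normB _ _) _.
    have := bl_slope _ _ _ _ _ _ BL _ _ (iter_homo i _ _ uv).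
    by have := bl_slope _ _ _ _ _ _ BL _ _ (iter_homo i _ _ uv'); lra.
  have bf : break_free R p (iter i G x) (iter i G (act (d *+ 2) x)).
    apply: contrapT => /nbreak_free[m /andP[m1 m2]]; apply: nh.
    have [h|h] := ltP (p + m%:~R) (iter i G (act d x)).
    - by left; exists m; rewrite -iter_act (ltW m1).
    - by right; exists m; rewrite h -iter_act -act2.
  apply: le_trans (_ : K1 * (iter i G (act (d *+ 2) x) - iter i G x) <= _).
    by apply: (bl_smooth _ _ _ _ _ _ BL _ _ _ _ _ _ bf); rewrite ?iter_le ?iter_homo.
  by rewrite /B e -addrA lerDl addr_ge0 //; case: ifP.
apply: le_trans (ler_norm_sum _ _ _) _.
apply: le_trans (_ : \sum_(i < q') B i <= _).
  apply: le_trans (_ : \sum_(i < n) B i <= _); first by apply: ler_sum => i _.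
  rewrite -!(big_mkord xpredT B) [leRHS](big_cat_nat (leq0n n) nq') //=.
  by rewrite lerDl sumr_ge0.
have hb z : \sum_(i < q') (if `[< hit z i >] then 2 * V else 0) <= 2 * V.
  by apply: sum_unique_le => [|i j ij]; [lra|exact: hit_unique].
rewrite !big_split /= -mulr_sumr big_split /=.
have := hb x; have := hb (act d x).
have h : K1 * (\sum_(i < q') (act d (iter i G x) - iter i G x) +
  \sum_(i < q') (act d (iter i G (act d x)) - iter i G (act d x))) <= K1 * 2.
  apply: ler_wpM2l => //.
  by have := sum_step_le1 x; have := sum_step_le1 (act d x); lra.
by move: h; lra.
Qed.

End Distortion.
End Sums.

(** * Denjoy bounds for orbit sums and for return maps *)

Section Denjoy.
Variable R : realType.
Variables (G Gi : R -> R) (t : R).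
Hypothesis GL : irrational_lift R G Gi t.
Variables (p V K0 K1 : R).
Hypotheses (V0 : 0 <= V) (K10 : 0 <= K1).
Hypothesis BL : break_law R G p V K0 K1.
Variables (q q' : nat) (k k' : int).
Hypothesis lv : level R t q k q' k'.

Local Notation th := (th R t).
Local Notation act := (act R G Gi).
Local Notation g := (q%:Z, k).
Local Notation g' := (q'%:Z, k').
Local Notation d := (pos R t g).

Definition dist_cst (V K1 : R) : R := expR (2 * K1 + 4 * V).
Local Notation E := (dist_cst V K1).

Lemma dist_cst_ge1 : 1 <= E.
Proof. by rewrite -expR0 ler_expR; move: V0 K10; lra. Qed.

Lemma slope_gt0 n u v : u < v -> 0 < slope R (iter n G) u v.
Proof.
by move=> uv; rewrite divr_gt0 ?subr_gt0 // (iter_homo _ _ _ _ GL).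
Qed.

Lemma slope_dist x u v u' v' n : (n <= q')%N ->
  x <= u -> u < v -> v <= act (d *+ 2) x ->
  x <= u' -> u' < v' -> v' <= act (d *+ 2) x ->
  slope R (iter n G) u v <= E * slope R (iter n G) u' v'.
Proof.
move=> nq' xu uv vx xu' uv' vx'.
have h := distortion _ _ _ _ GL _ _ _ _ lv _ _ _ _ V0 K10 BL _ _ _ _ _ _ nq'
  xu uv vx xu' uv' vx'.
have p1 := slope_gt0 n _ _ uv; have p2 := slope_gt0 n _ _ uv'.
have E0 : 0 < E by exact: expR_gt0.
rewrite -ler_ln ?posrE //; last exact: mulr_gt0.
rewrite lnM ?posrE // expRK.
by move: h; rewrite ler_norml /lnslope => /andP[_]; lra.
Qed.

Let a (i : nat) (x : R) := act d (iter i G x) - iter i G x.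

Let a_gt0 i x : 0 < a i x.
Proof. by rewrite subr_gt0 (act_pos_gt _ _ _ _ GL _ _ _ _ lv). Qed.

Let aD i j x : a (i + j) x = a i (iter j G x).
Proof. by rewrite /a iterD. Qed.

Let a_slope i x : a i x = slope R (iter i G) x (act d x) * a 0 x.
Proof.
rewrite /slope (iter_act _ _ _ _ GL) -/(a i x) -/(a 0 x) mulfVK //.
by rewrite gt_eqF ?a_gt0.
Qed.

(* The arcs [x, act d x] and its image by act g' lie in a common arc
   [z, act (d *+ 2) z]. *)
Lemma step_ratio x i : (i <= q')%N ->
  a (i + q') x * a 0 x <= E * (a i x * a q' x) /\
  a i x * a q' x <= E * (a (i + q') x * a 0 x).
Proof.
move=> iq'; have [qq' q'0 sg lt det] := lv.
pose y := act g' x; pose z := if 0 < th g' then x else y.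
have yE : y = iter q' G x - k'%:~R by [].
have tr j : a j y = a j (iter q' G x).
  rewrite /a yE.
  have -> : iter j G (iter q' G x - k'%:~R) = iter j G (iter q' G x) - k'%:~R.
    rewrite -[- k'%:~R]rmorphN; apply: per_int => w.
    by rewrite -!(act_nat _ _ Gi) (act_per _ _ _ _ GL).
  rewrite -[- k'%:~R]rmorphN per_int; last exact: (act_per _ _ _ _ GL).
  by ring.
have dg : `|th g'| < th d by rewrite th_pos.
have [z1 z2 z3 z4] : [/\ z <= x, z <= y, act d x <= act (d *+ 2) z &
   act d y <= act (d *+ 2) z].
  rewrite /z /y; case: ltP => h; rewrite mulr2n.
  - split=> //; rewrite -?(actD _ _ _ _ GL).
    + exact/ltW/(th_gt0_act _ _ _ _ GL).
    + apply: (th_le_act _ _ _ _ GL); rewrite thD lerDl.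
      exact/ltW/(th_pos_gt0 _ _ _ _ _ _ lv).
    + by apply: (th_le_act _ _ _ _ GL); rewrite !thD lerD2l
        -(gtr0_norm h) ltW.
  - have h' : 0 <= - th g' by rewrite oppr_ge0.
    rewrite (ler0_norm h) in dg.
    split=> //; rewrite -?(actD _ _ _ _ GL).
    + by rewrite -[leRHS](act0 _ G Gi); apply: (th_le_act _ _ _ _ GL);
        rewrite th0.
    + by apply: (th_le_act _ _ _ _ GL); rewrite !thD; lra.
    + by apply: (th_le_act _ _ _ _ GL); rewrite !thD; lra.
have lt1 w := act_pos_gt _ _ _ _ GL _ _ _ _ lv w.
have s1 := slope_dist _ _ _ _ _ _ iq' z1 (lt1 x) z3 z2 (lt1 y) z4.
have s2 := slope_dist _ _ _ _ _ _ iq' z2 (lt1 y) z4 z1 (lt1 x) z3.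
rewrite aD -(add0n q') aD -!tr.
rewrite (a_slope i y) (a_slope i x).
have p1 := a_gt0 0 x; have p2 := a_gt0 0 y.
have pp : 0 < a 0 x * a 0 y by rewrite mulr_gt0.
split.
- move: s2; rewrite -(ler_pM2r pp) => s2.
  by apply: le_trans (le_trans s2 _); rewrite le_eqVlt; apply/orP; left;
    apply/eqP; ring.
- move: s1; rewrite -(ler_pM2r pp) => s1.
  by apply: le_trans (le_trans s1 _); rewrite le_eqVlt; apply/orP; left;
    apply/eqP; ring.
Qed.

Definition sum_cst (V K1 : R) : R := (4 * dist_cst V K1 ^+ 3)^-1.
Local Notation b := (sum_cst V K1).

Lemma sum_cst_gt0 : 0 < b.
Proof. by rewrite invr_gt0 mulr_gt0 // exprn_gt0 // expR_gt0. Qed.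

(** As [q <= q'], [sum_step_ge1] only gives [1 <= U x + U y] with [y = G^q' x]. Comparing arcs at
    [x], [y] and [z = G^q' y] by [step_ratio] and multiplying, the lengths cancel and leave
    [U y ^+ 2 <= E ^+ 3 * U x]. One of [U x] and [U y] is at least 1/2, whence the constant
    [1 / (4 E^3)]. *)
Lemma sum_step_ge x : b <= \sum_(i < q') (act d (iter i G x) - iter i G x).
Proof.
have [qq' q'0 sg lt det] := lv.
pose U y := \sum_(i < q') a i y.
have U1 y : U y <= 1 := sum_step_le1 _ _ _ _ GL _ _ _ _ lv y.
have Upos y : 0 < U y.
  rewrite /U; case: q' q'0 => // n _; rewrite big_ord_recl.
  by rewrite ltr_wpDr ?a_gt0 // sumr_ge0 // => i _; rewrite ltW ?a_gt0.
rewrite -/(U x); set y := iter q' G x; pose z := iter q' G y.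
have sum1 : 1 <= U x + U y.
  apply: le_trans (sum_step_ge1 _ _ _ _ GL _ _ _ _ lv x) _.
  rewrite big_split_ord /= lerD2l.
  rewrite (eq_bigr (fun i : 'I_q => a i y)); last first.
    by move=> i _; rewrite -aD addnC.
  rewrite -!(big_mkord xpredT (fun i => a i y)) /U.
  rewrite -(big_mkord xpredT (fun i => a i y)) [leRHS](big_cat_nat (leq0n q) qq') //=.
  by rewrite lerDl sumr_ge0 // => i _; rewrite ltW ?a_gt0.
have E1 := dist_cst_ge1; have E0 : 0 < E by move: E1; lra.
have a0 := a_gt0.
have h1 : U y * a 0 x <= E * (U x * a 0 y).
  rewrite mulrCA [E * _]mulrC /U !mulr_suml.
  apply: ler_sum => i _; have [h _] := step_ratio x i (ltnW (ltn_ord i)).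
  rewrite aD (_ : a q' x = a 0 y) in h; last by rewrite -aD.
  by apply: le_trans h _; rewrite mulrA [E * _]mulrC -mulrA [E * _]mulrC mulrA.
have h2 : U y * a 0 z <= E * (U z * a 0 y).
  rewrite mulrCA [E * _]mulrC /U !mulr_suml.
  apply: ler_sum => i _; have [_ h] := step_ratio y i (ltnW (ltn_ord i)).
  rewrite aD (_ : a q' y = a 0 z) in h; last by rewrite -aD.
  by apply: le_trans h _; rewrite mulrA [E * _]mulrC -mulrA [E * _]mulrC mulrA.
have h3 : a 0 y * a 0 y <= E * (a 0 z * a 0 x).
  have [_] := step_ratio x q' (leqnn _).
  rewrite aD (_ : a q' x = a 0 y); last by rewrite -aD.
  by rewrite (_ : a q' y = a 0 z) // -aD.
have Uxy : U y ^+ 2 <= E ^+ 3 * U x.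
  have y0 := a0 0%N y; have x0 := a0 0%N x; have z0 := a0 0%N z.
  rewrite -(ler_pM2r (mulr_gt0 y0 y0)).
  apply: le_trans (_ : U y ^+ 2 * (E * (a 0 z * a 0 x)) <= _).
    by rewrite ler_wpM2l ?sqr_ge0.
  rewrite (_ : U y ^+ 2 * _ = E * ((U y * a 0 z) * (U y * a 0 x))); last by ring.
  rewrite (_ : E ^+ 3 * U x * (a 0 y * a 0 y) =
    E * ((E * (1 * a 0 y)) * (E * (U x * a 0 y)))); last by ring.
  rewrite ler_pM2l // ler_pM ?mulr_ge0 ?(ltW (Upos _)) ?(ltW (a0 _ _)) //.
  apply: le_trans h2 _; rewrite ler_pM2l // ler_wpM2r ?(ltW y0) //.
rewrite /sum_cst invf_ple ?posrE ?mulr_gt0 ?exprn_gt0 //.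
rewrite -[leLHS]mul1r ler_pdivrMr //.
have [u|u] := leP (1 / 2) (U x).
  have e3 : 1 <= E ^+ 3 by rewrite exprn_ege1.
  by nra.
have u' : 1 / 2 <= U y by lra.
have : 1 / 4 <= U y ^+ 2 by nra.
by lra.
Qed.

(** Up to a factor [E] this slope is the quotient of the orbit sums starting at [G^q' x] and at [x],
    both of which lie in [[b, 1]]. *)
Lemma slope_return x :
  b / E <= slope R (iter q' G) x (act d x) <= E / b.
Proof.
have E1 := dist_cst_ge1; have E0 : 0 < E by move: E1; lra.
have b0 := sum_cst_gt0.
pose U y := \sum_(i < q') a i y.
have U1 y : U y <= 1 := sum_step_le1 _ _ _ _ GL _ _ _ _ lv y.
have Ub y : b <= U y := sum_step_ge y.
set y := iter q' G x.
have ee : a q' x = a 0 y by [].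
have h1 : U y * a 0 x <= E * (U x * a 0 y).
  rewrite mulrCA [E * _]mulrC /U !mulr_suml.
  apply: ler_sum => i _; have [h _] := step_ratio x i (ltnW (ltn_ord i)).
  rewrite aD ee in h.
  by apply: le_trans h _; rewrite mulrA [E * _]mulrC -mulrA [E * _]mulrC mulrA.
have h2 : U x * a 0 y <= E * (U y * a 0 x).
  rewrite mulrCA [E * _]mulrC /U !mulr_suml.
  apply: ler_sum => i _; have [_ h] := step_ratio x i (ltnW (ltn_ord i)).
  rewrite aD ee in h.
  by apply: le_trans h _; rewrite mulrA [E * _]mulrC -mulrA [E * _]mulrC mulrA.
have e := a_slope q' x; rewrite ee in e.
have x0 := a_gt0 0 x; have y0 := a_gt0 0 y.
have -> : slope R (iter q' G) x (act d x) = a 0 y / a 0 x by rewrite e mulfK ?gt_eqF.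
apply/andP; split.
- rewrite ler_pdivlMr // mulrAC ler_pdivrMr //.
  apply: le_trans (le_trans _ h1) _; first by rewrite ler_wpM2r // ltW.
  by rewrite mulrC ler_wpM2r ?(ltW E0) // ler_piMl ?(ltW y0).
- rewrite ler_pdivlMr // mulrAC ler_pdivrMr //.
  rewrite mulrC; apply: le_trans (le_trans _ h2) _.
    by rewrite ler_wpM2r // ltW.
  by rewrite ler_wpM2l ?(ltW E0) // ler_piMl ?(ltW x0).
Qed.

End Denjoy.

(** * Curvature of the return maps away from the break *)

Section Curvature.
Variable R : realType.
Variables (G Gi : R -> R) (t : R).
Hypothesis GL : irrational_lift R G Gi t.
Variables (p V K0 K1 : R).
Hypotheses (V0 : 0 <= V) (K00 : 0 < K0) (K10 : 0 <= K1).
Hypothesis BL : break_law R G p V K0 K1.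
Variables (q q' : nat) (k k' : int).
Hypothesis lv : level R t q k q' k'.

Local Notation th := (th R t).
Local Notation act := (act R G Gi).
Local Notation width := (width R G Gi t GL).
Local Notation g := (q%:Z, k).
Local Notation g' := (q'%:Z, k').
Local Notation d := (pos R t g).
Local Notation d' := (pos R t g').
Local Notation E := (dist_cst R V K1).
Local Notation b := (sum_cst R V K1).

Lemma ln_dist_le (m u v : R) : 0 < m -> m <= u -> m <= v ->
  m * `|ln u - ln v| <= `|u - v|.
Proof.
move=> m0; wlog vu : u v / v <= u => [hw mu mv|mu mv].
  by case/orP: (le_total v u) => ?; [|rewrite distrC [leRHS]distrC]; exact: hw.
have v0 : 0 < v by lra.
have u0 : 0 < u by lra.
rewrite !ger0_norm ?subr_ge0 ?ler_ln ?posrE //.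
rewrite -ln_div ?posrE //.
have : ln (u / v) <= (u - v) / v.
  rewrite (_ : u / v = 1 + (u - v) / v); last by field; rewrite gt_eqF.
  apply: le_ln1Dx; rewrite (lt_le_trans (_ : _ < 0)) ?ltrN10 //.
  by rewrite divr_ge0 ?subr_ge0 // ltW.
rewrite ler_pdivlMr // mulrC; apply: le_trans; rewrite ler_wpM2r //.
by rewrite ln_ge0 // ler_pdivlMr ?mul1r.
Qed.

(** The product of [b / E ^+ 2], a lower bound for slopes of the return map that converts logarithms
    back to slopes, and of [K0 * b / E], the curvature accumulated along the orbit. *)
Definition curv_cst (V K0 K1 : R) : R :=
  K0 * sum_cst R V K1 ^+ 2 / dist_cst R V K1 ^+ 3.

Local Notation K2 := (curv_cst V K0 K1).

Lemma curv_cst_gt0 : 0 < K2.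
Proof.
by rewrite divr_gt0 ?mulr_gt0 ?exprn_gt0 ?expR_gt0 //; exact: sum_cst_gt0.
Qed.

(** All curvature terms along the orbit have the same sign. By bounded distortion the [i]-th image
    of [[y1, y3]] fills, up to a factor [E], the same fraction of the [i]-th image of the whole arc,
    and the latter images have total length at least [b]. *)
Lemma slope_curved x y1 y2 y3 :
  x <= y1 -> y1 < y2 -> y2 < y3 -> y3 <= act (d *+ 2) x ->
  (forall i, (i < q')%N -> break_free R p (iter i G y1) (iter i G y3)) ->
  K2 * (y3 - y1) / (act (d *+ 2) x - x) <=
  `|slope R (iter q' G) y2 y3 - slope R (iter q' G) y1 y2|.
Proof.
move=> xy1 y12 y23 y3e bf; set e := act (d *+ 2) x in y3e *.
have y13 := lt_trans y12 y23.
have E0 : 0 < E by exact: expR_gt0.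
have b0 : 0 < b := sum_cst_gt0 _ _ _.
have ltd z : z < act d z by exact: (act_pos_gt _ _ _ _ GL _ _ _ _ lv).
have dle : act d x <= e by rewrite /e (act2 _ _ _ _ GL) ltW.
have xe : x < e := lt_le_trans (ltd x) dle.
have L0 : 0 < e - x by rewrite subr_gt0.
have dist i u v u' v' : (i <= q')%N -> x <= u -> u < v -> v <= e ->
    x <= u' -> u' < v' -> v' <= e ->
    slope R (iter i G) u v <= E * slope R (iter i G) u' v'.
  exact: (slope_dist _ _ _ _ GL _ _ _ _ V0 K10 BL _ _ _ _ lv).
pose s1 := slope R (iter q' G) y1 y2; pose s2 := slope R (iter q' G) y2 y3.
rewrite -/s1 -/s2.
have low u v : x <= u -> u < v -> v <= e -> b / E ^+ 2 <= slope R (iter q' G) u v.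
  move=> xu uv ve.
  have /andP[h _] := slope_return _ _ _ _ GL _ _ _ _ V0 K10 BL _ _ _ _ lv x.
  have h' := dist q' x (act d x) u v (leqnn _) (lexx _) (ltd x) dle xu uv ve.
  rewrite expr2 invfM mulrA ler_pdivrMr // [leRHS]mulrC; exact: le_trans h h'.
have m0 : 0 < b / E ^+ 2 by rewrite divr_gt0 ?exprn_gt0.
have low2 : b / E ^+ 2 <= s2 by apply: low => //; lra.
have low1 : b / E ^+ 2 <= s1 by apply: low => //; lra.
apply: le_trans (ln_dist_le _ _ _ m0 low2 low1).
rewrite -[ln s2]/(lnslope R (iter q' G) y2 y3).
rewrite -[ln s1]/(lnslope R (iter q' G) y1 y2).
rewrite !(lnslope_iter _ _ (il_homo _ _ _ _ GL)) // -sumrB.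
have [s sE curv] := bl_curved _ _ _ _ _ _ BL.
have ns : `|s| = 1 by case: sE => ->; rewrite ?normrN normr1.
rewrite (_ : K2 * (y3 - y1) / (e - x) =
  b / E ^+ 2 * (K0 * (E^-1 * (b * ((y3 - y1) / (e - x)))))); last first.
  by rewrite /curv_cst; field; rewrite !gt_eqF // subr_gt0.
rewrite ler_pM2l // -[leRHS]mul1r -ns -normrM.
apply: le_trans (ler_norm _); rewrite mulr_sumr.
apply: le_trans (_ : \sum_(i < q') K0 * (iter i G y3 - iter i G y1) <= _); last first.
  apply: ler_sum => i _; apply: curv; [exact: bf|exact: iter_homo GL _ _ _ y12|].
  exact: iter_homo GL _ _ _ y23.
rewrite -mulr_sumr ler_pM2l //.
apply: le_trans (_ : \sum_(i < q') E^-1 * ((iter i G e - iter i G x) *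
  ((y3 - y1) / (e - x))) <= _); last first.
  apply: ler_sum => i _; rewrite mulrC ler_pdivrMr //.
  have h := dist i x e y1 y3 (ltnW (ltn_ord i)) (lexx _) xe (lexx _) xy1 y13 y3e.
  have y0 : 0 < y3 - y1 by rewrite subr_gt0.
  move: h; rewrite -(ler_pM2r y0) /slope.
  by rewrite -[E * _ * _]mulrA divfK ?gt_eqF // [E * _]mulrC mulrAC mulrA.
rewrite -mulr_sumr ler_pM2l ?invr_gt0 // -mulr_suml ler_pM2r; last first.
  by rewrite divr_gt0 ?subr_gt0.
apply: le_trans (sum_step_ge _ _ _ _ GL _ _ _ _ V0 K10 BL _ _ _ _ lv x) _.
apply: ler_sum => i _; rewrite lerD2r -(iter_act _ _ _ _ GL).
by rewrite (iter_le _ _ _ _ GL).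
Qed.

Lemma pos_th_le1 : th d <= 1.
Proof.
rewrite th_pos; apply: le_trans (level_th_le _ _ _ _ _ _ lv).
by rewrite ler_peMl // ler1n (lv_gt0 _ _ _ _ _ _ lv).
Qed.

Lemma act_pos_le1 z : act d z <= z + 1.
Proof.
have -> : z + 1 = act (0, -1) z by rewrite -[act _ _]/(z - - 1) opprK.
apply: (th_le_act _ _ _ _ GL); apply: le_trans pos_th_le1 _.
by rewrite -[leRHS]/(0 * t - - 1) mul0r sub0r opprK.
Qed.

(** By [hit_unique] at most one image of the arc has a break in its interior; [z] is the preimage of
    that break, or [u] if there is none. *)
Lemma break_point u v : u < v -> v <= act d u -> exists z, u <= z <= v /\
  forall i, (i < q')%N -> break_free R p (iter i G u) (iter i G z) /\
    break_free R p (iter i G z) (iter i G v).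
Proof.
move=> uv vd.
have ile i := iter_le _ _ _ _ GL i.
case: (pselect (exists2 i0, (i0 < q')%N &
    ~ break_free R p (iter i0 G u) (iter i0 G v))); last first.
  move=> nb; exists u; rewrite lexx (ltW uv); split=> // i iq'.
  have bf : break_free R p (iter i G u) (iter i G v).
    by apply: contrapT => h; apply: nb; exists i.
  by split=> //; apply: break_freeS bf _ _; rewrite // ile ltW.
move=> [i0 i0q' /nbreak_free[m /andP[m1 m2]]].
pose z := act (- (i0%:Z, 0)) (p + m%:~R).
have zE : iter i0 G z = p + m%:~R.
  by rewrite -(act_nat _ _ Gi) (actNK _ _ _ _ GL).
have uz : u <= z by rewrite -(ile i0) zE ltW.
have zv : z <= v by rewrite -(ile i0) zE ltW.
have vd' i : iter i G v <= act d (iter i G u).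
  by rewrite -(iter_act _ _ _ _ GL) ile.
exists z; rewrite uz zv; split=> // i iq'.
(* At the hitting time the image has length at most 1, so the two neighbouring breaks are not
   reached. *)
have [<-|ni] := eqVneq i0 i.
  have h := le_trans (vd' i0) (act_pos_le1 _).
  rewrite zE; split; [exists (m - 1); rewrite rmorphB /=|exists m]; lra.
have bf : break_free R p (iter i G u) (iter i G v).
  apply: contrapT => /nbreak_free[n /andP[n1 n2]].
  have h0 : exists m : int, iter i0 G u <= p + m%:~R < act d (iter i0 G u).
    by exists m; rewrite (ltW m1) (lt_le_trans m2).
  have h1 : exists m : int, iter i G u <= p + m%:~R < act d (iter i G u).
    by exists n; rewrite (ltW n1) (lt_le_trans n2).
  have [l|l|l] := ltngtP i0 i; last by rewrite l eqxx in ni.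
  - by apply: (hit_unique _ _ _ _ GL _ _ _ _ lv p u i0 i) h0 h1; rewrite l iq'.
  - by apply: (hit_unique _ _ _ _ GL _ _ _ _ lv p u i i0) h1 h0; rewrite l.
by split; apply: break_freeS bf _ _; rewrite // ile.
Qed.

Definition arc_base (y : R) : R := if 0 < th g' then y else act g' y.

Definition arc_len (y : R) : R := act d' (arc_base y) - arc_base y.

(** The start of the half of [[x, act (d *+ 2) x]] from which a [g']-step does not leave the whole
    arc: the left half if [g'] moves to the right, else the right half. *)
Definition half_base (x : R) : R := if 0 < th g' then x else act d x.

Lemma arc_lenE : exists2 s : R, s = 1 \/ s = -1 &
  forall y, arc_len y = s * (act g' y - y).
Proof.
rewrite /arc_len /arc_base /pos; case: ltP => h.
  by exists 1 => [|z]; [left|rewrite mul1r].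
exists (-1) => [|z]; first by right.
by rewrite (actK _ _ _ _ GL); ring.
Qed.

(** A displacement that varies little contradicts curvature: slopes of [G^q'] are 1 plus or minus
    difference quotients of [arc_len], and the latter are at most [(hi - lo) / rho]. *)
Lemma arc_second_diff x y1 y2 y3 rho lo hi :
  x <= y1 -> y3 <= act (d *+ 2) x -> 0 < rho ->
  rho <= y2 - y1 -> rho <= y3 - y2 ->
  (forall i, (i < q')%N -> break_free R p (iter i G y1) (iter i G y3)) ->
  lo <= arc_len y1 <= hi -> lo <= arc_len y2 <= hi -> lo <= arc_len y3 <= hi ->
  K2 * rho ^+ 2 / (act (d *+ 2) x - x) <= hi - lo.
Proof.
move=> xy1 y3e r0 r1 r2 bf /andP[a1 b1] /andP[a2 b2] /andP[a3 b3].
have y12 : y1 < y2 by lra.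
have y23 : y2 < y3 by lra.
have := slope_curved _ _ _ _ xy1 y12 y23 y3e bf.
have L0 : 0 < act (d *+ 2) x - x by lra.
set L := _ - x in L0 *.
have [s sE alE] := arc_lenE.
have slE u v : u < v -> slope R (iter q' G) u v =
    1 + s * ((arc_len v - arc_len u) / (v - u)).
  move=> uv; have ss : s * s = 1 by case: sE => ->; rewrite ?mulrNN mulr1.
  have uv0 : v - u != 0 by rewrite subr_eq0 gt_eqF.
  rewrite !alE -mulrBr mulrA mulrA ss mul1r !act_posE /slope.
  by field.
have key A B : 1 + s * A - (1 + s * B) = s * (A - B) by ring.
rewrite !slE // key normrM.
rewrite (_ : `|s| = 1); last by case: sE => ->; rewrite ?normrN normr1.
rewrite mul1r => h.
have bd u v : rho <= v - u -> lo <= arc_len u <= hi -> lo <= arc_len v <= hi ->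
    `|(arc_len v - arc_len u) / (v - u)| <= (hi - lo) / rho.
  move=> ruv /andP[u1 u2] /andP[v1 v2]; rewrite normrM normfV.
  apply: ler_pM => //; first by rewrite ler_norml; lra.
  by rewrite ger0_norm ?lef_pV2 ?posrE //; lra.
have h1 := bd y1 y2 r1; have h2 := bd y2 y3 r2.
have {h1}h1 : _ <= _ := h1 (introT andP (conj a1 b1)) (introT andP (conj a2 b2)).
have {h2}h2 : _ <= _ := h2 (introT andP (conj a2 b2)) (introT andP (conj a3 b3)).
have h3 := le_trans h (le_trans (ler_normB _ _) (lerD h2 h1)).
have K20 := curv_cst_gt0.
have h4 : K2 * (2 * rho) / L <= (hi - lo) / rho + (hi - lo) / rho.
  apply: le_trans h3; rewrite ler_pM2r ?invr_gt0 // ler_pM2l //; lra.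
have h5 : (hi - lo) / rho + (hi - lo) / rho = 2 * (hi - lo) / rho by field; rewrite gt_eqF.
rewrite h5 ler_pdivlMr // in h4.
rewrite -(@ler_pM2l _ 2) //; apply: le_trans h4.
by rewrite le_eqVlt; apply/orP; left; apply/eqP; ring.
Qed.

Lemma th_pos_lt : th d' < th d.
Proof. by rewrite !th_pos (lv_lt _ _ _ _ _ _ lv). Qed.

Lemma half_base_itv x : x <= half_base x /\ act d (half_base x) <= act (d *+ 2) x.
Proof.
have ltd z : z < act d z by exact: (act_pos_gt _ _ _ _ GL _ _ _ _ lv).
rewrite (act2 _ _ _ _ GL) /half_base; case: ltP => _; split=> //; exact: ltW.
Qed.

Lemma arc_base_itv x y : half_base x <= y -> y <= act d (half_base x) ->
  x <= arc_base y /\ act d' (arc_base y) <= act (d *+ 2) x.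
Proof.
have lt := th_pos_lt; rewrite (act2 _ _ _ _ GL).
rewrite /half_base /arc_base; case: ltP => h xy yx.
  split=> //; apply: le_trans (_ : act d y <= _); last by rewrite (act_le _ _ _ _ GL).
  by apply: (th_le_act _ _ _ _ GL); rewrite ltW.
have d'E : d' = - g' by rewrite /pos ltNge h.
rewrite d'E (actK _ _ _ _ GL); split=> //.
rewrite -(act_le _ _ _ _ GL d) (le_trans xy) // -(actD _ _ _ _ GL).
rewrite -[leLHS](act0 _ G Gi); apply: (th_le_act _ _ _ _ GL).
by move: lt; rewrite d'E th0 thD thN; lra.
Qed.

End Curvature.

(** * Drop of [width / th] by a definite factor *)

Section Gain.
Variable R : realType.
Variables (G Gi : R -> R) (t : R).
Hypothesis GL : irrational_lift R G Gi t.
Variables (p V K0 K1 : R).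
Hypotheses (V0 : 0 <= V) (K00 : 0 < K0) (K10 : 0 <= K1).
Hypothesis BL : break_law R G p V K0 K1.

Local Notation th := (th R t).
Local Notation act := (act R G Gi).
Local Notation width := (width R G Gi t GL).
Local Notation argmin := (argmin R G Gi t GL).
Local Notation K2 := (curv_cst R V K0 K1).

Lemma last_step z y e : 0 < th z -> y <= e -> exists j : nat,
  act (z *+ j) y <= e /\ e < act (z *+ j.+1) y.
Proof.
move=> z0 ye; have w0 := width_gt0 _ _ _ _ GL z z0.
have ex : exists j : nat, e < act (z *+ j) y.
  pose n := (Num.truncn ((e - y) / width z)).+1; exists n.
  have h : (e - y) / width z < n%:R := truncnS_gt _.
  rewrite ltr_pdivrMr // in h.
  have := width_le _ _ _ _ GL (z *+ n) y.
  have := widthMn _ _ _ _ GL z n isT; rewrite -mulr_natl; lra.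
have [[|j] ej minj] := find_ex_minn ex.
  by move: ej; rewrite (act0 R G Gi) ltNge ye.
exists j; split=> //; rewrite leNgt; apply/negP => h.
by have := minj _ h; rewrite ltnn.
Qed.

Lemma width_le_steps z j x : 0 < th z -> j%:R * width z <= act (z *+ j) x - x.
Proof.
move=> z0; case: j => [|j]; first by rewrite mul0r mulr0n (act0 R G Gi) subrr.
apply: le_trans (width_le _ _ _ _ GL _ x).
by rewrite mulr_natl; apply: widthMn.
Qed.

Section Level.
Variables (q q' : nat) (k k' : int).
Hypothesis lv : level R t q k q' k'.

Local Notation g := (q%:Z, k).
Local Notation g' := (q'%:Z, k').
Local Notation d := (pos R t g).
Local Notation d' := (pos R t g').

Let th'_gt0 : 0 < th d'.
Proof.
rewrite th_pos normr_gt0; apply: contraTneq (lv_sgn _ _ _ _ _ _ lv) => ->.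
by rewrite mulr0 ltxx.
Qed.

Let th_gt0 : 0 < th d := th_pos_gt0 _ _ _ _ _ _ lv.

(* Filling [x, act (d *+ 2) x] with z-arcs on both sides of [y, act d' y]. *)
Lemma arc_upper z x y : 0 < th z -> x <= y -> act d' y <= act (d *+ 2) x ->
  exists2 n : nat, 2 * th d - th d' - 2 * th z <= n%:R * th z &
  act d' y - y <= act (d *+ 2) x - x - n%:R * width z.
Proof.
move=> z0 xy ye.
have [j1 [j1a j1b]] := last_step _ _ _ z0 xy.
have [j2 [j2a j2b]] := last_step _ _ _ z0 ye.
have h1 := width_le_steps z j1 x z0; have h2 := width_le_steps z j2 (act d' y) z0.
exists (j1 + j2)%N; last by rewrite natrD; lra.
have : act (d *+ 2) x < act (z *+ j2.+1 + (d' + z *+ j1.+1)) x.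
  apply: lt_trans j2b _; rewrite !(actD _ _ _ _ GL).
  by rewrite !(act_lt _ _ _ _ GL).
have [h _|/(th_le_act _ _ _ _ GL _ _ x)] :=
  ltP (th (d *+ 2)) (th (z *+ j2.+1 + (d' + z *+ j1.+1))); last by rewrite leNgt => /negP.
move: h; rewrite !thD !thMr -!natr1 natrD; lra.
Qed.

(** In [width_drop] the displacements range over an interval of length at most [4 eps L], which must
    be less than [K2 / 144 * L]; the bound 1/20 keeps half of the arc longer than [L / 3]. *)
Definition flat_cst (V K0 K1 : R) : R := Num.min (curv_cst R V K0 K1 / 1000) (1 / 20).

Lemma flat_cst_itv : 0 < flat_cst V K0 K1 <= 1 / 20.
Proof.
have K20 := curv_cst_gt0 _ V _ K1 K00.
rewrite /flat_cst; apply/andP; split; last by rewrite ge_min; apply/orP; right.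
by rewrite lt_min; apply/andP; split; lra.
Qed.

Local Notation eps := (flat_cst V K0 K1).

(** If the density of [z] were close to that of the whole arc, the [z]-arcs on both sides of a
    [g']-arc would leave it so little freedom that the [g']-displacement would be almost constant on
    half of the arc, against the curvature. *)
Lemma width_drop z : 0 < th z -> th z <= eps * (2 * th d) ->
  width z / th z <= (1 - eps) * (width (d *+ 2) / (2 * th d)).
Proof.
move=> z0 zd; rewrite leNgt; apply/negP => neg.
have /andP[e0 e1] := flat_cst_itv.
have K20 := curv_cst_gt0 _ V _ K1 K00.
have eK : eps <= K2 / 1000 by rewrite /flat_cst ge_min; apply/orP; left.
pose x := argmin (d *+ 2); set L := width (d *+ 2) in neg.
have LE : act (d *+ 2) x - x = L by [].
have L0 : 0 < L by apply: width_gt0; rewrite thMn mulrn_wgt0 // th_gt0.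
pose B := L / (2 * th d); rewrite -/B in neg.
have Td : 0 < 2 * th d by move: th_gt0; lra.
have B0 : 0 < B by rewrite divr_gt0.
have BE : B * (2 * th d) = L by rewrite /B divfK // gt_eqF.
pose C := (1 - eps) * B; rewrite -/C ltr_pdivlMr // in neg.
have C0 : 0 < C by rewrite mulr_gt0 //; lra.
have w0 := width_gt0 _ _ _ _ GL z z0.
have low a : 0 < th a -> (th a - th z) * C <= width a.
  move=> a0; have [za|az] := leP (th z) (th a); last first.
    apply: le_trans (ltW (width_gt0 _ _ _ _ GL a a0)).
    by rewrite mulr_le0_ge0 ?(ltW C0) // subr_le0 ltW.
  apply: le_trans (width_floor _ _ _ _ GL z a z0 za).
  rewrite (_ : th a - th z = (th a / th z - 1) * th z); last first.
    by field; rewrite gt_eqF.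
  rewrite -mulrA; apply: ler_wpM2l; last by rewrite mulrC ltW.
  by rewrite subr_ge0 ler_pdivlMr ?mul1r.
have up y : x <= y -> act d' y <= act (d *+ 2) x ->
    act d' y - y <= L - (2 * th d - th d' - 2 * th z) * C.
  move=> xy ye; have [n n1 n2] := arc_upper z x y z0 xy ye.
  apply: le_trans n2 _; rewrite LE lerD2l lerN2.
  apply: le_trans (_ : n%:R * th z * C <= _); first by rewrite ler_wpM2r ?(ltW C0).
  by rewrite -mulrA ler_wpM2l // mulrC ltW.
pose u := half_base R G Gi t q q' k k' x.
have [xu ue] : x <= u /\ act d u <= act (d *+ 2) x := half_base_itv _ _ _ _ GL _ _ _ _ lv x.
have lenb y : u <= y -> y <= act d u ->
    (th d' - th z) * C <= arc_len R G Gi t q' k' y <=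
    L - (2 * th d - th d' - 2 * th z) * C.
  move=> uy yu; have [h1 h2] := arc_base_itv _ _ _ _ GL _ _ _ _ lv _ _ uy yu.
  rewrite /arc_len (up _ h1 h2) andbT.
  by apply: le_trans (low d' th'_gt0) _; exact: width_le.
have ud : u < act d u by exact: (act_pos_gt _ _ _ _ GL _ _ _ _ lv).
have Lu : L / 3 <= act d u - u.
  apply: le_trans (width_le _ _ _ _ GL d u); apply: le_trans (low d th_gt0).
  have -> : L / 3 = (2 * th d / 3) * B by rewrite -BE; ring.
  rewrite /C [leRHS]mulrA ler_pM2r //.
  have z9 : 9 / 10 * th d <= th d - th z.
    have : eps * (2 * th d) <= 1 / 20 * (2 * th d) by rewrite ler_pM2r.
    by move: zd; lra.
  apply: le_trans (_ : 9 / 10 * th d * (19 / 20) <= _).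
    by move: th_gt0; lra.
  have e2 : 19 / 20 <= 1 - eps by lra.
  by apply: ler_pM => //; move: th_gt0; lra.
have [m [/andP[um md] bf]] := break_point _ _ _ _ GL p _ _ _ _ lv _ _ ud (lexx _).
have [y [r [uy yd r1 bfy]]] : exists y r, [/\ u <= y, r <= act d u,
    L / 6 <= r - y & forall i, (i < q')%N -> break_free R p (iter i G y) (iter i G r)].
  have [h|h] := leP (L / 6) (m - u).
  - by exists u, m; split=> // i iq; case: (bf i iq).
  - by exists m, (act d u); split=> //; [lra|move=> i iq; case: (bf i iq)].
(* The half arc is at least [L / 3] long, hence one side of the break at least [L / 6], which leaves
   room for three points at distance [L / 12]. *)
have l12 : 0 < L / 12 by rewrite divr_gt0.
have r3 : y + L / 12 + L / 12 <= r by lra.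
have ibf i : (i < q')%N ->
    break_free R p (iter i G y) (iter i G (y + L / 12 + L / 12)).
  by move=> iq; apply: break_freeS (bfy i iq) _ _; rewrite ?(iter_le _ _ _ _ GL).
have key := arc_second_diff _ _ _ _ GL _ _ _ _ V0 K00 K10 BL _ _ _ _ lv
  x y (y + L / 12) (y + L / 12 + L / 12) (L / 12)
  ((th d' - th z) * C) (L - (2 * th d - th d' - 2 * th z) * C)
  (le_trans xu uy) (le_trans r3 (le_trans yd ue)) l12 _ _ ibf
  (lenb y _ _) (lenb (y + L / 12) _ _) (lenb (y + L / 12 + L / 12) _ _).
have {}key : K2 / 144 * L <= L - (2 * th d - th d' - 2 * th z) * C -
    (th d' - th z) * C.
  have <- : K2 * (L / 12) ^+ 2 / L = K2 / 144 * L by field; rewrite gt_eqF.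
  by apply: key; lra.
move: key.
have -> : L - (2 * th d - th d' - 2 * th z) * C - (th d' - th z) * C =
  eps * L + 3 * th z * C by rewrite /C -BE; ring.
have : 3 * th z * C <= 3 * eps * L.
  have CB : C <= B by rewrite /C ler_piMl ?(ltW B0) //; lra.
  rewrite -BE; apply: le_trans (_ : 3 * th z * B <= _).
    by rewrite ler_pM2l // mulr_gt0.
  rewrite (_ : 3 * eps * (B * (2 * th d)) = 3 * (eps * (2 * th d)) * B).
    by rewrite ler_pM2r // ler_pM2l.
  by ring.
have : eps * L <= K2 / 1000 * L by rewrite ler_pM2r.
have : 0 < K2 * L by rewrite mulr_gt0.
by lra.
Qed.

End Level.
End Gain.

(** * Drop of the width over a large partial quotient *)

Section Sharp.
Variable R : realType.
Variables (G Gi : R -> R) (t : R).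
Hypothesis GL : irrational_lift R G Gi t.
Variables (p V K0 K1 : R).
Hypotheses (V0 : 0 <= V) (K00 : 0 < K0) (K10 : 0 <= K1).
Hypothesis BL : break_law R G p V K0 K1.

Local Notation th := (th R t).
Local Notation act := (act R G Gi).
Local Notation width := (width R G Gi t GL).
Local Notation argmin := (argmin R G Gi t GL).
Local Notation K2 := (curv_cst R V K0 K1).

Variables (q q' : nat) (k k' : int).
Hypothesis lv : level R t q k q' k'.

Local Notation g := (q%:Z, k).
Local Notation g' := (q'%:Z, k').
Local Notation d := (pos R t g).
Local Notation d' := (pos R t g').

Let th'_gt0 : 0 < th d'.
Proof.
rewrite th_pos normr_gt0; apply: contraTneq (lv_sgn _ _ _ _ _ _ lv) => ->.
by rewrite mulr0 ltxx.
Qed.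

Let th_gt0 : 0 < th d := th_pos_gt0 _ _ _ _ _ _ lv.

(** Pigeonhole: the increments of [f] telescope, so the average of [a] over the block is at most
    [L / J]. *)
Lemma block_min (a f : nat -> R) (c J : nat) (L : R) : (0 < J)%N ->
  (forall i, a i <= f i.+1 - f i) -> f (c + J)%N - f c <= L ->
  exists2 i, (c <= i < c + J)%N & a i <= L / J%:R.
Proof.
move=> J0 af fL; apply: contrapT => nex.
have J0' : 0 < J%:R :> R by rewrite ltr0n.
suff : L < f (c + J)%N - f c by rewrite ltNge fL.
rewrite -(telescope_sumr f (leq_addr J c)).
have -> : L = \sum_(c <= i < c + J) L / J%:R.
  by rewrite sumr_const_nat addKn -[RHS]mulr_natl mulrC divfK // gt_eqF.
apply: ltr_sum_nat => [|i ci]; first by rewrite -addn1 leq_add2l.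
apply: lt_le_trans (af i); rewrite ltNge; apply/negP => h.
by apply: nex; exists i.
Qed.

(* Among the 10 J points of a d' *+ 2 orbit lying in half of the arc, 5 J
   consecutive ones avoid the break; every block of J of them contains a point
   whose g'-displacement is at most 1 / J of the arc, and three such points
   contradict the curvature of the return map unless J ^ 3 is bounded. *)
Lemma width_sharp (J : nat) : (0 < J)%N -> 20 * J%:R * th d' <= th d ->
  K2 * J%:R ^+ 3 * width (d' *+ 2) ^+ 2 <= width (d *+ 2) ^+ 2.
Proof.
move=> J0 Jd; have J0' : 0 < J%:R :> R by rewrite ltr0n.
pose D := d' *+ 2.
have D0 : 0 < th D by rewrite thMr mulr_gt0.
pose W := width D; have W0 : 0 < W := width_gt0 _ _ _ _ GL D D0.
pose x := argmin (d *+ 2); pose L := width (d *+ 2).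
have LE : act (d *+ 2) x - x = L by [].
have L0 : 0 < L by apply: width_gt0; rewrite thMr mulr_gt0.
pose u := half_base R G Gi t q q' k k' x.
have [xu ue] : x <= u /\ act d u <= act (d *+ 2) x := half_base_itv _ _ _ _ GL _ _ _ _ lv x.
have ud : u < act d u by exact: (act_pos_gt _ _ _ _ GL _ _ _ _ lv).
pose z i := act (D *+ i) u.
have zS i j : z (i + j)%N = act (D *+ j) (z i).
  by rewrite /z addnC mulrnDr (actD _ _ _ _ GL).
have zu i : u <= z i.
  rewrite -{1}[u](act0 R G Gi); apply: (th_le_act _ _ _ _ GL).
  by rewrite th0 thMr mulr_ge0 // ltW.
have zd i : (i <= 10 * J)%N -> z i <= act d u.
  move=> iJ; apply: (th_le_act _ _ _ _ GL); apply: le_trans Jd.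
  rewrite !thMr mulrA ler_pM2r //.
  have : i%:R <= (10 * J)%:R :> R by rewrite ler_nat.
  by rewrite natrM; lra.
have zW i j : (i + J <= j)%N -> J%:R * W <= z j - z i.
  move=> ij; rewrite -(subnKC (leq_trans (leq_addr _ _) ij)) zS.
  apply: le_trans (width_le_steps _ _ _ _ GL _ _ _ D0).
  by rewrite ler_pM2r // ler_nat leq_subRL // (leq_trans (leq_addr _ _) ij).
pose al := arc_len R G Gi t q' k'.
have [f [alf f0 fJ]] : exists f : nat -> R, [/\ forall i, al (z i) <= f i.+1 - f i,
    forall i, x <= f i & forall i, (i <= 10 * J)%N -> f i <= act (d *+ 2) x].
  case: (ltP 0 (th g')) => h.
    exists z; split=> [i|i|i iJ]; [|exact: le_trans xu (zu i)|].
    - rewrite /al /arc_len /arc_base h -addn1 zS mulr1n lerD2r.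
      apply: (th_le_act _ _ _ _ GL); rewrite thMr; move: th'_gt0; lra.
    - exact: le_trans (zd i iJ) ue.
  have uE : u = act d x by rewrite /u /half_base ltNge h.
  have d'E : d' = - g' by rewrite /pos ltNge h.
  exists (fun i => act (- D) (z i)); split=> [i|i|i iJ].
  - rewrite /al /arc_len /arc_base ltNge h /= d'E (actK _ _ _ _ GL).
    rewrite -addn1 zS mulr1n (actK _ _ _ _ GL) lerD2l lerN2.
    by apply: (th_le_act _ _ _ _ GL); rewrite thN thMr d'E thN; lra.
  - apply: le_trans (_ : act (- D) u <= _); last by rewrite (act_le _ _ _ _ GL).
    rewrite uE -(actD _ _ _ _ GL) -[leLHS](act0 R G Gi).
    apply: (th_le_act _ _ _ _ GL); rewrite th0 thD thN thMr.
    have : 1 * th d' <= J%:R * th d' by rewrite ler_pM2r // ler1n.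
    by have := th'_gt0; lra.
  - apply: le_trans (le_trans (zd i iJ) ue).
    rewrite -[leRHS](act0 R G Gi); apply: (th_le_act _ _ _ _ GL).
    by rewrite th0 thN oppr_le0 ltW.
have block c : (c + J <= 10 * J)%N ->
    exists2 i, (c <= i < c + J)%N & al (z i) <= L / J%:R.
  move=> cJ; apply: (block_min (al \o z) f) => //.
  by rewrite -LE; have := f0 c; have := fJ _ cJ; lra.
have [m [/andP[um md] bf]] := break_point _ _ _ _ GL p _ _ _ _ lv _ _ ud (lexx _).
have [a [aJ bfa]] : exists a, (a + 5 * J <= 10 * J)%N /\ forall j l i,
    (a <= j)%N -> (l <= a + 5 * J)%N -> (i < q')%N ->
    break_free R p (iter i G (z j)) (iter i G (z l)).
  have zle i j : (i <= j)%N -> z i <= z j.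
    move=> ij; apply: (th_le_act _ _ _ _ GL).
    by rewrite !(thMr _ _ D) (ler_pM2r D0) ler_nat.
  have [h|h] := leP (z (5 * J)%N) m.
  - exists 0%N; split; first by rewrite leq_mul2r orbT.
    move=> j l i _ lJ iq; apply: break_freeS (proj1 (bf i iq)) _ _.
      by rewrite (iter_le _ _ _ _ GL).
    by rewrite (iter_le _ _ _ _ GL) (le_trans _ h) // zle.
  - exists (5 * J)%N; split; first by rewrite -mulnDl.
    move=> j l i aj lJ iq; apply: break_freeS (proj2 (bf i iq)) _ _.
      by rewrite (iter_le _ _ _ _ GL) (le_trans (ltW h)) // zle.
    by rewrite (iter_le _ _ _ _ GL) zd // (leq_trans lJ) // -mulnDl.
have [|i1 /andP[i1a i1b] e1] := block a; first by clear -aJ; lia.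
have [|i2 /andP[i2a i2b] e2] := block (a + 2 * J)%N; first by clear -aJ; lia.
have [|i3 /andP[i3a i3b] e3] := block (a + 4 * J)%N; first by clear -aJ; lia.
have al0 i : (i <= 10 * J)%N -> al (z i) <= L / J%:R -> 0 <= al (z i) <= L / J%:R.
  move=> iJ ->; rewrite andbT subr_ge0; apply/ltW.
  exact: (th_gt0_act _ _ _ _ GL).
have key : K2 * (J%:R * W) ^+ 2 / L <= L / J%:R - 0.
  apply: (arc_second_diff _ _ _ _ GL _ _ _ _ V0 K00 K10 BL _ _ _ _ lv
    x (z i1) (z i2) (z i3)).
  - exact: le_trans xu (zu _).
  - by apply: le_trans (zd _ _) ue; clear -aJ i3b; lia.
  - by rewrite mulr_gt0.
  - by apply: zW; clear -i1b i2a; lia.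
  - by apply: zW; clear -i2b i3a; lia.
  - by move=> i iq; apply: bfa iq; clear -i1a i3b; lia.
  - by apply: al0 => //; clear -aJ i1b; lia.
  - by apply: al0 => //; clear -aJ i2b; lia.
  - by apply: al0 => //; clear -aJ i3b; lia.
move: key; rewrite subr0 ler_pdivrMr // [leRHS]mulrAC ler_pdivlMr //.
rewrite -[L * L]/(L ^+ 2); apply: le_trans.
by rewrite /W /D le_eqVlt; apply/orP; left; apply/eqP; ring.
Qed.

(** The 40 comes from [J >= 1 / (40 r)] below; the summand 1 serves ratios of at least 1/20, for
    which monotonicity of [width] suffices. *)
Definition sharp_cst (V K0 K1 : R) : R := 40 ^+ 3 * (1 + (curv_cst R V K0 K1)^-1).

(** The exponent 3 against the exponent 2 is the gain: the square of [width / th] is multiplied by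
    at most [sharp_cst] times the ratio. *)
Lemma width_sharp_ratio :
  width (d' *+ 2) ^+ 2 <=
  sharp_cst V K0 K1 * (th d' / th d) ^+ 3 * width (d *+ 2) ^+ 2.
Proof.
have K20 := curv_cst_gt0 _ V _ K1 K00.
have W0 : 0 <= width (d *+ 2) ^+ 2 by rewrite sqr_ge0.
have r0 : 0 < th d' / th d by rewrite divr_gt0.
have [h|h] := leP (1 / 20) (th d' / th d).
  have w : width (d' *+ 2) <= width (d *+ 2).
    apply: width_mono; rewrite !thMr ler_pM2l //.
    exact/ltW/(th_pos_lt _ _ _ _ _ _ lv).
  have w0 : 0 <= width (d' *+ 2).
    by apply/ltW/width_gt0; rewrite thMr mulr_gt0.
  have w2 : width (d' *+ 2) ^+ 2 <= width (d *+ 2) ^+ 2.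
    by rewrite ler_pXn2r // nnegrE // (le_trans w0).
  apply: le_trans w2 _; rewrite ler_peMl // /sharp_cst.
  have h3 : (1 / 20) ^+ 3 <= (th d' / th d) ^+ 3.
    by rewrite ler_pXn2r ?nnegrE ?divr_ge0 // ltW.
  have i0 : 0 < K2^-1 by rewrite invr_gt0.
  have h4 : 40 ^+ 3 <= 40 ^+ 3 * (1 + K2^-1).
    by rewrite ler_peMr ?exprn_ge0 //; lra.
  apply: le_trans (_ : 40 ^+ 3 * (1 / 20) ^+ 3 <= _); first by lra.
  by apply: ler_pM; rewrite ?exprn_ge0 // divr_ge0.
set r := th d' / th d in r0 h *.
(* The largest [J] that [width_sharp] admits; rounding down loses at most a factor 2. *)
pose J := Num.truncn ((20 * r)^-1).
have ir : 1 <= (20 * r)^-1 by rewrite invf_ge1; lra.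
have J0 : (0 < J)%N by rewrite truncn_gt0.
have /andP[J1 J2] := truncn_itv (le_trans ler01 ir).
rewrite -/J -?[J.+1%:R]natr1 in J1 J2.
have J1' : 1 <= J%:R :> R by rewrite ler1n.
have r20 : 0 < 20 * r by lra.
have rJ : J%:R * (20 * r) <= 1 by rewrite -ler_pdivlMr // div1r.
have rJ2 : 1 <= J%:R * (40 * r).
  have : 1 < (J%:R + 1) * (20 * r) by rewrite -ltr_pdivrMr // div1r.
  have : 1 * (20 * r) <= J%:R * (20 * r) by rewrite ler_pM2r.
  by lra.
have := width_sharp J J0.
have -> : th d' = r * th d by rewrite /r divfK // gt_eqF.
have -> : 20 * J%:R * (r * th d) = J%:R * (20 * r) * th d by ring.
rewrite ler_piMl ?(ltW th_gt0) // => /(_ isT) key.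
have W'0 : 0 <= width (d' *+ 2) ^+ 2 by rewrite sqr_ge0.
have rJ3 : 1 <= (J%:R * (40 * r)) ^+ 3 by rewrite exprn_ege1.
apply: le_trans (_ : (J%:R * (40 * r)) ^+ 3 * width (d' *+ 2) ^+ 2 <= _).
  by rewrite ler_peMl.
have -> : (J%:R * (40 * r)) ^+ 3 * width (d' *+ 2) ^+ 2 =
    40 ^+ 3 * K2^-1 * r ^+ 3 * (K2 * J%:R ^+ 3 * width (d' *+ 2) ^+ 2).
  by field; rewrite gt_eqF.
have r3 : 0 < r ^+ 3 by rewrite exprn_gt0.
have iK : 0 < K2^-1 by rewrite invr_gt0.
apply: ler_pM => //.
- by apply: mulr_ge0 (ltW r3); apply: mulr_ge0 (ltW iK); rewrite exprn_ge0.
- by apply: mulr_ge0 => //; apply: mulr_ge0 (ltW K20) _; rewrite exprn_ge0.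
by rewrite ler_pM2r // /sharp_cst ler_pM2l ?exprn_gt0 // lerDr.
Qed.

End Sharp.

(** * Power decay of [width / th] along infinitely many scales *)

Section Decay.
Variable R : realType.

(** Up to this ratio [x], the square root of [x] absorbs the constant [4 C / eps] of
    [decay_sharp]. *)
Definition gap_cst (V K0 K1 : R) : R :=
  (flat_cst R V K0 K1 / (4 * sharp_cst R V K0 K1)) ^+ 2.

(** The second term is the exponent for which [gap ^ e0 = 1 - eps]. The cap 1/4 makes the target
    [x ^ (2 e0)] of [decay_sharp] at least the square root of [x], so that another square root is
    left for the constants. *)
Definition decay_exp (V K0 K1 : R) : R :=
  Num.min (1 / 4) (ln (1 - flat_cst R V K0 K1) / ln (gap_cst V K0 K1)).

Variables (V K0 K1 : R).
Hypotheses (V0 : 0 <= V) (K00 : 0 < K0) (K10 : 0 <= K1).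

Local Notation eps := (flat_cst R V K0 K1).
Local Notation C := (sharp_cst R V K0 K1).
Local Notation gap := (gap_cst V K0 K1).
Local Notation e0 := (decay_exp V K0 K1).

Lemma sharp_cst_ge1 : 1 <= C.
Proof.
have K20 := curv_cst_gt0 _ V _ K1 K00.
have i0 : 0 < (curv_cst R V K0 K1)^-1 by rewrite invr_gt0.
by rewrite /sharp_cst; lra.
Qed.

Lemma gap_cst_itv : 0 < gap < 1.
Proof.
have /andP[f0 f1] := flat_cst_itv _ V _ K1 K00; have C1 := sharp_cst_ge1.
have C0 : 0 < 4 * C by lra.
apply/andP; split; first by rewrite exprn_gt0 ?divr_gt0.
rewrite /gap_cst expr_lt1 ?divr_ge0 ?ltr_pdivrMr //; lra.
Qed.

Lemma decay_exp_gt0 : 0 < e0.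
Proof.
have /andP[f0 f1] := flat_cst_itv _ V _ K1 K00.
have gp := gap_cst_itv; rewrite /decay_exp lt_min; apply/andP; split; first by lra.
rewrite -mulrNN mulr_gt0 ?oppr_gt0 ?invr_lt0 ?ln_lt0 //.
by apply/andP; split; lra.
Qed.

Lemma decay_exp_le : e0 <= 1 / 4.
Proof. by rewrite /decay_exp ge_min; apply/orP; left. Qed.

Lemma decay_flat (x : R) : gap <= x -> x <= 1 -> 1 - eps <= x `^ e0.
Proof.
move=> gx x1; have /andP[g0 g1] := gap_cst_itv.
have /andP[f0 f1] := flat_cst_itv _ V _ K1 K00.
have f2 : 0 < 1 - eps by lra.
apply: le_trans (_ : gap `^ e0 <= _); last first.
  by apply: ge0_ler_powR; rewrite ?nnegrE ?(ltW decay_exp_gt0) ?(ltW g0) //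
    (le_trans (ltW g0)).
rewrite -ler_ln ?posrE ?powR_gt0 // ln_powR.
have lg : ln gap < 0 by rewrite ln_lt0 // g0.
by rewrite -ler_ndivlMr // /decay_exp ge_min lexx orbT.
Qed.

Lemma decay_sharp (x : R) : 0 < x -> x <= gap -> 4 * C / eps * x <= (x `^ e0) ^+ 2.
Proof.
move=> x0 xg; have /andP[g0 g1] := gap_cst_itv; have C1 := sharp_cst_ge1.
have /andP[f0 f1] := flat_cst_itv _ V _ K1 K00.
have x1 : x <= 1 by lra.
rewrite -powR_mulrn ?powR_ge0 // -powRrM.
have h : x `^ (1 / 2) <= x `^ (e0 * 2).
  by apply: ger_powR; rewrite ?x0 //; have := decay_exp_le; lra.
apply: le_trans h.
have xx : x `^ (1 / 2) * x `^ (1 / 2) = x.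
  rewrite -powRD; last by rewrite gt_eqF ?implybT.
  by rewrite (_ : 1 / 2 + 1 / 2 = 1) ?powRr1 ?(ltW x0) //; field.
have h2 : x `^ (1 / 2) <= eps / (4 * C).
  have e4 : 0 <= eps / (4 * C) by rewrite divr_ge0 //; lra.
  rewrite -(@ler_pXn2r _ 2) ?nnegrE ?powR_ge0 //.
  by rewrite expr2 xx.
have y0 : 0 < x `^ (1 / 2) by rewrite powR_gt0.
rewrite -{1}xx mulrA ger_pMl //.
rewrite mulrC -ler_pdivlMr ?divr_gt0 //; last by lra.
by rewrite [leRHS]div1r invf_div.
Qed.

Variables (G Gi : R -> R) (t p : R).
Hypothesis GL : irrational_lift R G Gi t.
Hypothesis BL : break_law R G p V K0 K1.

Local Notation th := (th R t).
Local Notation act := (act R G Gi).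
Local Notation width := (width R G Gi t GL).

Variables (q : nat -> nat) (k : nat -> int).
Hypothesis lv : forall n, level R t (q n) (k n) (q n.+1) (k n.+1).
Hypothesis hv : forall n,
  2 * `|th ((q n.+2)%:Z, k n.+2)| < `|th ((q n)%:Z, k n)|.

Local Notation d n := (pos R t ((q n)%:Z, k n)).
Local Notation D n := (d n *+ 2).

Let dens n := width (D n) / th (D n).

Let D0 n : 0 < th (D n).
Proof. by rewrite thMr mulr_gt0 // (th_pos_gt0 _ _ _ _ _ _ (lv n)). Qed.

Let W0 n : 0 < width (D n).
Proof. exact: width_gt0. Qed.

Let dens0 n : 0 < dens n.
Proof. by rewrite divr_gt0. Qed.

Let Dlt n : th (D n.+1) < th (D n).
Proof. by rewrite !thMr ltr_pM2l //; exact: th_pos_lt (lv n). Qed.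

Let Dle m n : (m <= n)%N -> th (D n) <= th (D m).
Proof.
move=> /subnK <-; elim: (n - m)%N => // j ih.
exact: le_trans (ltW (Dlt _)) ih.
Qed.

(** The density is monotone only up to the rounding in [width_floor], which costs a factor 2. *)
Let dens_le2 m n : (m <= n)%N -> dens n <= 2 * dens m.
Proof.
move=> mn; have le := Dle _ _ mn.
have p1 := D0 m; have p2 := D0 n.
rewrite /dens mulrA ler_pdivrMr // mulrAC ler_pdivlMr //.
have [h|h] := leP (2 * th (D n)) (th (D m)).
- have := width_floor _ _ _ _ GL _ _ p2 le.
  rewrite -(ler_pM2r p2) mulrAC mulrBl divfK ?gt_eqF // mul1r.
  have := W0 n; move: h p1 p2; move: (width _) (width _) (th _) (th _) => a b u v.
  by nra.
- have := width_mono _ _ _ _ GL _ _ le; have := W0 n; have := W0 m.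
  move: h p1 p2; move: (width _) (width _) (th _) (th _) => a b u v.
  by nra.
Qed.

(** Take the first scale [m.+1] with ratio [x] at most [eps]. If [x] is at least [gap], [width_drop]
    suffices. Otherwise the fall occurs in the last step, because [th (D m)] still exceeds
    [eps * th (D n)], and the sharp estimate applies to that single step. *)
Lemma density_gain n : exists2 m, (n < m)%N &
  dens m <= (th (D m) / th (D n)) `^ e0 * dens n.
Proof.
have /andP[f0 f1] := flat_cst_itv _ V _ K1 K00.
have ex : exists m, th (D m) <= eps * th (D n).
  have [|m _ mlt] := levels_th_lt _ _ _ _ hv (eps * th (D n) / 2) 0%N.
    by rewrite divr_gt0 // mulr_gt0.
  by exists m; rewrite thMr th_pos; lra.
have [m mP mmin] := find_ex_minn ex.
have nm : (n < m)%N.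
  rewrite ltnNge; apply/negP => /Dle; rewrite leNgt => /negP; apply.
  by apply: le_lt_trans mP _; rewrite gtr_pMl //; lra.
case: m mP mmin nm => [//|m] mP mmin nm.
exists m.+1 => //; pose x := th (D m.+1) / th (D n); rewrite -/x.
have x0 : 0 < x by rewrite divr_gt0.
have x1 : x <= 1 by rewrite ler_pdivrMr // mul1r Dle // ltnW.
have [gx|xg] := leP gap x.
  apply: le_trans (_ : (1 - eps) * dens n <= _); last first.
    by rewrite ler_pM2r // decay_flat.
  have := width_drop _ _ _ _ GL _ _ _ _ V0 K00 K10 BL _ _ _ _ (lv n) (D m.+1)
    (D0 m.+1).
  by rewrite /dens [th (D n)]thMr; apply; rewrite -thMr.
have mlt : eps * th (D n) < th (D m).
  by rewrite ltNge; apply/negP => /mmin; rewrite ltnn.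
have := width_sharp_ratio _ _ _ _ GL _ _ _ _ V0 K00 K10 BL _ _ _ _ (lv m).
have -> : th (d m.+1) / th (d m) = th (D m.+1) / th (D m).
  by rewrite !thMr -mulf_div divff // mul1r.
move=> sharp; have p1 := D0 m; have p2 := D0 m.+1; have p3 := D0 n.
have sharp' : dens m.+1 ^+ 2 <= C * (th (D m.+1) / th (D m)) * dens m ^+ 2.
  rewrite /dens !expr_div_n ler_pdivrMr ?exprn_gt0 //.
  apply: le_trans sharp _; rewrite le_eqVlt; apply/orP; left; apply/eqP.
  by field; rewrite !gt_eqF.
have C1 := sharp_cst_ge1.
have r1 : th (D m.+1) / th (D m) <= x / eps.
  rewrite /x -mulrA -invfM ler_pM2l // lef_pV2 ?posrE ?mulr_gt0 //.
  by rewrite mulrC ltW.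
have d2 : dens m ^+ 2 <= 4 * dens n ^+ 2.
  have := dens_le2 n m nm; have := dens0 m; have := dens0 n.
  by move: (dens m) (dens n) => u v; nra.
have l0 : 0 <= x `^ e0 * dens n by apply: mulr_ge0; rewrite ?powR_ge0 // ltW.
have l1 : 0 <= dens m.+1 by exact: ltW.
rewrite -(@ler_pXn2r _ 2) ?nnegrE // [leRHS]exprMn.
apply: le_trans sharp' _.
apply: le_trans (_ : 4 * C / eps * x * dens n ^+ 2 <= _); last first.
  by rewrite ler_pM2r ?exprn_gt0 // decay_sharp // ltW.
rewrite (_ : 4 * C / eps * x * dens n ^+ 2 = C * (x / eps) * (4 * dens n ^+ 2)).
  have C0 : 0 < C by lra.
  apply: ler_pM => //; rewrite ?sqr_ge0 // ?ler_pM2l //.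
  by apply: mulr_ge0; [exact: ltW|apply: divr_ge0; exact: ltW].
by field; rewrite gt_eqF.
Qed.

(** The ratios in [density_gain] telescope. The scales that it skips are not controlled, hence
    infinitely many [m] instead of all. *)
Lemma density_decay : exists2 A, 0 < A & forall N, exists2 m, (N <= m)%N &
  width (d m) <= A * th (d m) `^ (1 + e0).
Proof.
pose B := dens 0 / th (D 0) `^ e0.
have key N : exists2 m, (N <= m)%N & dens m <= B * th (D m) `^ e0.
  elim: N => [|N [m Nm mB]].
    by exists 0%N => //; rewrite /B divfK // gt_eqF // powR_gt0.
  have [l ml lB] := density_gain m; exists l; first exact: leq_ltn_trans Nm ml.
  apply: le_trans lB _.
  apply: le_trans (_ : (th (D l) / th (D m)) `^ e0 * (B * th (D m) `^ e0) <= _).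
    by rewrite ler_wpM2l ?powR_ge0.
  rewrite mulrCA -powRM ?divr_ge0 ?(ltW (D0 _)) //.
  by rewrite divfK ?gt_eqF.
have B0 : 0 < B by rewrite divr_gt0 // powR_gt0.
exists (B * 2 `^ e0); first by rewrite mulr_gt0 // powR_gt0.
move=> N; have [m Nm mB] := key N; exists m => //.
have t0 : 0 < th (d m) := th_pos_gt0 _ _ _ _ _ _ (lv m).
have e1 : width (d m) <= th (d m) * dens m.
  have h := widthMn _ _ _ _ GL (d m) 2 isT; rewrite mulr2n in h.
  have -> : th (d m) * dens m = width (D m) / 2.
    by rewrite /dens thMr; field; rewrite gt_eqF.
  by lra.
apply: le_trans e1 _.
apply: le_trans (_ : th (d m) * (B * th (D m) `^ e0) <= _).
  by rewrite ler_pM2l.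
rewrite thMr powRM ?(ltW t0) // powRD; last first.
  by apply/implyP => _; rewrite gt_eqF.
by rewrite powRr1 ?(ltW t0) // le_eqVlt; apply/orP; left; apply/eqP; ring.
Qed.

End Decay.

(** * Cross ratios along a conjugacy *)

Section CrossRatio.
Variable R : realType.

(* The logarithm of the distortion under f of the cross ratio
   (y2 - y1) (y4 - y3) / ((y3 - y1) (y4 - y2)). *)
Definition lncross (f : R -> R) (y1 y2 y3 y4 : R) : R :=
  lnslope R f y1 y2 + lnslope R f y3 y4 - lnslope R f y1 y3 - lnslope R f y2 y4.

Lemma lnslope_comp (f g : R -> R) u v : u < v -> g u < g v ->
  f (g u) < f (g v) ->
  lnslope R (f \o g) u v = lnslope R f (g u) (g v) + lnslope R g u v.
Proof.
move=> uv guv fguv; rewrite /lnslope /slope -lnM ?posrE ?divr_gt0 ?subr_gt0 //.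
by congr ln => /=; field; rewrite !subr_eq0 !gt_eqF.
Qed.

Lemma lncross_iter (G : R -> R) : {homo G : x y / x < y} ->
  forall n y1 y2 y3 y4, y1 < y2 -> y2 < y3 -> y3 < y4 ->
  lncross (iter n G) y1 y2 y3 y4 =
    \sum_(i < n) lncross G (iter i G y1) (iter i G y2) (iter i G y3) (iter i G y4).
Proof.
move=> Gh n y1 y2 y3 y4 y12 y23 y34.
have y13 := lt_trans y12 y23; have y24 := lt_trans y23 y34.
by rewrite /lncross !(lnslope_iter _ _ Gh) // -big_split -!sumrB.
Qed.

Lemma lncross_comp (f g : R -> R) : {homo f : x y / x < y} ->
  {homo g : x y / x < y} -> forall y1 y2 y3 y4, y1 < y2 -> y2 < y3 -> y3 < y4 ->
  lncross (f \o g) y1 y2 y3 y4 =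
    lncross f (g y1) (g y2) (g y3) (g y4) + lncross g y1 y2 y3 y4.
Proof.
move=> fh gh y1 y2 y3 y4 y12 y23 y34.
have y13 := lt_trans y12 y23; have y24 := lt_trans y23 y34.
have c u v : u < v ->
    lnslope R (f \o g) u v = lnslope R f (g u) (g v) + lnslope R g u v.
  by move=> uv; apply: lnslope_comp => //; [exact: gh|exact/fh/gh].
rewrite /lncross (c _ _ y12) (c _ _ y34) (c _ _ y13) (c _ _ y24).
by ring.
Qed.

(** Cauchy-Schwarz, term by term: each square lies above its tangent line at [b / n]. *)
Lemma sum_sqr_ge (n : nat) (a : 'I_n -> R) (b : R) : 0 <= b -> (0 < n)%N ->
  b <= \sum_i a i -> b ^+ 2 / n%:R <= \sum_i a i ^+ 2.
Proof.
move=> b0 n0 bS; have n0' : 0 < n%:R :> R by rewrite ltr0n.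
apply: le_trans (_ : \sum_i (2 * (b / n%:R) * a i - (b / n%:R) ^+ 2) <= _).
  rewrite sumrB -mulr_sumr sumr_const card_ord.
  have -> : (b / n%:R) ^+ 2 *+ n = b ^+ 2 / n%:R.
    by rewrite -[LHS]mulr_natl; field; rewrite gt_eqF.
  have : 2 * (b / n%:R) * b <= 2 * (b / n%:R) * \sum_i a i.
    by rewrite ler_wpM2l // mulr_ge0 // divr_ge0 // ltW.
  have -> : 2 * (b / n%:R) * b = 2 * (b ^+ 2 / n%:R) by ring.
  by lra.
apply: ler_sum => i _; have := sqr_ge0 (a i - b / n%:R).
by move: (b / n%:R) => c; nra.
Qed.

Variables (G Gi : R -> R) (t : R).
Hypothesis GL : irrational_lift R G Gi t.
Variables (p V K0 K1 : R).
Hypotheses (V0 : 0 <= V) (K00 : 0 < K0) (K10 : 0 <= K1).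
Hypothesis BL : break_law R G p V K0 K1.
Hypothesis Gcross : forall y1 y2 y3 y4, break_free R p y1 y4 ->
  y1 < y2 -> y2 < y3 -> y3 < y4 -> lncross G y1 y2 y3 y4 = 0.

Local Notation th := (th R t).
Local Notation act := (act R G Gi).
Local Notation width := (width R G Gi t GL).
Local Notation E := (dist_cst R V K1).
Local Notation b := (sum_cst R V K1).

Variables (F : R -> R) (kappa : R).
Hypotheses (Fhomo : {homo F : x y / x < y}) (kappa0 : 0 < kappa).
Hypothesis Fcross : forall y1 y2 y3 y4, break_free R p y1 y4 ->
  y1 < y2 -> y2 < y3 -> y3 < y4 ->
  lncross F y1 y2 y3 y4 <= - (kappa * (y4 - y1) * (y3 - y2)).

Variables (h k : R -> R) (alpha L M : R).
Hypotheses (hK : cancel h k) (kK : cancel k h).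
Hypotheses (hhomo : {homo h : x y / x < y}) (hper : forall x, h (x + 1) = h x + 1).
Hypothesis kG : forall x, k (G x) = F (k x).
Hypotheses (L0 : 0 < L) (M0 : 0 <= M) (alpha0 : 0 < alpha).
Hypothesis klow : forall x y, x < y -> (y - x) / L <= k y - k x.
Hypothesis kdist : forall a e u v u' v', a <= u -> u < v -> v <= e ->
  a <= u' -> u' < v' -> v' <= e ->
  `|lnslope R k u v - lnslope R k u' v'| <= M * (e - a) `^ alpha.

Let khomo : {homo k : x y / x < y}.
Proof.
by move=> x y xy; rewrite ltNge; apply/negP; rewrite le_eqVlt => /orP[/eqP/(can_inj kK)|/hhomo];
  rewrite ?kK => e; move: xy; rewrite ?e ?ltxx // ltNge (ltW e).
Qed.

Let k_iter i x : k (iter i G x) = iter i F (k x).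
Proof. by elim: i => //= i ih; rewrite kG ih. Qed.

Let bfF u v : break_free R (h p) u v -> break_free R p (k u) (k v).
Proof.
move=> [m [m1 m2]]; exists m.
have kle : {mono k : x y / x <= y} by exact: le_mono.
have hm (j : int) x : h (x + j%:~R) = h x + j%:~R by exact: per_int.
split.
- by rewrite -[p + _]hK kle hm.
- by rewrite -[p + _ + 1]hK kle hper hm.
Qed.

Lemma lncross_dist y1 y2 y3 y4 : y1 < y2 -> y2 < y3 -> y3 < y4 ->
  `|lncross k y1 y2 y3 y4| <= 2 * M * (y4 - y1) `^ alpha.
Proof.
move=> y12 y23 y34.
have h1 : `|lnslope R k y1 y2 - lnslope R k y1 y3| <= M * (y4 - y1) `^ alpha.
  by apply: kdist; lra.
have h2 : `|lnslope R k y3 y4 - lnslope R k y2 y4| <= M * (y4 - y1) `^ alpha.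
  by apply: kdist; lra.
have -> : lncross k y1 y2 y3 y4 = (lnslope R k y1 y2 - lnslope R k y1 y3) +
    (lnslope R k y3 y4 - lnslope R k y2 y4) by rewrite /lncross; ring.
by apply: le_trans (ler_normD _ _) _; lra.
Qed.

(** The distortion of [k \o iter n G = iter n F \o k] is computed in two ways. The terms of [G]
    vanish and those of [F] have a definite sign, so their sum is bounded by the distortion of [k]
    at the two ends of the orbit alone, which Hoelder continuity controls. *)
Lemma cross_obstruction n y1 y2 y3 y4 : y1 < y2 -> y2 < y3 -> y3 < y4 ->
  (forall i, (i < n)%N -> break_free R p (iter i G y1) (iter i G y4)) ->
  (forall i, (i < n)%N -> break_free R (h p) (iter i G y1) (iter i G y4)) ->
  \sum_(i < n) kappa / L ^+ 2 * (iter i G y4 - iter i G y1) *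
      (iter i G y3 - iter i G y2) <=
    2 * M * ((y4 - y1) `^ alpha + (iter n G y4 - iter n G y1) `^ alpha).
Proof.
move=> y12 y23 y34 bfG bfh.
have Gh := il_homo _ _ _ _ GL.
have ih i : {homo iter i G : x y / x < y} := iter_homo _ _ _ _ GL i.
have fh i : {homo iter i F : x y / x < y}.
  by move=> x y xy; elim: i => //= i; exact: Fhomo.
have y13 := lt_trans y12 y23; have y24 := lt_trans y23 y34.
have y14 := lt_trans y12 y24.
have e1 : lncross (k \o iter n G) y1 y2 y3 y4 =
    lncross k (iter n G y1) (iter n G y2) (iter n G y3) (iter n G y4).
  rewrite (lncross_comp k (iter n G)) // (lncross_iter _ Gh) // big1 ?addr0 // => i _.
  by apply: Gcross; rewrite ?ih //; exact: bfG.
have e2 : lncross (k \o iter n G) y1 y2 y3 y4 = lncross (iter n F \o k) y1 y2 y3 y4.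
    rewrite (_ : k \o iter n G = iter n F \o k) //.
    by apply/funext => x /=; rewrite k_iter.
have e3 : lncross (iter n F \o k) y1 y2 y3 y4 = lncross k y1 y2 y3 y4 +
    \sum_(i < n) lncross F (iter i F (k y1)) (iter i F (k y2)) (iter i F (k y3))
      (iter i F (k y4)).
  by rewrite (lncross_comp (iter n F) k) // (lncross_iter _ Fhomo) ?khomo // addrC.
have b1 := lncross_dist _ _ _ _ y12 y23 y34.
have b2 := lncross_dist _ _ _ _ (ih n _ _ y12) (ih n _ _ y23) (ih n _ _ y34).
have : \sum_(i < n) kappa / L ^+ 2 * (iter i G y4 - iter i G y1) *
    (iter i G y3 - iter i G y2) <=
  - \sum_(i < n) lncross F (iter i F (k y1)) (iter i F (k y2)) (iter i F (k y3))
      (iter i F (k y4)).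
  rewrite -sumrN; apply: ler_sum => i _; rewrite lerNr -!k_iter.
  have z12 := ih i _ _ y12; have z23 := ih i _ _ y23; have z34 := ih i _ _ y34.
  have z14 := ih i _ _ y14.
  apply: le_trans (Fcross _ _ _ _ _ (khomo _ _ z12) (khomo _ _ z23) (khomo _ _ z34)) _.
    exact/bfF/bfh.
  rewrite lerN2 (_ : kappa / L ^+ 2 * (iter i G y4 - iter i G y1) *
    (iter i G y3 - iter i G y2) = kappa * ((iter i G y4 - iter i G y1) / L) *
    ((iter i G y3 - iter i G y2) / L)); last by field; rewrite gt_eqF.
  have q1 : 0 < (iter i G y4 - iter i G y1) / L by rewrite divr_gt0 ?subr_gt0.
  have q2 : 0 < (iter i G y3 - iter i G y2) / L by rewrite divr_gt0 ?subr_gt0.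
  apply: ler_pM (ltW q2) _ (klow _ _ z23).
    exact: mulr_ge0 (ltW kappa0) (ltW q1).
  by rewrite ler_pM2l // klow.
have -> : \sum_(i < n) lncross F (iter i F (k y1)) (iter i F (k y2)) (iter i F (k y3))
      (iter i F (k y4)) = lncross k (iter n G y1) (iter n G y2) (iter n G y3) (iter n G y4)
      - lncross k y1 y2 y3 y4 by rewrite -e1 e2 e3; ring.
move=> /le_trans; apply.
move: b1 b2; rewrite !ler_norml => /andP[b1 b2] /andP[b3 b4]; lra.
Qed.

End CrossRatio.

(** * Contradiction with a smooth conjugacy *)

Section NoConjugacy.
Variable R : realType.
Variables (G Gi : R -> R) (t : R).
Hypothesis GL : irrational_lift R G Gi t.
Variables (p V K0 K1 : R).
Hypotheses (V0 : 0 <= V) (K00 : 0 < K0) (K10 : 0 <= K1).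
Hypothesis BL : break_law R G p V K0 K1.
Hypothesis Gcross : forall y1 y2 y3 y4, break_free R p y1 y4 ->
  y1 < y2 -> y2 < y3 -> y3 < y4 -> lncross R G y1 y2 y3 y4 = 0.

Local Notation th := (th R t).
Local Notation act := (act R G Gi).
Local Notation width := (width R G Gi t GL).
Local Notation E := (dist_cst R V K1).
Local Notation b := (sum_cst R V K1).

Variables (F : R -> R) (kappa : R).
Hypotheses (Fhomo : {homo F : x y / x < y}) (kappa0 : 0 < kappa).
Hypothesis Fcross : forall y1 y2 y3 y4, break_free R p y1 y4 ->
  y1 < y2 -> y2 < y3 -> y3 < y4 ->
  lncross R F y1 y2 y3 y4 <= - (kappa * (y4 - y1) * (y3 - y2)).

Variables (h k : R -> R) (alpha L M : R).
Hypotheses (hK : cancel h k) (kK : cancel k h).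
Hypotheses (hhomo : {homo h : x y / x < y}) (hper : forall x, h (x + 1) = h x + 1).
Hypothesis kG : forall x, k (G x) = F (k x).
Hypotheses (L0 : 0 < L) (M0 : 0 <= M) (alpha0 : 0 < alpha).
Hypothesis klow : forall x y, x < y -> (y - x) / L <= k y - k x.
Hypothesis kdist : forall a e u v u' v', a <= u -> u < v -> v <= e ->
  a <= u' -> u' < v' -> v' <= e ->
  `|lnslope R k u v - lnslope R k u' v'| <= M * (e - a) `^ alpha.

(** Two cuts, for [p] and for [h p], leave at least a quarter of the shortest arc, and its three
    equal parts are at least a twelfth: hence [48 = 4 * 12]. The sum of the squared lengths is at
    least [b ^+ 2 / q'], and [q' * th d <= 1]. *)
Lemma cross_level q k0 q' k' : level R t q k0 q' k' ->
  kappa / L ^+ 2 * b ^+ 2 / (48 * E ^+ 2) * th (pos R t (q%:Z, k0)) <=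
  2 * M * (1 + (E / b) `^ alpha) * width (pos R t (q%:Z, k0)) `^ alpha.
Proof.
set d := pos _ _ _ => lv; have q'0 := lv_gt0 _ _ _ _ _ _ lv.
pose x := argmin R G Gi t GL d; pose e := act d x.
have eW : e - x = width d by [].
have ltd z : z < act d z by exact: (act_pos_gt _ _ _ _ GL _ _ _ _ lv).
have xe : x < e := ltd x.
have W0 : 0 < width d by rewrite -eW subr_gt0.
have E0 : 0 < E by exact: expR_gt0.
have b0 : 0 < b := sum_cst_gt0 _ _ _.
have ile i := iter_le _ _ _ _ GL i.
have ih i : {homo iter i G : x y / x < y} := iter_homo _ _ _ _ GL i.
have cut P u v : x <= u -> u < v -> v <= e -> exists u' v', [/\ u <= u', v' <= v,
    (v - u) / 2 <= v' - u' &
    forall i, (i < q')%N -> break_free R P (iter i G u') (iter i G v')].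
  move=> xu uv ve; have vd : v <= act d u.
    by apply: le_trans ve _; rewrite (act_le _ _ _ _ GL).
  have [z [/andP[uz zv] bf]] := break_point _ _ _ _ GL P _ _ _ _ lv _ _ uv vd.
  have [c|c] := leP ((v - u) / 2) (z - u).
  - by exists u, z; split=> // i iq; case: (bf i iq).
  - by exists z, v; split=> //; [lra|move=> i iq; case: (bf i iq)].
have [u1 [v1 [xu1 v1e l1 bf1]]] := cut p x e (lexx _) xe (lexx _).
have uv1 : u1 < v1 by lra.
have [u2 [v2 [u12 v21 l2 bf2]]] := cut (h p) u1 v1 xu1 uv1 v1e.
have {}bf1 i : (i < q')%N -> break_free R p (iter i G u2) (iter i G v2).
  by move=> iq; apply: break_freeS (bf1 i iq) _ _; rewrite ile.
pose r := (v2 - u2) / 3.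
have r0 : width d / 12 <= r by rewrite /r -eW; lra.
have r1 : 0 < r by lra.
pose y2 := u2 + r; pose y3 := y2 + r.
have y12 : u2 < y2 by rewrite /y2; lra.
have y23 : y2 < y3 by rewrite /y3; lra.
have v2E : v2 = y3 + r by rewrite /y3 /y2 /r; field.
have y34 : y3 < v2 by rewrite v2E; lra.
have xu2 : x <= u2 by lra.
have v2e : v2 <= e by lra.
have e2 : e <= act (d *+ 2) x by rewrite (act2 _ _ _ _ GL); exact: ltW.
have obs := cross_obstruction _ _ _ _ GL _ Gcross _ _ Fhomo kappa0 Fcross
  _ _ _ _ _ hK kK hhomo hper kG L0 klow kdist _ _ _ _ _ y12 y23 y34 bf1 bf2.
pose a i := iter i G e - iter i G x.
have a0 i : 0 < a i by rewrite subr_gt0 ih.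
have frac i u v c : (i <= q')%N -> 0 < c -> x <= u -> u < v -> v <= e ->
    width d / c <= v - u -> a i / (c * E) <= iter i G v - iter i G u.
  move=> iq c0 xu uv ve cuv.
  have := slope_dist _ _ _ _ GL _ _ _ _ V0 K10 BL _ _ _ _ lv x x e u v i iq
    (lexx _) xe e2 xu uv (le_trans ve e2).
  rewrite /slope -/(a i) eW ler_pdivrMr // => s.
  have vu0 : 0 < v - u by rewrite subr_gt0.
  rewrite ler_pdivrMr ?mulr_gt0 //; apply: le_trans s _.
  set S := iter i G v - iter i G u.
  have S0 : 0 < S by rewrite subr_gt0 ih.
  rewrite (_ : S * (c * E) = E * (S / (v - u)) * (c * (v - u))).
    rewrite ler_pM2l ?mulr_gt0 ?invr_gt0 //.
    by rewrite mulrC -ler_pdivrMr.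
  by field; rewrite gt_eqF.
have low : kappa / L ^+ 2 * b ^+ 2 / (48 * E ^+ 2) * th d <=
    \sum_(i < q') kappa / L ^+ 2 * (iter i G v2 - iter i G u2) *
      (iter i G y3 - iter i G y2).
  have kL : 0 < kappa / L ^+ 2 by rewrite divr_gt0 ?exprn_gt0.
  have th0 : 0 <= th d by rewrite ltW // (th_pos_gt0 _ _ _ _ _ _ lv).
  apply: le_trans (_ : \sum_(i < q') kappa / L ^+ 2 * (48 * E ^+ 2)^-1 * a i ^+ 2 <= _).
    rewrite -mulr_sumr.
    rewrite (_ : kappa / L ^+ 2 * b ^+ 2 / (48 * E ^+ 2) * th d =
      kappa / L ^+ 2 * (48 * E ^+ 2)^-1 * (b ^+ 2 * th d)); last by ring.
    rewrite ler_pM2l; last by rewrite mulr_gt0 // invr_gt0 mulr_gt0 // exprn_gt0.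
    apply: le_trans (_ : b ^+ 2 / q'%:R <= _).
      rewrite ler_pM2l ?exprn_gt0 // -div1r ler_pdivlMr ?ltr0n // mulrC.
      by rewrite th_pos; exact: (level_th_le _ _ _ _ _ _ lv).
    apply: (sum_sqr_ge _ _ (fun i : 'I_q' => a i)) => //; first exact: ltW.
    apply: le_trans (sum_step_ge _ _ _ _ GL _ _ _ _ V0 K10 BL _ _ _ _ lv x) _.
    by apply: ler_sum => i _; rewrite /a /e (iter_act _ _ _ _ GL).
  apply: ler_sum => i _; have iq := ltnW (ltn_ord i).
  rewrite (_ : kappa / L ^+ 2 * (48 * E ^+ 2)^-1 * a i ^+ 2 =
    kappa / L ^+ 2 * (a i / (4 * E)) * (a i / (12 * E))); last first.
    by field; rewrite !gt_eqF.
  have q1 : 0 < a i / (4 * E) by rewrite divr_gt0 ?mulr_gt0.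
  have q2 : 0 < a i / (12 * E) by rewrite divr_gt0 ?mulr_gt0.
  apply: ler_pM (ltW q2) _ _; first exact: mulr_ge0 (ltW kL) (ltW q1).
    rewrite ler_pM2l //; apply: frac => //; first exact: lt_trans (lt_trans y12 y23) y34.
    by rewrite -eW; lra.
  apply: frac => //; first by rewrite (le_trans xu2) ?ltW.
    by rewrite (le_trans (ltW y34)).
  by rewrite /y3 addrAC subrr add0r.
apply: le_trans low (le_trans obs _).
have wa : (v2 - u2) `^ alpha <= width d `^ alpha.
  have uv2 : v2 - u2 <= width d by rewrite -eW; lra.
  have uv0 : 0 <= v2 - u2 by lra.
  exact: ge0_ler_powR (ltW alpha0) _ _ uv0 (ltW W0) uv2.
have wb : (iter q' G v2 - iter q' G u2) `^ alpha <= (E / b) `^ alpha * width d `^ alpha.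
  have eb : 0 <= E / b by rewrite divr_ge0 // ltW.
  have ebW : 0 <= E / b * width d by rewrite mulr_ge0 // ltW.
  rewrite -powRM // ?(ltW W0) //.
  have i0 : 0 <= iter q' G v2 - iter q' G u2 by rewrite subr_ge0 ile; lra.
  apply: ge0_ler_powR (ltW alpha0) _ _ i0 ebW _.
  have /andP[_ s] := slope_return _ _ _ _ GL _ _ _ _ V0 K10 BL _ _ _ _ lv x.
  rewrite /slope -/e -/(a q') eW ler_pdivrMr // in s.
  by apply: le_trans s; rewrite /a lerB // ile.
rewrite -[2 * M * _ * _]mulrA ler_wpM2l ?mulr_ge0 // mulrDl mul1r.
exact: lerD.
Qed.

(** With [density_decay], [cross_level] becomes [c1 <= C2 * T m ^ gam] for infinitely many [m],
    where [gam > 0], whereas [T m] tends to 0. *)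
Lemma no_conjugacy : 1 < (1 + decay_exp R V K0 K1) * alpha -> False.
Proof.
move=> exp1; set e0 := decay_exp R V K0 K1 in exp1.
have [q [kk lvh]] := levels_ex _ _ (il_irr _ _ _ _ GL).
have lv n := proj1 (lvh n); have hv n := proj2 (lvh n).
have [A A0 decay] := density_decay _ _ _ _ V0 K00 K10 _ _ _ _ GL BL _ _ lv hv.
pose T n := th (pos R t ((q n)%:Z, kk n)).
have T0 n : 0 < T n := th_pos_gt0 _ _ _ _ _ _ (lv n).
have Tle m n : (m <= n)%N -> T n <= T m.
  move=> /subnK <-; elim: (n - m)%N => // j ih; apply: le_trans ih.
  by apply: ltW; exact: th_pos_lt (lv _).
have E0 : 0 < E by exact: expR_gt0.
have b0 : 0 < b := sum_cst_gt0 _ _ _.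
pose c1 := kappa / L ^+ 2 * b ^+ 2 / (48 * E ^+ 2).
have c10 : 0 < c1.
  apply: divr_gt0; last by apply: mulr_gt0 => //; exact: exprn_gt0.
  by apply: mulr_gt0; [apply: divr_gt0 => //|]; exact: exprn_gt0.
pose C2 := 2 * M * (1 + (E / b) `^ alpha) * A `^ alpha.
have C20 : 0 <= C2.
  by rewrite !mulr_ge0 ?addr_ge0 ?powR_ge0.
pose gam := (1 + e0) * alpha - 1; have gam0 : 0 < gam by rewrite /gam; lra.
have key N : exists2 m, (N <= m)%N & c1 <= C2 * T m `^ gam.
  have [m Nm wm] := decay N; exists m => //.
  have := cross_level _ _ _ _ (lv m); rewrite /= -/(T m) -/c1 => h1.
  have h2 : width (pos R t ((q m)%:Z, kk m)) `^ alpha <= A `^ alpha * (T m * T m `^ gam).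
    rewrite -[X in X * _ `^ gam]powRr1 ?(ltW (T0 m)) // -powRD; last first.
      by apply/implyP => _; rewrite gt_eqF.
    rewrite (_ : 1 + gam = (1 + e0) * alpha); last by rewrite /gam; ring.
    rewrite powRrM -powRM ?(ltW A0) ?powR_ge0 //.
    apply: ge0_ler_powR; rewrite ?nnegrE ?(ltW alpha0) ?mulr_ge0 ?powR_ge0 ?(ltW A0) //.
    by apply/ltW/(width_gt0 _ _ _ _ GL)/T0.
  rewrite -(ler_pM2r (T0 m)); apply: le_trans h1 _.
  apply: le_trans (_ : 2 * M * (1 + (E / b) `^ alpha) * (A `^ alpha * (T m * T m `^ gam)) <= _).
    by rewrite ler_wpM2l // !mulr_ge0 ?addr_ge0 ?powR_ge0.
  by rewrite /C2 le_eqVlt; apply/orP; left; apply/eqP; ring.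
(* The threshold below which [T m ^ gam < c1 / (C2 + 1)]; the [+ 1] avoids a division by
   [C2 = 0]. *)
pose s := (c1 / (C2 + 1)) `^ gam^-1.
have s0 : 0 < s by rewrite powR_gt0 // divr_gt0 //; lra.
have [N _ Ns] := levels_th_lt _ _ _ _ hv s 0%N s0.
have [m Nm cm] := key N.
have Ts : T m < s by apply: le_lt_trans (Tle _ _ Nm) _; rewrite /T th_pos.
have : T m `^ gam < c1 / (C2 + 1).
  rewrite (_ : c1 / (C2 + 1) = s `^ gam).
    by apply: gt0_ltr_powR; rewrite ?nnegrE ?ltW.
  rewrite /s -powRrM mulVf ?gt_eqF // powRr1 // divr_ge0 ?ltW //; lra.
have C21 : 0 < C2 + 1 by lra.
rewrite ltr_pdivlMr // => lt1.
have : 0 < T m `^ gam by rewrite powR_gt0.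
by move: cm lt1; move: (T m `^ gam) => y; nra.
Qed.

End NoConjugacy.

(** * Lifts built from one period *)

Section Extension.
Variable R : realType.
Variables (p b : R) (P : R -> R).

Definition ext (x : R) : R :=
  b + (Num.floor (x - p))%:~R + P (x - p - (Num.floor (x - p))%:~R).

Hypotheses (P0 : P 0 = 0) (P1 : P 1 = 1).

(** The case [x = 1], where the floor jumps, is included thanks to [P0] and [P1]. *)
Lemma ext_val (n : int) x : 0 <= x <= 1 -> ext (p + n%:~R + x) = b + n%:~R + P x.
Proof.
move=> /andP[x0]; rewrite le_eqVlt => /orP[/eqP ->|x1]; rewrite /ext.
- have -> : p + n%:~R + 1 - p = (n + 1)%:~R by rewrite rmorphD /=; ring.
  by rewrite intrKfloor subrr P0 P1 addr0 rmorphD /= addrA.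
- have -> : p + n%:~R + x - p = n%:~R + x by ring.
  have -> : Num.floor (n%:~R + x) = n.
    by apply: floor_def; rewrite lerDl x0 rmorphD /= ltrD2l.
  by have -> : n%:~R + x - n%:~R = x by ring.
Qed.

Lemma ext_coord x : exists (n : int) y, [/\ 0 <= y, y < 1 & x = p + n%:~R + y].
Proof.
have h1 : (Num.floor (x - p))%:~R <= x - p := floor_le _.
have h2 : x - p < (Num.floor (x - p))%:~R + 1.
  by rewrite -[1]/(1%:~R) -rmorphD floorD1_gt.
exists (Num.floor (x - p)), (x - p - (Num.floor (x - p))%:~R).
by split; [lra|lra|ring].
Qed.

Lemma ext_per x : ext (x + 1) = ext x + 1.
Proof.
have [n [y [y0 y1 ->]]] := ext_coord x.
have yi : 0 <= y <= 1 by rewrite y0 ltW.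
have -> : p + n%:~R + y + 1 = p + (n + 1)%:~R + y by rewrite rmorphD /=; ring.
by rewrite !ext_val // rmorphD /=; ring.
Qed.

Variables m M : R.
Hypothesis Pbd : forall x y, 0 <= x -> x < y -> y <= 1 ->
  m * (y - x) <= P y - P x <= M * (y - x).

(** [P0] and [P1] force [m <= 1 <= M], so whole periods between [x] and [y] obey the same bounds as
    [P]. *)
Lemma ext_bd x y : x < y -> m * (y - x) <= ext y - ext x <= M * (y - x).
Proof.
have [i [u [u0 u1 ->]]] := ext_coord x; have [j [v [v0 v1 ->]]] := ext_coord y.
have ui : 0 <= u <= 1 by rewrite u0 ltW.
have vi : 0 <= v <= 1 by rewrite v0 ltW.
rewrite !ext_val // => xy.
have [ij|ij|ij] := ltgtP i j; last first.
- move: xy; rewrite ij !ltrD2l => uv.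
  have := Pbd _ _ u0 uv (ltW v1).
  have -> : p + j%:~R + v - (p + j%:~R + u) = v - u by ring.
  by have -> : b + j%:~R + P v - (b + j%:~R + P u) = P v - P u by ring.
- have : j%:~R + 1 <= i%:~R :> R by rewrite -[1]/(1%:~R) -rmorphD ler_int lezD1.
  by move: xy; lra.
have m1 : m <= 1 <= M.
  have /andP[a1 a2] := Pbd _ _ (lexx 0) ltr01 (lexx 1).
  by rewrite P0 P1 in a1 a2; apply/andP; split; lra.
have bu : m * (1 - u) <= 1 - P u <= M * (1 - u).
  by have := Pbd _ _ u0 u1 (lexx 1); rewrite P1.
have bv : m * v <= P v <= M * v.
  move: v0; rewrite le_eqVlt => /orP[/eqP <-|v0']; first by rewrite P0 !mulr0 lexx.
  by have := Pbd _ _ (lexx 0) v0' (ltW v1); rewrite P0 !subr0.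
have jk : i%:~R + 1 <= j%:~R :> R by rewrite -[1]/(1%:~R) -rmorphD ler_int lezD1.
have [/andP[b1 b2] [/andP[b3 b4] /andP[m2 m3]]] := (bu, (bv, m1)).
have e1 : m * (j%:~R - i%:~R - 1) <= (j%:~R - i%:~R - 1) :> R.
  by rewrite ler_piMl //; lra.
have e2 : (j%:~R - i%:~R - 1) <= M * (j%:~R - i%:~R - 1) :> R.
  by rewrite ler_peMl //; lra.
by apply/andP; split; lra.
Qed.

Hypothesis m0 : 0 < m.

Lemma ext_homo : {homo ext : x y / x < y}.
Proof.
move=> x y xy; have /andP[h _] := ext_bd _ _ xy.
by rewrite -subr_gt0 (lt_le_trans _ h) // mulr_gt0 // subr_gt0.
Qed.

Lemma ext_lip x y : `|ext x - ext y| <= M * `|x - y|.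
Proof.
wlog xy : x y / x < y => [hw|].
  have [/hw//|yx|->] := ltgtP x y; last by rewrite !subrr normr0 mulr0.
  by rewrite distrC [`|x - y|]distrC; exact: hw.
have /andP[_ h] := ext_bd _ _ xy.
rewrite distrC [`|x - y|]distrC !gtr0_norm ?subr_gt0 //.
exact: ext_homo.
Qed.

Lemma ext_cont : continuous ext.
Proof.
have M0 : 0 < M.
  have /andP[a1 a2] := Pbd _ _ (lexx 0) ltr01 (lexx 1).
  by move: a1 a2; rewrite P0 P1; lra.
move=> x; apply/cvgrPdist_lt => e e0; near=> y.
apply: le_lt_trans (ext_lip _ _) _; rewrite mulrC -ltr_pdivlMr //.
near: y; apply: cvgr_dist_lt => //; exact: divr_gt0.
Unshelve. all: by end_near. Qed.

End Extension.

(** * The maps of [[0, 1]] behind [g] and the family *)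

Section Model.
Variable R : realType.

(* For r = 1 this is the Moebius map x / (s + (1 - s) x) of [0, 1]; in general
   it is its composition (with s r in place of s) with the quadratic map quad r,
   whose derivatives at 0 and 1 have the ratio r ^ 2. *)
Definition quad (r x : R) : R := (2 * r ^+ 2 * x - (r ^+ 2 - 1) * x ^+ 2) / (r ^+ 2 + 1).

Definition mden (s y : R) : R := s + (1 - s) * y.

Definition model (s r x : R) : R := quad r x / mden (s * r) (quad r x).

(** The coefficient in [quad r x = x * (1 + tilt r - tilt r * x)]; for [r >= 1] it vanishes only in
    the Moebius case [r = 1]. *)
Definition tilt (r : R) : R := (r ^+ 2 - 1) / (r ^+ 2 + 1).

Variables (s r : R).
Hypotheses (s0 : 0 < s) (r1 : 1 <= r).

Let r21 : 0 < r ^+ 2 + 1.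
Proof. by have := sqr_ge0 r; lra. Qed.

Lemma tilt_itv : 0 <= tilt r < 1.
Proof.
rewrite /tilt divr_ge0 ?ltr_pdivrMr //=; last 2 first.
- by rewrite subr_ge0 exprn_ege1.
- exact: ltW.
by lra.
Qed.

Lemma quadB x y : quad r y - quad r x = (y - x) * (1 + tilt r - tilt r * (x + y)).
Proof. by rewrite /quad /tilt; field; rewrite gt_eqF. Qed.

Lemma quad0 : quad r 0 = 0.
Proof. by rewrite /quad expr0n /= !mulr0 subrr mul0r. Qed.

Lemma quad1 : quad r 1 = 1.
Proof. by rewrite /quad; field; rewrite gt_eqF. Qed.

Lemma quad_factor x y : 0 <= x <= 1 -> 0 <= y <= 1 ->
  1 - tilt r <= 1 + tilt r - tilt r * (x + y) <= 1 + tilt r.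
Proof.
move=> /andP[x0 x1] /andP[y0 y1]; have /andP[u0 u1] := tilt_itv.
by apply/andP; split; nra.
Qed.

Lemma quad_homo x y : 0 <= x -> x < y -> y <= 1 -> quad r x < quad r y.
Proof.
move=> x0 xy y1; rewrite -subr_gt0 quadB mulr_gt0 ?subr_gt0 //.
have xi : 0 <= x <= 1 by rewrite x0 (le_trans (ltW xy)).
have yi : 0 <= y <= 1 by rewrite y1 (le_trans x0) ?ltW.
have /andP[h _] := quad_factor _ _ xi yi; have /andP[u0 u1] := tilt_itv.
by lra.
Qed.

Lemma quad_itv x : 0 <= x <= 1 -> 0 <= quad r x <= 1.
Proof.
move=> /andP[x0 x1]; apply/andP; split.
- rewrite -quad0; move: x0; rewrite le_eqVlt => /orP[/eqP ->//|x0].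
  by apply/ltW/quad_homo.
- rewrite -[leRHS]quad1; move: x1; rewrite le_eqVlt => /orP[/eqP ->//|x1].
  by apply/ltW/quad_homo.
Qed.

(** [mden s] is affine on [[0, 1]] with end values [s] and 1; [dmin] and [dmax] are its extreme
    values. *)
Definition dmin (s : R) : R := Num.min s 1.
Definition dmax (s : R) : R := Num.max s 1.

Lemma mden_itv (a y : R) : 0 <= y <= 1 -> dmin a <= mden a y <= dmax a.
Proof.
rewrite /mden /dmin /dmax => /andP[y0 y1]; have [a1|a1] := leP a 1.
- by apply/andP; split; nra.
- by apply/andP; split; nra.
Qed.

Lemma dmin_gt0 (a : R) : 0 < a -> 0 < dmin a.
Proof. by move=> a0; rewrite /dmin lt_min a0 /=. Qed.

Lemma dmax_ge1 (a : R) : 1 <= dmax a.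
Proof. by rewrite /dmax le_max lexx orbT. Qed.

Lemma mden_gt0 (a y : R) : 0 < a -> 0 <= y <= 1 -> 0 < mden a y.
Proof. by move=> a0 /(mden_itv a)/andP[h _]; apply: lt_le_trans h; exact: dmin_gt0. Qed.

Let sr0 : 0 < s * r.
Proof. by rewrite mulr_gt0 // (lt_le_trans ltr01). Qed.

Local Notation den x := (mden (s * r) (quad r x)).

Lemma den_gt0 x : 0 <= x <= 1 -> 0 < den x.
Proof. by move=> /quad_itv; exact: mden_gt0. Qed.

Lemma modelB x y : 0 <= x <= 1 -> 0 <= y <= 1 ->
  model s r y - model s r x = s * r * (quad r y - quad r x) / (den x * den y).
Proof.
move=> xi yi; have dx := den_gt0 _ xi; have dy := den_gt0 _ yi.
rewrite /model; move: dx dy; rewrite /mden; move: (quad r x) (quad r y) => u v dx dy.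
by field; rewrite !gt_eqF.
Qed.

Lemma model0 : model s r 0 = 0.
Proof. by rewrite /model quad0 mul0r. Qed.

Lemma model1 : model s r 1 = 1.
Proof. by rewrite /model quad1 /mden mulr1 subrKC divr1. Qed.

(** The Moebius part splits into a function of [x] plus the same function of [y], so it cancels in
    [lncross]. *)
Lemma lnslope_model x y : 0 <= x -> x < y -> y <= 1 ->
  lnslope R (model s r) x y =
  ln (1 + tilt r - tilt r * (x + y)) + ln (s * r) - ln (den x) - ln (den y).
Proof.
move=> x0 xy y1; have xi : 0 <= x <= 1 by rewrite x0 (le_trans (ltW xy)).
have yi : 0 <= y <= 1 by rewrite y1 (le_trans x0) ?ltW.
have dx := den_gt0 _ xi; have dy := den_gt0 _ yi.
have /andP[f0 _] := quad_factor _ _ xi yi; have /andP[u0 u1] := tilt_itv.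
have f1 : 0 < 1 + tilt r - tilt r * (x + y) by lra.
rewrite /lnslope /slope modelB // quadB.
set A := 1 + tilt r - _ in f1 *.
have h1 : 0 < A * (s * r) := mulr_gt0 f1 sr0.
have h2 : 0 < A * (s * r) / den x := divr_gt0 h1 dx.
have -> : s * r * ((y - x) * A) / (den x * den y) / (y - x) =
    A * (s * r) / den x / den y.
  by field; rewrite !gt_eqF // subr_gt0.
by rewrite (ln_div h2 dy) (ln_div h1 dx) (lnM f1 sr0).
Qed.

Lemma model_bd x y : 0 <= x -> x < y -> y <= 1 ->
  s * r * (1 - tilt r) / dmax (s * r) ^+ 2 * (y - x) <= model s r y - model s r x <=
  s * r * (1 + tilt r) / dmin (s * r) ^+ 2 * (y - x).
Proof.
move=> x0 xy y1; have xi : 0 <= x <= 1 by rewrite x0 (le_trans (ltW xy)).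
have yi : 0 <= y <= 1 by rewrite y1 (le_trans x0) ?ltW.
have dx := den_gt0 _ xi; have dy := den_gt0 _ yi.
have /andP[f0 f1] := quad_factor _ _ xi yi; have /andP[u0 u1] := tilt_itv.
rewrite modelB // quadB.
have /andP[d1 d2] := mden_itv (s * r) _ (quad_itv _ xi).
have /andP[d3 d4] := mden_itv (s * r) _ (quad_itv _ yi).
have m0 := dmin_gt0 _ sr0; have M1 := dmax_ge1 (s * r).
have M0 : 0 < dmax (s * r) by lra.
set f := 1 + tilt r - tilt r * (x + y) in f0 f1 *.
have q0 : 0 < s * r * (y - x) by rewrite mulr_gt0 // subr_gt0.
have e1 : (dmax (s * r) ^+ 2)^-1 <= (den x * den y)^-1.
  by rewrite lef_pV2 ?posrE ?mulr_gt0 ?exprn_gt0 // expr2 ler_pM // ltW.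
have e2 : (den x * den y)^-1 <= (dmin (s * r) ^+ 2)^-1.
  by rewrite lef_pV2 ?posrE ?mulr_gt0 ?exprn_gt0 // expr2 ler_pM // ltW.
have i1 : 0 <= (dmax (s * r) ^+ 2)^-1 by rewrite invr_ge0 exprn_ge0 // ltW.
have i2 : 0 <= (den x * den y)^-1 by rewrite invr_ge0 mulr_ge0 // ltW.
have -> : s * r * ((y - x) * f) / (den x * den y) =
  s * r * (y - x) * (f * (den x * den y)^-1) by ring.
have -> : s * r * (1 - tilt r) / dmax (s * r) ^+ 2 * (y - x) =
  s * r * (y - x) * ((1 - tilt r) * (dmax (s * r) ^+ 2)^-1) by ring.
have -> : s * r * (1 + tilt r) / dmin (s * r) ^+ 2 * (y - x) =
  s * r * (y - x) * ((1 + tilt r) * (dmin (s * r) ^+ 2)^-1) by ring.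
rewrite !(ler_pM2l q0); apply/andP; split; apply: ler_pM => //; lra.
Qed.

Lemma model_low_gt0 : 0 < s * r * (1 - tilt r) / dmax (s * r) ^+ 2.
Proof.
have /andP[u0 u1] := tilt_itv; have M1 := dmax_ge1 (s * r).
by apply: divr_gt0; [apply: mulr_gt0 sr0 _|apply: exprn_gt0]; lra.
Qed.

(** Only the quadratic factors remain. As they are affine in the sums of the endpoints, the two
    products differ by exactly [tilt r ^+ 2 * (x4 - x1) * (x3 - x2)]; then [ln (1 - y) <= - y]
    applies. *)
Lemma lncross_model x1 x2 x3 x4 : 0 <= x1 -> x1 < x2 -> x2 < x3 -> x3 < x4 ->
  x4 <= 1 -> lncross R (model s r) x1 x2 x3 x4 <=
  - (tilt r ^+ 2 / (1 + tilt r) ^+ 2 * (x4 - x1) * (x3 - x2)).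
Proof.
move=> x10 x12 x23 x34 x41; have /andP[u0 u1] := tilt_itv.
have itv z : x1 <= z -> z <= x4 -> 0 <= z <= 1.
  by move=> a1 a2; rewrite (le_trans x10 a1) (le_trans a2 x41).
have f z w : x1 <= z -> z <= x4 -> x1 <= w -> w <= x4 ->
    1 - tilt r <= 1 + tilt r - tilt r * (z + w) <= 1 + tilt r.
  by move=> *; apply: quad_factor; exact: itv.
have /andP[a1 _] : 1 - tilt r <= 1 + tilt r - tilt r * (x1 + x2) <= 1 + tilt r.
  by apply: f; lra.
have /andP[a2 _] : 1 - tilt r <= 1 + tilt r - tilt r * (x3 + x4) <= 1 + tilt r.
  by apply: f; lra.
have /andP[a3 b3] : 1 - tilt r <= 1 + tilt r - tilt r * (x1 + x3) <= 1 + tilt r.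
  by apply: f; lra.
have /andP[a4 b4] : 1 - tilt r <= 1 + tilt r - tilt r * (x2 + x4) <= 1 + tilt r.
  by apply: f; lra.
rewrite /lncross !lnslope_model; try lra.
have id : (1 + tilt r - tilt r * (x1 + x2)) * (1 + tilt r - tilt r * (x3 + x4)) =
  (1 + tilt r - tilt r * (x1 + x3)) * (1 + tilt r - tilt r * (x2 + x4)) -
  tilt r ^+ 2 * ((x4 - x1) * (x3 - x2)) by ring.
move: a1 a2 a3 b3 a4 b4 id.
set A12 := 1 + _ - _ * (x1 + x2); set A34 := 1 + _ - _ * (x3 + x4).
set A13 := 1 + _ - _ * (x1 + x3); set A24 := 1 + _ - _ * (x2 + x4).
move=> a1 a2 a3 b3 a4 b4 id.
have p1 : 0 < A12 by lra.
have p2 : 0 < A34 by lra.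
have p3 : 0 < A13 by lra.
have p4 : 0 < A24 by lra.
have Q0 : 0 < A13 * A24 by rewrite mulr_gt0.
have -> : ln A12 + ln (s * r) - ln (den x1) - ln (den x2) +
  (ln A34 + ln (s * r) - ln (den x3) - ln (den x4)) -
  (ln A13 + ln (s * r) - ln (den x1) - ln (den x3)) -
  (ln A24 + ln (s * r) - ln (den x2) - ln (den x4)) = ln (A12 * A34 / (A13 * A24)).
  by rewrite (ln_div (mulr_gt0 p1 p2) Q0) (lnM p1 p2) (lnM p3 p4); ring.
have -> : A12 * A34 / (A13 * A24) =
  1 + - (tilt r ^+ 2 * ((x4 - x1) * (x3 - x2)) / (A13 * A24)).
  by rewrite id; field; rewrite !gt_eqF.
have c0 : 0 <= tilt r ^+ 2 * ((x4 - x1) * (x3 - x2)).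
  by rewrite mulr_ge0 ?sqr_ge0 // mulr_ge0; lra.
have lt1 : tilt r ^+ 2 * ((x4 - x1) * (x3 - x2)) / (A13 * A24) < 1.
  rewrite ltr_pdivrMr // mul1r -subr_gt0 -id; exact: mulr_gt0.
apply: le_trans (le_ln1Dx _) _; first by rewrite ltrN2.
rewrite lerN2 (_ : tilt r ^+ 2 / (1 + tilt r) ^+ 2 * (x4 - x1) * (x3 - x2) =
  tilt r ^+ 2 * ((x4 - x1) * (x3 - x2)) / (1 + tilt r) ^+ 2); last by ring.
rewrite ler_wpM2l // lef_pV2 ?posrE // ?exprn_gt0 //; last by lra.
by rewrite expr2 ler_pM // ltW.
Qed.

End Model.

(** * Break law and cross ratios of the extended maps *)

Section ModelLaw.
Variable R : realType.
Variables (p b s : R).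
Hypothesis s0 : 0 < s.

Lemma lnslope_ext r (n : int) x y : 1 <= r -> 0 <= x -> x < y -> y <= 1 ->
  lnslope R (ext R p b (model R s r)) (p + n%:~R + x) (p + n%:~R + y) =
  lnslope R (model R s r) x y.
Proof.
move=> r1 x0 xy y1.
have m0 := model0 R s r; have m1 := model1 R s r.
rewrite /lnslope /slope !(ext_val _ _ _ _ m0 m1) ?x0 ?y1 ?(le_trans (ltW xy)) ?(le_trans x0 (ltW xy)) //.
congr (ln (_ / _)); ring.
Qed.

Lemma break_coord u v : break_free R p u v -> u <= v ->
  exists (n : int) x y, [/\ 0 <= x, y <= 1, u = p + n%:~R + x & v = p + n%:~R + y].
Proof.
move=> [n [n1 n2]] uv; exists n, (u - p - n%:~R), (v - p - n%:~R).
by split; [lra|lra|ring|ring].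
Qed.

Lemma ext_lncross_le r y1 y2 y3 y4 : 1 <= r -> break_free R p y1 y4 ->
  y1 < y2 -> y2 < y3 -> y3 < y4 ->
  lncross R (ext R p b (model R s r)) y1 y2 y3 y4 <=
  - (tilt R r ^+ 2 / (1 + tilt R r) ^+ 2 * (y4 - y1) * (y3 - y2)).
Proof.
move=> r1 bf y12 y23 y34; have y14 := lt_trans y12 (lt_trans y23 y34).
have [n [x1 [x4 [x10 x41 e1 e4]]]] := break_coord _ _ bf (ltW y14).
pose x2 := y2 - p - n%:~R; pose x3 := y3 - p - n%:~R.
have e2 : y2 = p + n%:~R + x2 by rewrite /x2; ring.
have e3 : y3 = p + n%:~R + x3 by rewrite /x3; ring.
move: x2 x3 e2 e3 y12 y23 y34 {y14 bf} => x2 x3 -> ->; rewrite e1 e4 !ltrD2l.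
move=> x12 x23 x34.
have {e1 e4} x13 := lt_trans x12 x23; have x24 := lt_trans x23 x34.
have x20 : 0 <= x2 by rewrite (le_trans x10) ?ltW.
have x30 : 0 <= x3 by rewrite (le_trans x20) ?ltW.
have x31 : x3 <= 1 by rewrite (le_trans (ltW x34)).
have x21 : x2 <= 1 by rewrite (le_trans (ltW x23)).
rewrite /lncross !lnslope_ext //.
have := lncross_model R s r s0 r1 _ _ _ _ x10 x12 x23 x34 x41.
rewrite /lncross => /le_trans; apply; rewrite le_eqVlt; apply/orP; left.
by apply/eqP; ring.
Qed.

Lemma tilt1 : tilt R 1 = 0.
Proof. by rewrite /tilt expr1n subrr mul0r. Qed.

Lemma lnslope_mobius (n : int) x y : 0 <= x -> x < y -> y <= 1 ->
  lnslope R (ext R p b (model R s 1)) (p + n%:~R + x) (p + n%:~R + y) =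
  ln s - ln (mden R s x) - ln (mden R s y).
Proof.
have q z : quad R 1 z = z by rewrite /quad expr1n; field.
move=> x0 xy y1; rewrite lnslope_ext // lnslope_model //.
by rewrite tilt1 mul0r subr0 addr0 ln1 add0r mulr1 !q.
Qed.

Lemma ext_lncross0 y1 y2 y3 y4 : break_free R p y1 y4 ->
  y1 < y2 -> y2 < y3 -> y3 < y4 ->
  lncross R (ext R p b (model R s 1)) y1 y2 y3 y4 = 0.
Proof.
move=> bf y12 y23 y34; have y14 := lt_trans y12 (lt_trans y23 y34).
have [n [x1 [x4 [x10 x41 e1 e4]]]] := break_coord _ _ bf (ltW y14).
pose x2 := y2 - p - n%:~R; pose x3 := y3 - p - n%:~R.
have e2 : y2 = p + n%:~R + x2 by rewrite /x2; ring.
have e3 : y3 = p + n%:~R + x3 by rewrite /x3; ring.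
move: x2 x3 e2 e3 y12 y23 y34 {y14 bf} => x2 x3 -> ->; rewrite e1 e4 !ltrD2l.
move=> x12 x23 x34.
have {e1 e4} x13 := lt_trans x12 x23; have x24 := lt_trans x23 x34.
have x20 : 0 <= x2 by rewrite (le_trans x10) ?ltW.
have x30 : 0 <= x3 by rewrite (le_trans x20) ?ltW.
have x31 : x3 <= 1 by rewrite (le_trans (ltW x34)).
have x21 : x2 <= 1 by rewrite (le_trans (ltW x23)).
by rewrite /lncross !lnslope_mobius //; ring.
Qed.

Definition low_cst (s r : R) : R := s * r * (1 - tilt R r) / dmax R (s * r) ^+ 2.
Definition high_cst (s r : R) : R := s * r * (1 + tilt R r) / dmin R (s * r) ^+ 2.

Definition slope_cst (s : R) : R := `|ln (low_cst s 1)| + `|ln (high_cst s 1)|.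
Definition curvlow_cst (s : R) : R := `|1 - s| / dmax R s.
Definition curvhigh_cst (s : R) : R := 2 * `|1 - s| / dmin R s.

Lemma ln_mden_le x y : 0 <= x <= 1 -> 0 <= y <= 1 ->
  `|ln (mden R s x) - ln (mden R s y)| <= `|1 - s| / dmin R s * `|x - y|.
Proof.
move=> xi yi; have m0 := dmin_gt0 _ _ s0.
have /andP[a1 _] := mden_itv _ s _ xi; have /andP[a2 _] := mden_itv _ s _ yi.
have := ln_dist_le _ _ _ _ m0 a1 a2.
rewrite (_ : mden R s x - mden R s y = (1 - s) * (x - y)); last by rewrite /mden; ring.
by rewrite normrM mulrAC ler_pdivlMr // mulrC.
Qed.

(** The three constants involve neither [p] nor [b]; this makes the final exponent a function of [c]
    alone. *)
Lemma mobius_break_law : s != 1 ->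
  break_law R (ext R p b (model R s 1)) p (slope_cst s) (curvlow_cst s) (curvhigh_cst s).
Proof.
move=> s1; have m0 := model0 R s 1; have m1 := model1 R s 1.
have bd := model_bd R s 1 s0 (lexx 1).
have s10 : 0 < `|1 - s| by rewrite normr_gt0 subr_eq0 eq_sym.
split.
- move=> u v uv; have /andP[h1 h2] := ext_bd _ p b _ m0 m1 _ _ bd _ _ uv.
  have l0 := model_low_gt0 R s 1 s0 (lexx 1).
  rewrite -/(low_cst s 1) in h1 l0; rewrite -/(high_cst s 1) in h2.
  have uv0 : 0 < v - u by rewrite subr_gt0.
  rewrite -ler_pdivlMr // in h1; rewrite -ler_pdivrMr // in h2.
  have sl0 := lt_le_trans l0 h1; have h0 := lt_le_trans sl0 h2.
  move: h1 h2; rewrite -ler_ln // => h1; rewrite -ler_ln // => h2.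
  rewrite /lnslope /slope /slope_cst.
  have := ler_norm (ln (high_cst s 1)); have := ler_norm (- ln (low_cst s 1)).
  rewrite normrN => h3 h4.
  have := normr_ge0 (ln (high_cst s 1)); have := normr_ge0 (ln (low_cst s 1)) => h5 h6.
  by rewrite ler_norml; apply/andP; split; lra.
- move=> a e u v u' v' bf au uv ve au' uv' ve'.
  have ae : a <= e by rewrite (le_trans au) // (le_trans (ltW uv)).
  have [n [x [y [x0 y1 ea ee]]]] := break_coord _ _ bf ae.
  have coord z : a <= z -> z <= e -> exists w, [/\ 0 <= w <= 1, x <= w <= y & z = p + n%:~R + w].
    move=> az ze; exists (z - p - n%:~R); split; last by ring.
      by apply/andP; split; lra.
    by apply/andP; split; lra.
  have [w1 [i1 b1 E1]] := coord u au (le_trans (ltW uv) ve).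
  have [w2 [i2 b2 E2]] := coord v (le_trans au (ltW uv)) ve.
  have [w3 [i3 b3 E3]] := coord u' au' (le_trans (ltW uv') ve').
  have [w4 [i4 b4 E4]] := coord v' (le_trans au' (ltW uv')) ve'.
  rewrite E1 E2 E3 E4 ltrD2l in uv uv' *; rewrite ltrD2l in uv'.
  have [/andP[i10 i11] /andP[i20 i21]] := (i1, i2).
  have [/andP[i30 i31] /andP[i40 i41]] := (i3, i4).
  rewrite !lnslope_mobius //.
  have -> : ln s - ln (mden R s w1) - ln (mden R s w2) -
      (ln s - ln (mden R s w3) - ln (mden R s w4)) =
    (ln (mden R s w3) - ln (mden R s w1)) + (ln (mden R s w4) - ln (mden R s w2)) by ring.
  apply: le_trans (ler_normD _ _) _.
  have d z w : x <= z <= y -> x <= w <= y -> `|z - w| <= e - a.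
    by move=> /andP[? ?] /andP[? ?]; rewrite ea ee ler_norml; apply/andP; split; lra.
  have c0 : 0 <= `|1 - s| / dmin R s by rewrite divr_ge0 ?normr_ge0 // ltW ?dmin_gt0.
  have l1 := le_trans (ln_mden_le _ _ i3 i1) (ler_wpM2l c0 (d _ _ b3 b1)).
  have l2 := le_trans (ln_mden_le _ _ i4 i2) (ler_wpM2l c0 (d _ _ b4 b2)).
  apply: le_trans (lerD l1 l2) _; rewrite /curvhigh_cst le_eqVlt.
  by apply/orP; left; apply/eqP; ring.
(* For [s < 1] the denominator increases, so the slope decreases; for [s > 1] it is the other way
   round. *)
- exists (if s < 1 then -1 else 1); first by case: ifP; [right|left].
  move=> y1 y2 y3 bf y12 y23; have y13 := lt_trans y12 y23.
  have [n [x1 [x3 [x10 x31 e1 e3]]]] := break_coord _ _ bf (ltW y13).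
  pose x2 := y2 - p - n%:~R.
  have e2 : y2 = p + n%:~R + x2 by rewrite /x2; ring.
  move: x2 e2 y12 y23 {bf} => x2 ->; rewrite e1 e3 !ltrD2l => x12 x23.
  have x13 := lt_trans x12 x23.
  have x20 : 0 <= x2 by rewrite (le_trans x10) ?ltW.
  have x21 : x2 <= 1 by rewrite (le_trans (ltW x23)).
  have x1i : 0 <= x1 <= 1 by rewrite x10 (le_trans (ltW x12)).
  have x3i : 0 <= x3 <= 1 by rewrite x31 (le_trans x20) ?ltW.
  rewrite !lnslope_mobius //.
  have -> : p + n%:~R + x3 - (p + n%:~R + x1) = x3 - x1 by ring.
  have /andP[a1 a2] := mden_itv _ s _ x1i; have /andP[a3 a4] := mden_itv _ s _ x3i.
  have M0 : 0 < dmax R s by rewrite (lt_le_trans ltr01) ?dmax_ge1.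
  have d0 := dmin_gt0 _ _ s0.
  have lnd u v : 0 < u -> u <= v -> v <= dmax R s ->
      (v - u) / dmax R s <= ln v - ln u.
    move=> u0 uv vM; have v0 : 0 < v by rewrite (lt_le_trans u0).
    apply: le_trans (_ : (v - u) / v <= _).
      by rewrite ler_wpM2l ?subr_ge0 // lef_pV2.
    rewrite -[leRHS]opprK lerNr opprB -ln_div // (_ : u / v = 1 + - ((v - u) / v)).
      by apply: le_ln1Dx; rewrite ltrN2 ltr_pdivrMr // mul1r gtrBl.
    by field; rewrite gt_eqF.
  have u1 : 0 < mden R s x1 by rewrite (lt_le_trans d0).
  have u3 : 0 < mden R s x3 by rewrite (lt_le_trans d0).
  have dE : mden R s x3 - mden R s x1 = (1 - s) * (x3 - x1) by rewrite /mden; ring.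
  rewrite /curvlow_cst; case: ltP => sl.
  + have sp : 0 < 1 - s by rewrite subr_gt0.
    rewrite (gtr0_norm sp) mulrAC -dE.
    have le13 : mden R s x1 <= mden R s x3.
      by rewrite -subr_ge0 dE mulr_ge0 ?subr_ge0 // ltW.
    by have := lnd _ _ u1 le13 a4; lra.
  + have sp : 1 - s <= 0 by rewrite subr_le0.
    have dE' : - (1 - s) * (x3 - x1) = mden R s x1 - mden R s x3 by rewrite /mden; ring.
    rewrite (ler0_norm sp) mulrAC dE'.
    have le31 : mden R s x3 <= mden R s x1.
      by rewrite -subr_ge0 -dE' mulr_ge0 ?oppr_ge0 // subr_ge0 ltW.
    by have := lnd _ _ u3 le31 a2; lra.
Qed.

Lemma curv_csts : s != 1 -> [/\ 0 <= slope_cst s, 0 < curvlow_cst s & 0 <= curvhigh_cst s].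
Proof.
move=> s1; have s10 : 0 < `|1 - s| by rewrite normr_gt0 subr_eq0 eq_sym.
split; first exact: addr_ge0.
- by apply: divr_gt0 => //; rewrite (lt_le_trans ltr01) ?dmax_ge1.
- by apply: divr_ge0; [apply: mulr_ge0 => //; exact: ltW|exact/ltW/dmin_gt0].
Qed.

End ModelLaw.

(** * Inverses and translation numbers of lifts *)

Section LiftInverse.
Variable R : realType.

Lemma lift_inverse (G : R -> R) : continuous G -> {homo G : x y / x < y} ->
  (forall x, G (x + 1) = G x + 1) -> exists Gi, cancel G Gi /\ cancel Gi G.
Proof.
move=> Gc Gh Gp.
have Gk (k : int) : G k%:~R = G 0 + k%:~R by rewrite -(per_int R G Gp) add0r.
have sur y : exists x, G x = y.
  pose k := Num.floor (y - G 0).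
  have h1 : k%:~R <= y - G 0 := floor_le _.
  have h2 : y - G 0 < k%:~R + 1 by rewrite -[1]/(1%:~R) -rmorphD floorD1_gt.
  have e : G (k%:~R + 1) = G 0 + k%:~R + 1 by rewrite Gp Gk.
  have [|||x _ <-] := @IVT R G k%:~R (k%:~R + 1) y; last by exists x.
  - by rewrite lerDl.
  - exact: continuous_subspaceT.
  - rewrite Gk e; apply/andP; split.
      by rewrite ge_min; apply/orP; left; lra.
    by rewrite le_max; apply/orP; right; lra.
have [Gi GiP] := choice sur.
exists Gi; split=> x; last exact: GiP.
have Gm : {mono G : x y / x <= y} by exact: le_mono.
by apply: (inc_inj Gm); exact: GiP.
Qed.

End LiftInverse.

Section Translation.
Variable R : realType.
Variable F : R -> R.
Hypothesis FH : circle_homeo F.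

Let Fh : {homo F : x y / x < y}. Proof. by case: FH. Qed.
Let Fp x : F (x + 1) = F x + 1. Proof. by case: FH. Qed.

Lemma homeo_iter_le n : {homo iter n F : x y / x <= y}.
Proof.
move=> x y xy; elim: n => //= n ih; move: ih.
by rewrite le_eqVlt => /orP[/eqP -> //|/Fh/ltW].
Qed.

Lemma homeo_iter_per n x (k : int) : iter n F (x + k%:~R) = iter n F x + k%:~R.
Proof.
by apply: per_int => z; elim: n => //= n ->; exact: Fp.
Qed.

Lemma displacement_dist n x y :
  `|(iter n F x - x) - (iter n F y - y)| <= 1.
Proof.
pose k := Num.floor (x - y).
have h1 : k%:~R <= x - y := floor_le _.
have h2 : x - y < k%:~R + 1 by rewrite -[1]/(1%:~R) -rmorphD floorD1_gt.
have a1 : iter n F (y + k%:~R) <= iter n F x by apply: homeo_iter_le; lra.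
have a2 : iter n F x <= iter n F (y + (k + 1)%:~R).
  by apply: homeo_iter_le; rewrite rmorphD /=; lra.
rewrite !homeo_iter_per ?rmorphD /= in a1 a2.
by rewrite ler_norml; apply/andP; split; lra.
Qed.

Lemma iter_mul_le n (c : R) : (forall x, iter n F x <= x + c) ->
  forall j x, iter (j * n) F x <= x + j%:R * c.
Proof.
move=> h; elim=> [|j ih] x; first by rewrite mul0r addr0.
rewrite mulSn iterD; apply: le_trans (h _) _.
by have := ih x; rewrite -natr1; lra.
Qed.

Lemma iter_mul_ge n (c : R) : (forall x, x + c <= iter n F x) ->
  forall j x, x + j%:R * c <= iter (j * n) F x.
Proof.
move=> h; elim=> [|j ih] x; first by rewrite mul0r addr0.
rewrite mulSn iterD; apply: le_trans (h _).
by have := ih x; rewrite -natr1; lra.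
Qed.

Lemma iter_mul_le1 n (k : int) x : iter n F x <= x + k%:~R ->
  forall j, iter (j * n) F x <= x + j%:R * k%:~R.
Proof.
move=> h; elim=> [|j ih]; first by rewrite mul0r addr0.
rewrite mulSn addnC iterD.
apply: le_trans (homeo_iter_le (j * n) _ _ h) _.
by rewrite homeo_iter_per; have := ih; rewrite -natr1; lra.
Qed.

Lemma iter_mul_ge1 n (k : int) x : x + k%:~R <= iter n F x ->
  forall j, x + j%:R * k%:~R <= iter (j * n) F x.
Proof.
move=> h; elim=> [|j ih]; first by rewrite mul0r addr0.
rewrite mulSn addnC iterD.
apply: le_trans (homeo_iter_le (j * n) _ _ h).
by rewrite homeo_iter_per; have := ih; rewrite -natr1; lra.
Qed.

(** Comparing [X (m * n)] with [m * X n] and with [n * X m] puts every [(X n - 1) / n] below every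
    [(X m + 1) / m]; [t] is the supremum of the former. *)
Lemma translation_ex : exists t, forall n, `|iter n F 0 - n%:R * t| <= 1.
Proof.
pose X n := iter n F 0.
have mul m n : `|X (m * n)%N - m%:R * X n| <= m%:R.
  have b y : X n - 1 <= iter n F y - y <= X n + 1.
    have := displacement_dist n y 0; rewrite subr0 -/(X n) ler_norml => /andP[a1 a2].
    by apply/andP; split; lra.
  have u : forall x, iter n F x <= x + (X n + 1) by move=> x; have /andP[_] := b x; lra.
  have l : forall x, x + (X n - 1) <= iter n F x by move=> x; have /andP[] := b x; lra.
  have := iter_mul_le _ _ u m 0; have := iter_mul_ge _ _ l m 0.
  by rewrite -/(X _) !add0r ler_norml => a1 a2; apply/andP; split; lra.
have cmp m n : (0 < m)%N -> (0 < n)%N -> (X n - 1) / n%:R <= (X m + 1) / m%:R.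
  move=> m0 n0; have m0' : 0 < m%:R :> R by rewrite ltr0n.
  have n0' : 0 < n%:R :> R by rewrite ltr0n.
  rewrite ler_pdivrMr // mulrAC ler_pdivlMr //.
  have := mul m n; have := mul n m; rewrite mulnC !ler_norml => /andP[a1 a2] /andP[a3 a4].
  by move: a1 a2 a3 a4; lra.
pose S := [set (X n - 1) / n%:R | n in [set n | (0 < n)%N]].
have S0 : S !=set0 by exists ((X 1%N - 1) / 1%:R), 1%N.
have Sub : has_sup S.
  by split=> //; exists ((X 1%N + 1) / 1%:R) => _ [n n0 <-]; exact: cmp.
exists (sup S) => -[|n]; first by rewrite mul0r subr0 normr0.
have n0 : 0 < n.+1%:R :> R by rewrite ltr0n.
have h1 : (X n.+1 - 1) / n.+1%:R <= sup S.
  by apply: (sup_upper_bound Sub); exists n.+1.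
have h2 : sup S <= (X n.+1 + 1) / n.+1%:R.
  by apply: ge_sup => // _ [m m0 <-]; exact: cmp.
rewrite ler_pdivrMr // in h1; rewrite ler_pdivlMr // in h2.
by rewrite -/(X n.+1) ler_norml mulrC; apply/andP; split; lra.
Qed.

Lemma translation_lim t C : (forall n, `|iter n F 0 - n%:R * t| <= C) ->
  limn (fun n : nat => iter n F 0 / n%:R) = t.
Proof.
move=> h; apply: cvg_lim => //; apply/cvgrPdist_lt => e e0.
have C0 : 0 <= C by apply: le_trans (h 0%N).
exists (Num.truncn (C / e)).+1 => // n /= nN.
have n0 : 0 < n%:R :> R by rewrite ltr0n (leq_trans _ nN).
rewrite (_ : t - iter n F 0 / n%:R = - ((iter n F 0 - n%:R * t) / n%:R)); last first.
  by field; rewrite gt_eqF.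
rewrite normrN normrM normfV (gtr0_norm n0) ltr_pdivrMr //.
apply: le_lt_trans (h n) _; rewrite mulrC -ltr_pdivrMr //.
by apply: lt_le_trans (truncnS_gt _) _; rewrite ler_nat.
Qed.

Lemma rotation_numberE t C : (forall n, `|iter n F 0 - n%:R * t| <= C) ->
  rotation_number F = t - (Num.floor t)%:~R.
Proof. by rewrite /rotation_number => /translation_lim ->. Qed.

Variable t : R.
Hypothesis tirr : forall n (k : int), (0 < n)%N -> n%:R * t <> k%:~R.

Lemma no_linear_growth (c C : R) : (forall j : nat, j%:R * c <= C) -> c <= 0.
Proof.
move=> h; rewrite leNgt; apply/negP => c0.
have := h (Num.truncn (C / c)).+1; rewrite leNgt => /negP; apply.
by rewrite -ltr_pdivrMr // truncnS_gt.
Qed.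

(** A single point violating one of the inequalities would violate it along its orbit too, and so
    deviate linearly from the rotation by [t]. *)
Lemma irrational_liftP Fi C : cancel F Fi -> cancel Fi F ->
  (forall n, `|iter n F 0 - n%:R * t| <= C) -> irrational_lift R F Fi t.
Proof.
move=> FK KF h.
have hx n x : `|iter n F x - x - n%:R * t| <= C + 1.
  have := displacement_dist n x 0; have := h n; rewrite subr0.
  rewrite !ler_norml => /andP[a1 a2] /andP[a3 a4].
  by apply/andP; split; lra.
split=> //; first by case: FH.
- move=> n k n0 nk x; rewrite ltNge; apply/negP => /iter_mul_ge1 h2.
  have : k%:~R - n%:R * t <= 0.
    apply: (no_linear_growth _ (C + 1)) => j; have := h2 j; have := hx (j * n)%N x.
    by rewrite natrM ler_norml => /andP[_]; lra.
  by lra.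
- move=> n k n0 nk x; rewrite ltNge; apply/negP => /iter_mul_le1 h2.
  have : n%:R * t - k%:~R <= 0.
    apply: (no_linear_growth _ (C + 1)) => j; have := h2 j; have := hx (j * n)%N x.
    by rewrite natrM ler_norml => /andP[+ _]; lra.
  by lra.
Qed.

End Translation.

(** * The additive constant that gives translation number [t] *)

Section Tuning.
Variable R : realType.
Variable t : R.
Hypothesis tirr : forall n (k : int), (0 < n)%N -> n%:R * t <> k%:~R.
Variables (Psi : R -> R -> R) (Mu : R).
Hypothesis PsiH : forall e, circle_homeo (Psi e).
Hypothesis PsiL : forall e x y, `|Psi e x - Psi e y| <= Mu * `|x - y|.
Hypothesis PsiC : forall x, continuous (fun e => Psi e x).

Definition shifted (e b x : R) : R := b + Psi e x.

Lemma shifted_homeo e b : circle_homeo (shifted e b).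
Proof.
have [Pc Ph Pp] := PsiH e; split.
- by move=> x; apply: cvgD; [exact: cvg_cst|exact: Pc].
- by move=> x y xy; rewrite ltrD2l Ph.
- by move=> x; rewrite /shifted Pp addrA.
Qed.

(** A finite certificate of a translation number below [t]; unlike the number itself, it is visibly
    stable under small changes of [e] and [b]. *)
Definition low e b := exists n (k : int) x,
  [/\ (0 < n)%N, k%:~R < n%:R * t & iter n (shifted e b) x < x + k%:~R].

Definition high e b := exists n (k : int) x,
  [/\ (0 < n)%N, n%:R * t < k%:~R & x + k%:~R < iter n (shifted e b) x].

Lemma shifted_iter_gap e b b' n x : b <= b' -> (0 < n)%N ->
  iter n (shifted e b) x + (b' - b) <= iter n (shifted e b') x.
Proof.
move=> bb'; case: n => // n _ /=.
have le : iter n (shifted e b) x <= iter n (shifted e b') x.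
  elim: n => //= n ih; rewrite /shifted; apply: lerD => //.
  exact: (homeo_iter_le _ _ (PsiH e) 1).
rewrite /shifted; have := homeo_iter_le _ _ (PsiH e) 1 _ _ le.
by rewrite /=; lra.
Qed.

Lemma low_mono e b b' : b' <= b -> low e b -> low e b'.
Proof.
move=> bb' [n [k [x [n0 kt h]]]]; exists n, k, x; split=> //.
by have := shifted_iter_gap e _ _ n x bb' n0; lra.
Qed.

(** The certificates give integers with [m k + 1 <= n l]. Over [3 m n] iterates the displacements of
    [x] and [y] would differ by at least 3, but [displacement_dist] allows only 1. *)
Lemma low_high e b : low e b -> ~ high e b.
Proof.
move=> [n [k [x [n0 kt h]]]] [m [l [y [m0 tl h']]]].
have H := shifted_homeo e b.
have a1 := iter_mul_le1 _ _ H _ _ _ (ltW h) (3 * m).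
have a2 := iter_mul_ge1 _ _ H _ _ _ (ltW h') (3 * n).
rewrite -mulnA in a1; rewrite -mulnA (mulnC n m) in a2.
have := displacement_dist _ _ H (3 * (m * n)) x y.
rewrite ler_norml => /andP[a3 _].
have m0' : 0 < m%:R :> R by rewrite ltr0n.
have n0' : 0 < n%:R :> R by rewrite ltr0n.
have lt1 : m%:R * k%:~R < n%:R * l%:~R :> R.
  apply: lt_trans (_ : m%:R * (n%:R * t) < _); first by rewrite ltr_pM2l.
  by rewrite mulrCA ltr_pM2l.
have lt2 : m%:R * k%:~R + 1 <= n%:R * l%:~R :> R.
  rewrite 2!pmulrn -!rmorphM -[1]/(1%:~R) -rmorphD /= ler_int lezD1.
  by rewrite -(ltr_int R) !rmorphM /= -!pmulrn.
move: a1 a2; rewrite !natrM; lra.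
Qed.

(** The Lipschitz bound uniform in [e] upgrades the pointwise continuity [PsiC] to joint
    continuity. *)
Lemma shifted_iter_cvg {T : Type} (Fl : set_system T) {FF : Filter Fl}
    (E B : T -> R) e b n x : E @ Fl --> e -> B @ Fl --> b ->
  iter n (shifted (E i) (B i)) x @[i --> Fl] --> iter n (shifted e b) x.
Proof.
move=> Ee Bb; elim: n => [|n ih] /=; first exact: cvg_cst.
rewrite /shifted; apply: cvgD => //.
set y0 := iter n (shifted e b) x in ih *.
rewrite (_ : (fun i => _) = (fun i => Psi (E i) y0 +
  (Psi (E i) (iter n (shifted (E i) (B i)) x) - Psi (E i) y0))); last first.
  by apply/funext => i /=; rewrite addrC subrK.
rewrite -[Psi e y0]addr0; apply: cvgD.
  exact: (cvg_comp _ _ Ee (PsiC y0 e)).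
apply/norm_cvg0P; apply: (@squeeze_cvgr _ _ _ _ (fun=> 0) 
    (fun i => Mu * `|iter n (shifted (E i) (B i)) x - y0|)).
- by near=> i; rewrite normr_ge0 PsiL.
- exact: cvg_cst.
- rewrite -(mulr0 Mu); apply: cvgM; first exact: cvg_cst.
  by rewrite -(normr0 R) -(subrr y0); apply: cvg_norm; apply: cvgB => //; exact: cvg_cst.
Unshelve. all: by end_near. Qed.

Lemma low_near {T : Type} (Fl : set_system T) {FF : Filter Fl}
    (E B : T -> R) e b : E @ Fl --> e -> B @ Fl --> b -> low e b ->
  \forall i \near Fl, low (E i) (B i).
Proof.
move=> Ee Bb [n [k [x [n0 kt h]]]].
near=> i; exists n, k, x; split=> //; near: i.
exact: (cvgr_lt _ (shifted_iter_cvg Fl E B e b n x Ee Bb) _ h).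
Unshelve. all: by end_near. Qed.

Lemma high_near {T : Type} (Fl : set_system T) {FF : Filter Fl}
    (E B : T -> R) e b : E @ Fl --> e -> B @ Fl --> b -> high e b ->
  \forall i \near Fl, high (E i) (B i).
Proof.
move=> Ee Bb [n [k [x [n0 kt h]]]].
near=> i; exists n, k, x; split=> //; near: i.
exact: (cvgr_gt _ (shifted_iter_cvg Fl E B e b n x Ee Bb) _ h).
Unshelve. all: by end_near. Qed.

Lemma low_ex e : exists b, low e b.
Proof.
exists ((Num.floor t)%:~R - Psi e 0 - 1), 1%N, (Num.floor t), 0; split=> //.
- rewrite mul1r lt_neqAle floor_le andbT; apply/eqP => h.
  by apply: (tirr 1 (Num.floor t)) => //; rewrite mul1r h.
- by rewrite /= /shifted; lra.
Qed.

Lemma high_ex e : exists b, high e b.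
Proof.
exists ((Num.floor t + 1)%:~R - Psi e 0 + 1), 1%N, (Num.floor t + 1), 0; split=> //.
- by rewrite mul1r floorD1_gt.
- by rewrite /= /shifted; lra.
Qed.

Definition tune e : R := sup [set b | low e b].

Lemma low_has_sup e : has_sup [set b | low e b].
Proof.
split; first by have [b lb] := low_ex e; exists b.
have [b hb] := high_ex e; exists b => b' lb'.
by rewrite leNgt; apply/negP => /ltW bb'; exact: low_high (low_mono _ _ _ bb' lb') hb.
Qed.

Lemma low_tune e b : low e b -> b <= tune e.
Proof. by move=> lb; apply: (sup_upper_bound (low_has_sup e)). Qed.

Lemma high_tune e b : high e b -> tune e <= b.
Proof.
move=> hb; apply: ge_sup; first by have [b' lb'] := low_ex e; exists b'.
move=> b' lb'; rewrite leNgt; apply/negP => /ltW bb'.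
exact: low_high (low_mono _ _ _ bb' lb') hb.
Qed.

Lemma tune_nlow e : ~ low e (tune e).
Proof.
move=> h.
have := low_near (nbhs (0 : R)^'+) (fun=> e) (fun i => tune e + i) e (tune e).
move=> /(_ _ (cvg_cst _) _ h) near_low.
have : \forall i \near (0 : R)^'+, low e (tune e + i).
  apply: near_low; rewrite -[X in _ --> X]addr0; apply: cvgD; first exact: cvg_cst.
  exact: (cvg_at_right_filter cvg_id).
move=> near_l; have [i [li i0]] : exists i, low e (tune e + i) /\ 0 < i.
  near (0 : R)^'+ => i; exists i; split; last by [].
  by near: i.
by have := low_tune _ _ li; lra.
Unshelve. all: by end_near. Qed.

Lemma tune_nhigh e : ~ high e (tune e).
Proof.
move=> h.
have := high_near (nbhs (0 : R)^'+) (fun=> e) (fun i => tune e - i) e (tune e).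
move=> /(_ _ (cvg_cst _) _ h) near_high.
have : \forall i \near (0 : R)^'+, high e (tune e - i).
  apply: near_high; rewrite -[X in _ --> X]subr0; apply: cvgB; first exact: cvg_cst.
  exact: (cvg_at_right_filter cvg_id).
move=> near_h; have [i [hi i0]] : exists i, high e (tune e - i) /\ 0 < i.
  near (0 : R)^'+ => i; exists i; split; last by [].
  by near: i.
by have := high_tune _ _ hi; lra.
Unshelve. all: by end_near. Qed.

(** Translation number [t], expressed as the absence of [low] and [high] certificates. *)
Definition tracks (F : R -> R) := forall n (k : int) x, (0 < n)%N ->
  (n%:R * t < k%:~R -> iter n F x <= x + k%:~R) /\
  (k%:~R < n%:R * t -> x + k%:~R <= iter n F x).

Lemma tune_tracks e : tracks (shifted e (tune e)).
Proof.
move=> n k x n0; split=> kt; rewrite leNgt; apply/negP => h.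
- by apply: (tune_nhigh e); exists n, k, x.
- by apply: (tune_nlow e); exists n, k, x.
Qed.

Lemma tracks_bd F : tracks F -> forall n x, `|iter n F x - x - n%:R * t| <= 1.
Proof.
move=> h [|n] x; first by rewrite mul0r subr0 subrr normr0.
have [_ h1] := h n.+1 (Num.floor (n.+1%:R * t)) x isT.
have [h2 _] := h n.+1 (Num.floor (n.+1%:R * t) + 1) x isT.
have f1 : (Num.floor (n.+1%:R * t))%:~R <= n.+1%:R * t := floor_le _.
have f2 := floorD1_gt (n.+1%:R * t).
have f3 : (Num.floor (n.+1%:R * t))%:~R < n.+1%:R * t.
  by rewrite lt_neqAle f1 andbT; apply/eqP => /esym; exact: tirr.
have := h1 f3; have := h2 f2; rewrite rmorphD /= in f2 *.
by rewrite ler_norml => a1 a2; apply/andP; split; lra.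
Qed.

Lemma approx_ex (e : R) : 0 < e ->
  (exists n (k : int), [/\ (0 < n)%N, k%:~R < n%:R * t & n%:R * t - k%:~R < e]) /\
  (exists n (k : int), [/\ (0 < n)%N, n%:R * t < k%:~R & k%:~R - n%:R * t < e]).
Proof.
move=> e0; have [q [k lvh]] := levels_ex R t tirr.
have lv n := proj1 (lvh n).
(* Two consecutive convergents approximate [t] from opposite sides; from index 1 on, [lv_gt0] makes
   the denominators positive. *)
have [n n1 ne] := levels_th_lt _ _ _ _ (fun n => proj2 (lvh n)) e 1%N e0.
case: n n1 ne => // n _ ne.
have [_ _ sg lt _] := lv n.+1.
have q1 := lv_gt0 _ _ _ _ _ _ (lv n); have q2 := lv_gt0 _ _ _ _ _ _ (lv n.+1).
have ne2 := lt_trans lt ne; move: sg ne ne2; rewrite !th_nat.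
set a := _ * t - _; set b := _ * t - _ => sg ae be.
have [a0|a0|a0] := ltgtP 0 a; last by rewrite -a0 mul0r ltxx in sg.
- have b0 : b < 0 by rewrite -(pmulr_rlt0 _ a0).
  rewrite (gtr0_norm a0) in ae; rewrite (ltr0_norm b0) in be.
  split; [exists (q n.+1), (k n.+1)|exists (q n.+2), (k n.+2)]; split=> //;
    by move: a0 b0 ae be; rewrite /a /b; lra.
- have b0 : 0 < b by rewrite -(nmulr_rlt0 _ a0).
  rewrite (ltr0_norm a0) in ae; rewrite (gtr0_norm b0) in be.
  split; [exists (q n.+2), (k n.+2)|exists (q n.+1), (k n.+1)]; split=> //;
    by move: a0 b0 ae be; rewrite /a /b; lra.
Qed.

(* At an irrational translation number, lowering the map lowers that number:
   take k / n < t close to t; somewhere F^n moves a point by less than n t. *)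
Lemma tracks_low e b b' : tracks (shifted e b) -> b' < b -> low e b'.
Proof.
move=> tr bb'; have eta0 : 0 < b - b' by rewrite subr_gt0.
have [[n [k [n0 kt te]]] _] := approx_ex _ eta0.
have [x hx] : exists x, iter n (shifted e b) x < x + (k%:~R + (b - b')).
  apply: contrapT => nex.
  have h x : x + (k%:~R + (b - b')) <= iter n (shifted e b) x.
    by rewrite leNgt; apply/negP => hx; apply: nex; exists x.
  have h2 := iter_mul_ge _ _ _ _ h.
  have : k%:~R + (b - b') - n%:R * t <= 0.
    apply: (no_linear_growth _ _ 1) => j.
    have := tracks_bd _ tr (j * n)%N 0; have := h2 j 0.
    by rewrite natrM ler_norml => a1 /andP[_ a2]; lra.
  by lra.
exists n, k, x; split=> //.
by have := shifted_iter_gap e _ _ n x (ltW bb') n0; lra.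
Qed.

Lemma tracks_high e b b' : tracks (shifted e b) -> b < b' -> high e b'.
Proof.
move=> tr bb'; have eta0 : 0 < b' - b by rewrite subr_gt0.
have [_ [n [k [n0 kt te]]]] := approx_ex _ eta0.
have [x hx] : exists x, x + (k%:~R - (b' - b)) < iter n (shifted e b) x.
  apply: contrapT => nex.
  have h x : iter n (shifted e b) x <= x + (k%:~R - (b' - b)).
    by rewrite leNgt; apply/negP => hx; apply: nex; exists x.
  have h2 := iter_mul_le _ _ _ _ h.
  have : n%:R * t - (k%:~R - (b' - b)) <= 0.
    apply: (no_linear_growth _ _ 1) => j.
    have := tracks_bd _ tr (j * n)%N 0; have := h2 j 0.
    by rewrite natrM ler_norml => a1 /andP[a2 _]; lra.
  by lra.
exists n, k, x; split=> //.
by have := shifted_iter_gap e _ _ n x (ltW bb') n0; lra.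
Qed.

(** This identifies the member [e = 0] of the family with [g]. *)
Lemma tune_unique e b : tracks (shifted e b) -> tune e = b.
Proof.
move=> tr; have [h|h|//] := ltgtP (tune e) b.
- have := tracks_high _ _ _ (tune_tracks e) h; move=> [n [k [x [n0 kt hx]]]].
  by have [/(_ kt)] := tr n k x n0; rewrite leNgt hx.
- have := tracks_low _ _ _ (tune_tracks e) h; move=> [n [k [x [n0 kt hx]]]].
  by have [_ /(_ kt)] := tr n k x n0; rewrite leNgt hx.
Qed.

(** An arbitrarily small shift of the tuned constant is [low] on one side and [high] on the other,
    and both certificates persist for nearby [e]. *)
Lemma tune_cont : continuous tune.
Proof.
move=> e0; apply/cvgrPdist_le => eps eps0; near=> e.
have l : low e (tune e0 - eps).
  near: e; apply: (low_near (nbhs e0) id (fun=> tune e0 - eps) e0); [exact: cvg_id|exact: cvg_cst|].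
  by apply: tracks_low (tune_tracks e0) _; lra.
have h : high e (tune e0 + eps).
  near: e; apply: (high_near (nbhs e0) id (fun=> tune e0 + eps) e0); [exact: cvg_id|exact: cvg_cst|].
  by apply: tracks_high (tune_tracks e0) _; lra.
have := low_tune _ _ l; have := high_tune _ _ h.
by rewrite ler_norml => a1 a2; apply/andP; split; lra.
Unshelve. all: by end_near. Qed.

End Tuning.

(** * Iterated derivatives of rational functions on a segment *)

Section Rational.
Variable R : realType.
Variables (a b : R).
Hypothesis ab : a < b.

(** [derive_itv] is a [lim], which is determined by convergence only along a proper filter; the ends
    of the segment have to be covered. *)
Lemma within_itv_dnbhs_proper (x : R) : x \in `[a, b] ->
  ProperFilter (within `[a, b] x^').
Proof.
rewrite in_itv /= => /andP[ax xb].
apply: Build_ProperFilter_ex => P [e /= e0 eP].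
pose c := if x < b then x + Num.min (e / 2) (b - x) else x - Num.min (e / 2) (b - a).
have [cx xc ce] : [/\ c != x, a <= c <= b & `|x - c| < e].
  rewrite /c; case: ltP => h.
  - have m0 : 0 < Num.min (e / 2) (b - x) by rewrite lt_min divr_gt0 //= subr_gt0.
    have m1 : Num.min (e / 2) (b - x) <= e / 2 by rewrite ge_min lexx.
    have m2 : Num.min (e / 2) (b - x) <= b - x by rewrite ge_min lexx orbT.
    move: (Num.min _ _) m0 m1 m2 => m m0 m1 m2; have e1 : 0 < e := e0.
    split; first by rewrite gt_eqF // ltrDl.
      by apply/andP; split; lra.
    by rewrite ltr_norml; apply/andP; split; lra.
  - have m0 : 0 < Num.min (e / 2) (b - a) by rewrite lt_min divr_gt0 //= subr_gt0.
    have m1 : Num.min (e / 2) (b - a) <= e / 2 by rewrite ge_min lexx.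
    have m2 : Num.min (e / 2) (b - a) <= b - a by rewrite ge_min lexx orbT.
    move: (Num.min _ _) m0 m1 m2 => m m0 m1 m2; have e1 : 0 < e := e0.
    split; first by rewrite lt_eqF // gtrBl.
      by apply/andP; split; lra.
    by rewrite ltr_norml; apply/andP; split; lra.
by exists c; apply: (eP c) => //=; rewrite in_itv.
Qed.

Lemma is_derive_quotient (F : R -> R) (x l : R) : is_derive x 1 F l ->
  (F y - F x) / (y - x) @[y --> x^'] --> l.
Proof.
move=> [dF <-]; move/cvgrPdist_lt: dF => h; apply/cvgrPdist_lt => e e0.
have [d /= d0 dP] := h e e0; exists d => //= y /= xy yx.
have := dP (y - x); rewrite /= sub0r normrN distrC => /(_ xy).
rewrite subr_eq0 yx => /(_ isT); rewrite /= scaler1 subrK.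
by rewrite [_ *: _]mulrC.
Qed.

Lemma derive_itvE (f F : R -> R) (x l : R) : x \in `[a, b] ->
  {in `[a, b], f =1 F} -> is_derive x 1 F l -> derive_itv a b f x = l.
Proof.
move=> xab fF dF; apply: cvg_lim => //.
  exact: within_itv_dnbhs_proper.
have := is_derive_quotient _ _ _ dF; move=> /cvgrPdist_lt h.
apply/cvgrPdist_lt => e e0; have [d /= d0 dP] := h e e0.
exists d => //= y /= xy yx yab; rewrite !fF //.
exact: dP.
Qed.

(** The numerator of the [k]-th derivative of [N / D] over [D ^+ k.+1], without cancellation, so
    that its coefficients remain polynomial in those of [N] and [D]. *)
Fixpoint rat_num (N D : {poly R}) (k : nat) : {poly R} :=
  if k is k'.+1 then (rat_num N D k')^`() * D - k'.+1%:R *: (rat_num N D k' * D^`())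
  else N.

Lemma is_derive_rat (N D : {poly R}) k (x : R) : D.[x] != 0 ->
  is_derive x 1 (fun y => (rat_num N D k).[y] / D.[y] ^+ k.+1)
    ((rat_num N D k.+1).[x] / D.[x] ^+ k.+2).
Proof.
move=> D0.
have Dk : (D ^+ k.+1).[x] != 0 by rewrite horner_exp expf_neq0.
have dN : is_derive x 1 (horner (rat_num N D k)) (rat_num N D k)^`().[x] by exact: is_derive_poly.
have dD : is_derive x 1 (horner (D ^+ k.+1)) (D ^+ k.+1)^`().[x] by exact: is_derive_poly.
have dV := is_deriveV Dk dD.
have := is_deriveM dN dV.
have -> : (horner (rat_num N D k) * (fun y => (D ^+ k.+1).[y]^-1))%R =
    (fun y => (rat_num N D k).[y] / D.[y] ^+ k.+1).
  by apply/funext => y; rewrite /= -horner_exp.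
move=> h; apply: trigger_derive h _ => /=.
rewrite deriv_exp /= !hornerE hornerMn hornerM horner_exp /GRing.scale /=.
rewrite -[_ *+ k.+1]mulr_natl.
move: D0 {Dk dN dD dV}; set d := D.[x]; set dd := D^`().[x] => D0.
set n := (rat_num N D k).[x]; set n' := _^`().[x]; set c := k.+1%:R.
have P0 : d ^+ k != 0 by rewrite expf_neq0.
rewrite !exprS; move: (d ^+ k) P0 => P P0.
by field; rewrite D0 P0.
Qed.

Lemma derive_itvn_rat (f : R -> R) (N D : {poly R}) :
  (forall x, x \in `[a, b] -> D.[x] != 0) ->
  {in `[a, b], forall x, f x = N.[x] / D.[x]} ->
  forall k, {in `[a, b], forall x,
    derive_itvn a b k f x = (rat_num N D k).[x] / D.[x] ^+ k.+1}.
Proof.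
move=> D0 fE; elim=> [|k ih] x xab; first by rewrite /derive_itvn /= fE.
rewrite /derive_itvn iterS.
by apply: (derive_itvE _ _ _ _ xab ih); apply: is_derive_rat; exact: D0.
Qed.

End Rational.

(** * Uniform convergence of rational families, over the reals and the complex numbers *)

Section UniformRational.
Variables (R : realType) (K : numFieldType).

Lemma uniform_cvg_bound (A : set K) (f : R -> K -> K) (eta : R -> K) e0 :
  (forall e z, A z -> `|f e z - f e0 z| <= eta e) ->
  eta e @[e --> e0] --> (0 : K) ->
  {uniform A, f @ e0 --> f e0}.
Proof.
move=> fe eta0 P /uniform_nbhs[E [entE EP]].
move: entE; rewrite -entourage_ballE => -[eps /= eps0 epsE].
have [d /= d0 dP] := (cvgrPdist_lt _ _).1 eta0 eps eps0.
exists d => //= e ed; apply: EP => z Az; apply: epsE => /=.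
rewrite /ball /= distrC; apply: le_lt_trans (fe e z Az) _.
have := dP e ed; rewrite /= sub0r normrN; apply: le_lt_trans.
exact: real_ler_norm (ger0_real (le_trans (normr_ge0 _) (fe e z Az))).
Qed.

Definition poly_family (P : R -> {poly K}) : Prop :=
  (exists n, forall e, (size (P e) <= n)%N) /\
  forall i, continuous (fun e => (P e)`_i : K).

Lemma poly_family_cst p : poly_family (fun=> p).
Proof. by split=> [|i x]; [exists (size p)|exact: cvg_cst]. Qed.

Lemma poly_familyD P Q : poly_family P -> poly_family Q ->
  poly_family (fun e => P e + Q e).
Proof.
move=> [[n nP] cP] [[m mQ] cQ]; split.
  exists (maxn n m) => e; apply: leq_trans (size_polyD _ _) _.
  by rewrite geq_max !leq_max nP mQ orbT.
move=> i; have -> : (fun e => (P e + Q e)`_i) = (fun e => (P e)`_i + (Q e)`_i).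
  by apply/funext => e; rewrite coefD.
by move=> x; apply: cvgD; [exact: cP|exact: cQ].
Qed.

Lemma poly_familyM P Q : poly_family P -> poly_family Q ->
  poly_family (fun e => P e * Q e).
Proof.
move=> [[n nP] cP] [[m mQ] cQ]; split.
  exists (n + m)%N => e; apply: leq_trans (size_polyMleq _ _) _.
  by apply: leq_trans (leq_pred _) _; apply: leq_add.
move=> i; have -> : (fun e => (P e * Q e)`_i) =
    (fun e => \sum_(j < i.+1) (P e)`_j * (Q e)`_(i - j)).
  by apply/funext => e; rewrite coefM.
move=> x; apply: cvg_big => [|j _]; first exact: add_continuous.
by apply: cvgM; [exact: cP|exact: cQ].
Qed.

Lemma poly_familyC (c : R -> K) : continuous c -> poly_family (fun e => (c e)%:P).
Proof.
move=> cc; split; first by exists 1%N => e; exact: size_polyC_leq1.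
move=> i; have -> : (fun e => (c e)%:P`_i) = (fun e => if i == 0%N then c e else 0).
  by apply/funext => e; rewrite coefC.
by case: (i == 0%N) => x; [exact: cc|exact: cvg_cst].
Qed.

Lemma poly_family_deriv P : poly_family P -> poly_family (fun e => (P e)^`()).
Proof.
move=> [[n nP] cP]; split.
  exists n => e; apply: leq_trans (nP e).
  have [->|P0] := eqVneq (P e) 0; first by rewrite deriv0.
  exact/ltnW/lt_size_deriv.
move=> i; have -> : (fun e => (P e)^`()`_i) = (fun e => (P e)`_i.+1 * i.+1%:R).
  by apply/funext => e; rewrite coef_deriv mulr_natr.
by move=> x; apply: cvgM; [exact: cP|exact: cvg_cst].
Qed.

Lemma poly_familyX P n : poly_family P -> poly_family (fun e => P e ^+ n).
Proof.
move=> hP; elim: n => [|n ih]; first exact: poly_family_cst.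
by rewrite (_ : (fun e => _) = (fun e => P e * P e ^+ n)); [exact: poly_familyM|apply/funext => e; rewrite exprS].
Qed.

Lemma horner_norm_le (p : {poly K}) n (B z : K) : (size p <= n)%N -> `|z| <= B ->
  `|p.[z]| <= \sum_(i < n) `|p`_i| * B ^+ i.
Proof.
move=> pn zB; rewrite (horner_coef_wide _ pn); apply: le_trans (ler_norm_sum _ _ _) _.
apply: ler_sum => i _; rewrite normrM normrX ler_wpM2l //.
by apply: lerXn2r; rewrite ?nnegrE // (le_trans _ zB).
Qed.

(** Over the common denominator, of modulus at least [m ^+ 2], the difference has numerator [P e], a
    family of bounded degree whose coefficients tend to 0. *)
Lemma rational_cvg_bound (A : set K) (N D : R -> {poly K}) (m B : K) e0 :
  poly_family N -> poly_family D -> 0 < m ->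
  (forall e z, A z -> m <= `|(D e).[z]|) -> (forall z, A z -> `|z| <= B) ->
  exists2 eta : R -> K, eta e @[e --> e0] --> (0 : K) &
    forall e z, A z ->
      `|(N e).[z] / (D e).[z] - (N e0).[z] / (D e0).[z]| <= eta e.
Proof.
move=> NF DF m0 Dm AB; pose P e := N e * D e0 + (- N e0) * D e.
have [[n nP] cP] : poly_family P.
  by apply: poly_familyD; apply: poly_familyM => //; exact: poly_family_cst.
exists (fun e => (\sum_(i < n) `|(P e)`_i| * B ^+ i) / m ^+ 2).
  have P0 : P e0 = 0 by rewrite /P mulNr subrr.
  have lim0 : (\sum_(i < n) `|(P e0)`_i| * B ^+ i) / m ^+ 2 = 0.
    by rewrite big1 ?mul0r // => i _; rewrite P0 coef0 normr0 mul0r.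
  rewrite -[X in _ --> X]lim0.
  have term (i : nat) : `|(P e)`_i| * B ^+ i @[e --> e0] --> `|(P e0)`_i| * B ^+ i.
    by apply: cvgM; [apply: cvg_norm; exact: cP|exact: cvg_cst].
  apply: cvgM; last exact: cvg_cst.
  by apply: cvg_big => [|i _]; [exact: add_continuous|exact: term].
move=> e z Az; have h1 := Dm e z Az; have h0 := Dm e0 z Az.
have n1 : 0 < `|(D e).[z]| by apply: lt_le_trans h1.
have n0 : 0 < `|(D e0).[z]| by apply: lt_le_trans h0.
have -> : (N e).[z] / (D e).[z] - (N e0).[z] / (D e0).[z] =
    (P e).[z] / ((D e).[z] * (D e0).[z]).
  rewrite /P hornerD !hornerM hornerN; move: n1 n0; rewrite !normr_gt0 => n1 n0.
  by field; rewrite n0 n1.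
rewrite normrM normfV normrM; apply: ler_pM => //.
  by apply: horner_norm_le; [exact: nP|exact: AB].
rewrite lef_pV2 ?posrE ?mulr_gt0 ?exprn_gt0 // expr2.
by apply: ler_pM => //; exact: ltW.
Qed.

Lemma derivable_horner_num (p : {poly K}) (x : K^o) :
  derivable (horner p : K^o -> K^o) x 1.
Proof.
elim/poly_ind: p => [|p c ih].
  rewrite (_ : horner 0 = cst 0); first exact: derivable_cst.
  by apply/funext => y; rewrite horner0.
rewrite (_ : horner _ = (fun y => p.[y] * y) + cst c).
  apply: derivableD; last exact: derivable_cst.
  by apply: derivableM; [exact: ih|exact: derivable_id].
by apply/funext => y; rewrite !hornerE.
Qed.

Lemma derivable_rational (N D : {poly K}) (x : K^o) : D.[x] != 0 ->
  derivable ((fun z => N.[z] / D.[z]) : K^o -> K^o) x 1.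
Proof.
move=> D0; apply: (@derivableM K K^o (horner N) (fun z => D.[z]^-1)).
  exact: derivable_horner_num.
by apply: derivableV => //; exact: derivable_horner_num.
Qed.

End UniformRational.

Section ComplexEmbedding.
Variable R : realType.

Lemma normc_real (x : R) : `|(x%:C)%C| = (`|x|%:C)%C :> R[i].
Proof. by rewrite normc_def /= expr0n /= addr0 sqrtr_sqr. Qed.

Lemma real_complex_cont : continuous (fun x : R => (x%:C)%C : Cplx R).
Proof.
move=> x; apply/cvgrPdist_lt => e e0.
have eE : ((complex.Re (e : R[i]))%:C)%C = e :> R[i] by apply: RRe_real; exact: gtr0_real.
have e0' : 0 < complex.Re (e : R[i]) by rewrite -ltcR eE.
near=> y; rewrite -rmorphB normc_real -eE ltcR.
by near: y; exact: cvgr_dist_lt.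
Unshelve. all: by end_near. Qed.

Lemma poly_family_complex (P : R -> {poly R}) : poly_family R R P ->
  poly_family R (Cplx R) (fun e => map_poly (real_complex R) (P e)).
Proof.
move=> [[n nP] cP]; split.
  by exists n => e; rewrite size_map_poly.
move=> i; have -> : (fun e => (map_poly (real_complex R) (P e))`_i) =
    (fun e => real_complex R ((P e)`_i)).
  by apply/funext => e; rewrite coef_map.
move=> x; exact: (cvg_comp _ _ (cP i x) (real_complex_cont _)).
Qed.

End ComplexEmbedding.

(** * One-sided derivatives at the break *)

Section OneSidedLimits.
Variable R : realType.

Lemma derive1_rat (F : R -> R) (N D : {poly R}) (a b : R) :
  (forall x, a < x < b -> F x = N.[x] / D.[x]) ->
  (forall x, a < x < b -> D.[x] != 0) ->
  forall x, a < x < b -> derive1 F x = (rat_num R N D 1).[x] / D.[x] ^+ 2.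
Proof.
move=> FE D0 x xab; have := is_derive_rat R N D 0 x (D0 x xab).
move=> [_ <-]; rewrite derive1E; apply: near_eq_derive.
have /andP[ax xb] := xab.
near=> y; rewrite FE ?expr1 //.
by apply/andP; split; near: y; [exact: lt_nbhsr|exact: lt_nbhsl].
Unshelve. all: by end_near. Qed.

Lemma rat_cont (N D : {poly R}) k (x : R) : D.[x] != 0 ->
  N.[y] / D.[y] ^+ k @[y --> x] --> N.[x] / D.[x] ^+ k.
Proof.
move=> D0; apply: cvgM; first exact: continuous_horner.
apply: cvgV; first by rewrite expf_neq0.
by apply: (@cvg_comp _ _ _ (horner D) (fun z => z ^+ k));
  [exact: continuous_horner|exact: exprn_continuous].
Qed.

Lemma lim_derive1_right (F : R -> R) (N D : {poly R}) (a b : R) : a < b ->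
  (forall x, a < x < b -> F x = N.[x] / D.[x]) ->
  (forall x, a <= x <= b -> D.[x] != 0) ->
  lim (derive1 F x @[x --> a^'+]) = (rat_num R N D 1).[a] / D.[a] ^+ 2.
Proof.
move=> ab FE D0; apply: cvg_lim => //.
have Da : D.[a] != 0 by apply: D0; rewrite lexx ltW.
have h : (rat_num R N D 1).[x] / D.[x] ^+ 2 @[x --> a^'+] -->
    (rat_num R N D 1).[a] / D.[a] ^+ 2.
  exact/cvg_at_right_filter/rat_cont.
apply: cvg_trans h; apply: near_eq_cvg; near=> x.
rewrite (derive1_rat F N D a b) // => [y /andP[ay yb]|].
  by apply: D0; rewrite !ltW.
by apply/andP; split; near: x; [exact: nbhs_right_gt|exact: nbhs_right_lt].
Unshelve. all: by end_near. Qed.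

Lemma lim_derive1_left (F : R -> R) (N D : {poly R}) (a b : R) : a < b ->
  (forall x, a < x < b -> F x = N.[x] / D.[x]) ->
  (forall x, a <= x <= b -> D.[x] != 0) ->
  lim (derive1 F x @[x --> b^'-]) = (rat_num R N D 1).[b] / D.[b] ^+ 2.
Proof.
move=> ab FE D0; apply: cvg_lim => //.
have Db : D.[b] != 0 by apply: D0; rewrite lexx andbT ltW.
have h : (rat_num R N D 1).[x] / D.[x] ^+ 2 @[x --> b^'-] -->
    (rat_num R N D 1).[b] / D.[b] ^+ 2.
  exact/cvg_at_left_filter/rat_cont.
apply: cvg_trans h; apply: near_eq_cvg; near=> x.
rewrite (derive1_rat F N D a b) // => [y /andP[ay yb]|].
  by apply: D0; rewrite !ltW.
by apply/andP; split; near: x; [exact: nbhs_left_gt|exact: nbhs_left_lt].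
Unshelve. all: by end_near. Qed.

Lemma rat_num1E (N D : {poly R}) x :
  (rat_num R N D 1).[x] = N^`().[x] * D.[x] - N.[x] * D^`().[x].
Proof. by rewrite /rat_num scale1r !hornerE. Qed.

Lemma break_limits (F : R -> R) (N D : {poly R}) (p : R) :
  (forall x, F (x + 1) = F x + 1) ->
  (forall x, p <= x <= p + 1 -> F x = N.[x] / D.[x]) ->
  (forall x, p <= x <= p + 1 -> D.[x] != 0) ->
  lim (derive1 F x @[x --> p^'-]) / lim (derive1 F x @[x --> p^'+]) =
  ((rat_num R N D 1).[p + 1] / D.[p + 1] ^+ 2) / ((rat_num R N D 1).[p] / D.[p] ^+ 2).
Proof.
move=> Fp FE D0; have pp : p < p + 1 by rewrite ltrDl.
rewrite (lim_derive1_right F N D p (p + 1)) //; last first.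
  by move=> x /andP[px xp]; rewrite FE // !ltW.
(* On [[p - 1, p]] periodicity gives [F x = F (x + 1) - 1], so the left limit at [p] is read off at
   [p + 1]. *)
congr (_ / _); pose q : {poly R} := 'X + 1%:P.
have qE x : q.[x] = x + 1 by rewrite /q !hornerE.
rewrite (lim_derive1_left F ((N \Po q) - (D \Po q)) (D \Po q) (p - 1) p); last 3 first.
- by rewrite ltrBlDr ltrDl.
- move=> x /andP[px xp].
  have i : p <= x + 1 <= p + 1 by apply/andP; split; lra.
  have := FE _ i; have := D0 _ i.
  rewrite Fp hornerD hornerN !horner_comp qE => d0 h.
  by rewrite mulrBl divff // -h addrK.
- move=> x /andP[px xp]; rewrite horner_comp qE; apply: D0.
  by apply/andP; split; lra.
have dq : q^`() = 1 by rewrite /q !poly.derivE addr0.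
rewrite !rat_num1E derivB !deriv_comp dq !mulr1 !hornerD !hornerN !horner_comp qE.
by congr (_ / _); ring.
Qed.

End OneSidedLimits.

(** * The family as quotients of polynomials *)

Section Family.
Variable R : realType.

(** [quad r] with its denominator [r ^+ 2 + 1] cleared, so that all coefficients are polynomial in
    [r]. *)
Definition fam0 (p r : R) : {poly R} :=
  (2 * r ^+ 2)%:P * ('X - p%:P) - (r ^+ 2 - 1)%:P * ('X - p%:P) ^+ 2.

Definition famD (p s r : R) : {poly R} :=
  (s * r * (r ^+ 2 + 1))%:P + (1 - s * r)%:P * fam0 p r.

Definition famN (p b s r : R) : {poly R} := b%:P * famD p s r + fam0 p r.

Lemma fam0E p r y : (fam0 p r).[p + y] = (r ^+ 2 + 1) * quad R r y.
Proof.
rewrite /fam0 !(hornerD, hornerN, hornerM, hornerC, horner_exp, hornerX) (_ : p + y - p = y); last by ring.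
by rewrite /quad; field; rewrite gt_eqF // ltr_wpDl ?sqr_ge0.
Qed.

Lemma famDE p s r y : (famD p s r).[p + y] = (r ^+ 2 + 1) * mden R (s * r) (quad R r y).
Proof. by rewrite /famD hornerD hornerM !hornerC fam0E /mden; ring. Qed.

Lemma famNE p b s r y :
  (famN p b s r).[p + y] = b * (famD p s r).[p + y] + (r ^+ 2 + 1) * quad R r y.
Proof. by rewrite /famN hornerD hornerM hornerC fam0E. Qed.

Lemma famD_ge p s r y : 0 < s -> 1 <= r -> 0 <= y <= 1 ->
  2 * dmin R s <= (famD p s r).[p + y].
Proof.
move=> s0 r1 yi; rewrite famDE.
have /andP[h _] := mden_itv _ (s * r) _ (quad_itv _ _ r1 _ yi).
have r2 : 2 <= r ^+ 2 + 1 by have := exprn_ege1 2 r1; lra.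
have m0 := dmin_gt0 _ _ s0.
have ms : dmin R s <= dmin R (s * r).
  rewrite /dmin le_min ge_min ge_min lexx orbT andbT; apply/orP; left.
  by rewrite ler_peMr // ltW.
by apply: ler_pM => //; rewrite ?(le_trans ms) // ltW.
Qed.

Lemma itv_shift (p x : R) : p <= x <= p + 1 -> exists2 y, 0 <= y <= 1 & x = p + y.
Proof.
by move=> /andP[a b]; exists (x - p); [apply/andP; split; lra|ring].
Qed.

Lemma famD_neq0 p s r x : 0 < s -> 1 <= r -> p <= x <= p + 1 -> (famD p s r).[x] != 0.
Proof.
move=> s0 r1 /itv_shift[y yi ->].
rewrite gt_eqF // (lt_le_trans _ (famD_ge _ _ _ _ s0 r1 yi)) //.
by rewrite mulr_gt0 // dmin_gt0.
Qed.

Lemma ext_rat p b s r x : 0 < s -> 1 <= r -> p <= x <= p + 1 ->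
  ext R p b (model R s r) x = (famN p b s r).[x] / (famD p s r).[x].
Proof.
move=> s0 r1 xi; have D0 := famD_neq0 _ _ _ _ s0 r1 xi.
have [y yi xE] := itv_shift _ _ xi; rewrite xE in D0 *.
have := ext_val R p b _ (model0 R s r) (model1 R s r) 0 y yi; rewrite !addr0 => ->.
rewrite famNE mulrDl mulfK //; congr +%R.
have r2 : r ^+ 2 + 1 != 0 by rewrite gt_eqF // ltr_wpDl ?sqr_ge0.
rewrite famDE mulf_eq0 negb_or r2 /= in D0.
by rewrite famDE /model; field; rewrite D0.
Qed.

Lemma fam_deriv p b s r y : (rat_num R (famN p b s r) (famD p s r) 1).[p + y] =
  (2 * r ^+ 2 - 2 * (r ^+ 2 - 1) * y) * (s * r * (r ^+ 2 + 1)).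
Proof.
rewrite rat_num1E.
have d0 : (fam0 p r)^`().[p + y] = 2 * r ^+ 2 - 2 * (r ^+ 2 - 1) * y.
  rewrite /fam0 expr2 !poly.derivE.
  by rewrite !(hornerD, hornerN, hornerM, hornerC, hornerX); ring.
have dD : (famD p s r)^`().[p + y] = (1 - s * r) * (fam0 p r)^`().[p + y].
  by rewrite /famD !poly.derivE !(hornerD, hornerM, hornerC); ring.
have dN : (famN p b s r)^`().[p + y] =
    b * (famD p s r)^`().[p + y] + (fam0 p r)^`().[p + y].
  by rewrite /famN !poly.derivE !(hornerD, hornerM, hornerC); ring.
rewrite dN dD d0 famNE famDE /mden; ring.
Qed.

Lemma ext_circle_homeo p b s r : 0 < s -> 1 <= r ->
  circle_homeo (ext R p b (model R s r)).
Proof.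
move=> s0 r1; have m0 := model0 R s r; have m1 := model1 R s r.
have bd := model_bd R s r s0 r1; have l0 := model_low_gt0 R s r s0 r1.
split.
- exact: ext_cont m0 m1 _ _ bd l0.
- exact: ext_homo m0 m1 _ _ bd l0.
- exact: ext_per m0 m1.
Qed.

Lemma ext_derive_gt0 p b s r x : 0 < s -> 1 <= r -> x \in `[p, p + 1] ->
  0 < derive_itv p (p + 1) (ext R p b (model R s r)) x.
Proof.
move=> s0 r1 xi; have pp : p < p + 1 by rewrite ltrDl.
have D0 z : z \in `[p, p + 1] -> (famD p s r).[z] != 0.
  by rewrite in_itv /=; exact: famD_neq0.
have FE : {in `[p, p + 1], forall z, ext R p b (model R s r) z =
    (famN p b s r).[z] / (famD p s r).[z]}.
  by move=> z; rewrite in_itv /=; exact: ext_rat.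
have := derive_itvn_rat R _ _ pp _ _ _ D0 FE 1 x xi.
rewrite /derive_itvn /= => ->.
have Dx := D0 x xi; move: xi; rewrite in_itv /= => /itv_shift[y /andP[y0 y1] xE].
rewrite xE in Dx *; rewrite fam_deriv divr_gt0 ?exprn_even_gt0 //.
have r2 : 1 <= r ^+ 2 by exact: exprn_ege1.
apply: mulr_gt0; last by rewrite !mulr_gt0 //; lra.
have : (r ^+ 2 - 1) * y <= (r ^+ 2 - 1) by rewrite ler_piMr //; lra.
lra.
Qed.

(** The Moebius factor contributes [(s r) ^+ 2] and the quadratic one [1 / r ^+ 2], so the break
    does not depend on [r]. *)
Lemma ext_break p b s r : 0 < s -> 1 <= r ->
  lim (derive1 (ext R p b (model R s r)) x @[x --> p^'-]) /
  lim (derive1 (ext R p b (model R s r)) x @[x --> p^'+]) = s ^+ 2.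
Proof.
move=> s0 r1; rewrite (break_limits R _ (famN p b s r) (famD p s r)); last 3 first.
- by move=> x; apply: ext_per; [exact: model0|exact: model1].
- by move=> x; exact: ext_rat.
- by move=> x; exact: famD_neq0.
have r0 : r != 0 by rewrite gt_eqF //; lra.
have r2 : r ^+ 2 + 1 != 0 by rewrite gt_eqF // ltr_wpDl ?sqr_ge0.
have := fam_deriv p b s r 0; have := famDE p s r 0; rewrite addr0 => -> ->.
rewrite fam_deriv famDE (quad0 R) (quad1 R) /mden.
by field; rewrite r0 r2 gt_eqF //= addrC subrK oner_eq0.
Qed.

End Family.

(** * Analytic extension and continuity in the parameter *)

Section ComplexNeighborhood.
Variable R : realType.
Variables p s : R.
Hypothesis s0 : 0 < s.

Local Notation rc := (real_complex R).

Definition cnbhd (rho : R) : set (Cplx R) :=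
  [set z | exists x : R, p <= x <= p + 1 /\ `|z - (rc x : Cplx R)| < (rc rho : Cplx R)].

Lemma cnbhd_nbhd rho : 0 < rho -> itv_nbhd p (p + 1) (cnbhd rho).
Proof.
move=> rho0; split; last first.
  by move=> x; rewrite in_itv /= => xi; exists x; split=> //; rewrite subrr normr0 ltcR.
rewrite (_ : cnbhd rho = \bigcup_(x in [set x : R | p <= x <= p + 1])
    ball (rc x : Cplx R) (rc rho : Cplx R)).
  by apply: bigcup_open => x _; apply: ball_open; rewrite ltcR.
by apply/seteqP; split=> z /= [x]; [move=> [xi xz]|move=> xi xz]; exists x => //;
  move: xz; rewrite /ball /= distrC.
Qed.

Lemma horner_rc (P : {poly R}) x : (map_poly rc P).[rc x] = rc P.[x].
Proof. exact: horner_map. Qed.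

(** A Lipschitz constant of [famD] up to distance 1 from the segment, for [r] in [[1, 2]]:
    [17 = 8 + 3 * 3] comes from the quadratic polynomial, and [1 + 2 s] bounds [1 - s r]. *)
Definition clip_cst (s : R) : R := 17 * (1 + 2 * s).

(** On the segment the denominator is at least [2 * dmin s], and within this radius it changes by at
    most [dmin s]. The radius is independent of [r], so one neighborhood serves all parameters. *)
Definition cradius : R := Num.min 1 (dmin R s / clip_cst s).

Let L0 : 0 < clip_cst s. Proof. by rewrite /clip_cst; move: s0; lra. Qed.

Let dm0 : 0 < dmin R s := dmin_gt0 _ _ s0.

Lemma cradius_gt0 : 0 < cradius.
Proof. by rewrite /cradius lt_min ltr01 divr_gt0. Qed.

Lemma famD_complex_lip r x (z : Cplx R) : 1 <= r <= 2 -> p <= x <= p + 1 ->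
  `|z - (rc x : Cplx R)| <= 1 ->
  `|(map_poly rc (famD R p s r)).[z] - (map_poly rc (famD R p s r)).[rc x]| <=
  rc (clip_cst s) * `|z - (rc x : Cplx R)|.
Proof.
move=> /andP[r1 r2] /andP[px xp] zx.
have E (w : Cplx R) : (map_poly rc (famD R p s r)).[w] =
    rc (s * r * (r ^+ 2 + 1)) + rc (1 - s * r) *
    (rc (2 * r ^+ 2) * (w - rc p) - rc (r ^+ 2 - 1) * (w - rc p) ^+ 2).
  rewrite /famD /fam0 !(rmorphD, rmorphN, rmorphM, rmorphXn) /= !map_polyC map_polyX.
  rewrite !(hornerD, hornerN, hornerM, hornerC, horner_exp, hornerX).
  reflexivity.
have -> : (map_poly rc (famD R p s r)).[z] - (map_poly rc (famD R p s r)).[rc x] =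
    rc (1 - s * r) * (rc (2 * r ^+ 2) - rc (r ^+ 2 - 1) * ((z - rc x) + rc (2 * (x - p)))) *
    (z - rc x).
  by rewrite !E !(rmorphB, rmorphM); ring.
rewrite normrM; apply: ler_wpM2r => //.
have nrc (a : R) : `|rc a : Cplx R| = (rc `|a| : Cplx R) := normc_real R a.
have h1 : `|(z - rc x) + rc (2 * (x - p)) : Cplx R| <= rc 3.
  apply: le_trans (ler_normD _ _) _; rewrite (_ : rc 3 = rc 1 + rc 2); last first.
    by rewrite -rmorphD; congr (rc _); lra.
  apply: lerD; first by rewrite rmorph1.
  by rewrite nrc lecR ler_norml; apply/andP; split; lra.
have r22 : 1 <= r ^+ 2 <= 4.
  by rewrite exprn_ege1 //= (_ : 4 = 2 ^+ 2) ?lerXn2r ?nnegrE //; lra.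
move: r22 => /andP[a1 a2].
have h2 : `|rc (2 * r ^+ 2) - rc (r ^+ 2 - 1) * ((z - rc x) + rc (2 * (x - p))) : Cplx R| <= rc 17.
  apply: le_trans (ler_normB _ _) _; rewrite (_ : rc 17 = rc 8 + rc 3 * rc 3); last first.
    by rewrite -rmorphM -rmorphD; congr (rc _); lra.
  apply: lerD; first by rewrite nrc lecR ger0_norm; lra.
  rewrite normrM; apply: ler_pM => //.
  by rewrite nrc lecR ger0_norm; lra.
have h3 : `|rc (1 - s * r) : Cplx R| <= rc (1 + 2 * s).
  rewrite nrc lecR; have : s * r <= s * 2 by rewrite ler_pM2l.
  have : 0 < s * r by rewrite mulr_gt0 //; lra.
  by rewrite ler_norml => *; apply/andP; split; lra.
rewrite normrM mulrC (_ : rc (clip_cst s) = rc 17 * rc (1 + 2 * s)).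
  by apply: ler_pM.
by rewrite -rmorphM.
Qed.

Lemma famD_complex_low r (z : Cplx R) : 1 <= r <= 2 -> cnbhd cradius z ->
  rc (dmin R s) <= `|(map_poly rc (famD R p s r)).[z]| :> Cplx R.
Proof.
move=> ri [x [xi xz]]; have /andP[r1 r2] := ri.
have c1 : cradius <= 1 by rewrite /cradius ge_min lexx.
have c2 : clip_cst s * cradius <= dmin R s.
  by rewrite mulrC -ler_pdivlMr // /cradius ge_min lexx orbT.
have xz1 : `|z - (rc x : Cplx R)| <= 1.
  by apply: le_trans (ltW xz) _; rewrite -(rmorph1 rc) lecR.
have lip := famD_complex_lip r x z ri xi xz1.
have up : `|(map_poly rc (famD R p s r)).[z] - (map_poly rc (famD R p s r)).[rc x]| <=
    (rc (dmin R s) : Cplx R).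
  apply: le_trans lip _; apply: le_trans (_ : rc (clip_cst s) * rc cradius <= _).
    by apply: ler_wpM2l (ltW xz); rewrite lecR ltW.
  by rewrite -rmorphM lecR.
have low : rc (2 * dmin R s) <= `|(map_poly rc (famD R p s r)).[rc x]| :> Cplx R.
  have [y yi ->] := itv_shift _ _ _ xi.
  have D := famD_ge _ p _ _ _ s0 r1 yi.
  rewrite horner_rc normc_real lecR; apply: le_trans D _; exact: ler_norm.
have tri := ler_normD ((map_poly rc (famD R p s r)).[z])
  ((map_poly rc (famD R p s r)).[rc x] - (map_poly rc (famD R p s r)).[z]).
rewrite addrC subrK in tri.
have := le_trans low (le_trans tri (lerD (lexx _) _)).
rewrite distrC in up => /(_ _ up).
by rewrite (_ : rc (2 * dmin R s) = rc (dmin R s) + rc (dmin R s));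
  [rewrite lerD2r|rewrite -rmorphD; congr (rc _); ring].
Qed.

Definition cfam (b r : R) (z : Cplx R) : Cplx R :=
  (map_poly rc (famN R p b s r)).[z] / (map_poly rc (famD R p s r)).[z].

Lemma cfam_holo b r : 1 <= r <= 2 -> holomorphic_on (cnbhd cradius) (cfam b r).
Proof.
move=> ri z Uz; apply: derivable_rational.
rewrite -normr_gt0; apply: lt_le_trans (famD_complex_low r z ri Uz).
by rewrite ltcR.
Qed.

Lemma cfam_extends b r : 1 <= r <= 2 ->
  extends_itv p (p + 1) (cfam b r) (ext R p b (model R s r)).
Proof.
move=> /andP[r1 r2] x; rewrite in_itv /= => xi.
by rewrite /cfam ext_rat // !horner_rc -fmorph_div.
Qed.

Lemma ext_B_omega b r : 1 <= r <= 2 -> B_omega p (s ^+ 2) (ext R p b (model R s r)).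
Proof.
move=> ri; have /andP[r1 r2] := ri; split.
- exact: ext_circle_homeo.
- exists (cnbhd cradius), (cfam b r); split.
  + exact: cnbhd_nbhd cradius_gt0.
  + exact: cfam_holo.
  + exact: cfam_extends.
- by move=> x; exact: ext_derive_gt0.
- exact: ext_break.
Qed.

Variables (beta r : R -> R).
Hypotheses (betac : continuous beta) (rc_cont : continuous r).
Hypothesis ri : forall e, 1 <= r e <= 2.

Let sqr_cont : continuous (fun e => r e ^+ 2).
Proof. by move=> x; apply: cvgM; exact: rc_cont. Qed.

Lemma fam0_family : poly_family R R (fun e => fam0 R p (r e)).
Proof.
have r2 := sqr_cont.
have -> : (fun e => fam0 R p (r e)) = (fun e => (2 * r e ^+ 2)%:P * ('X - p%:P) +
    (1 - r e ^+ 2)%:P * ('X - p%:P) ^+ 2).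
  by apply/funext => e; rewrite /fam0 -(opprB (r e ^+ 2) 1) polyCN mulNr.
apply: poly_familyD; apply: poly_familyM; try exact: poly_family_cst.
- by apply: poly_familyC => x; apply: cvgM; [exact: cvg_cst|exact: r2].
- by apply: poly_familyC => x; apply: cvgB; [exact: cvg_cst|exact: r2].
Qed.

Lemma famD_family : poly_family R R (fun e => famD R p s (r e)).
Proof.
have r2 := sqr_cont.
have sr : continuous (fun e => s * r e).
  by move=> x; apply: cvgM; [exact: cvg_cst|exact: rc_cont].
apply: poly_familyD; last apply: poly_familyM; last exact: fam0_family.
- apply: poly_familyC => x; apply: cvgM; first exact: sr.
  by apply: cvgD; [exact: r2|exact: cvg_cst].
- by apply: poly_familyC => x; apply: cvgB; [exact: cvg_cst|exact: sr].
Qed.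

Lemma famN_family : poly_family R R (fun e => famN R p (beta e) s (r e)).
Proof.
apply: poly_familyD; last exact: fam0_family.
by apply: poly_familyM; [exact: poly_familyC|exact: famD_family].
Qed.

Lemma rat_num_family (N D : R -> {poly R}) k : poly_family R R N -> poly_family R R D ->
  poly_family R R (fun e => rat_num R (N e) (D e) k).
Proof.
move=> hN hD; elim: k => [|k ih] //=.
have -> : (fun e => (rat_num R (N e) (D e) k)^`() * D e -
      k.+1%:R *: (rat_num R (N e) (D e) k * (D e)^`())) =
    (fun e => (rat_num R (N e) (D e) k)^`() * D e +
      (- k.+1%:R)%:P * (rat_num R (N e) (D e) k * (D e)^`())).
  by apply/funext => e; rewrite mul_polyC scaleNr.
apply: poly_familyD; apply: poly_familyM => //; first exact: poly_family_deriv.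
  exact: poly_family_cst.
by apply: poly_familyM => //; exact: poly_family_deriv.
Qed.

Lemma ext_Cinfty :
  Cinfty_continuous_family p (p + 1) (fun e => ext R p (beta e) (model R s (r e))).
Proof.
move=> k e0; have pp : p < p + 1 by rewrite ltrDl.
pose N e := rat_num R (famN R p (beta e) s (r e)) (famD R p s (r e)) k.
pose D e := famD R p s (r e) ^+ k.+1.
have NF : poly_family R R N by apply: rat_num_family; [exact: famN_family|exact: famD_family].
have DF : poly_family R R D by apply: poly_familyX; exact: famD_family.
have m0 : 0 < (2 * dmin R s) ^+ k.+1 by rewrite exprn_gt0 // mulr_gt0.
have Dm e z : [set` `[p, p + 1]] z -> (2 * dmin R s) ^+ k.+1 <= `|(D e).[z]|.
  rewrite /= in_itv /= => /itv_shift[y yi ->]; have /andP[r1 r2] := ri e.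
  rewrite /D horner_exp normrX; apply: lerXn2r; rewrite ?nnegrE //.
    by rewrite mulr_ge0 // ltW.
  exact: le_trans (famD_ge _ _ _ _ _ s0 r1 yi) (ler_norm _).
have zB z : [set` `[p, p + 1]] z -> `|z| <= `|p| + 1.
  rewrite /= in_itv /= => /andP[a1 a2]; have := ler_norm p; have := ler_norm (- p).
  by rewrite normrN ler_norml => *; apply/andP; split; lra.
have [eta eta0 bd] := rational_cvg_bound _ _ _ _ _ _ _ e0 NF DF m0 Dm zB.
apply: uniform_cvg_bound eta0 => e z Az.
have E e' : derive_itvn p (p + 1) k (ext R p (beta e') (model R s (r e'))) z =
    (N e').[z] / (D e').[z].
  have /andP[r1 r2] := ri e'; rewrite /D horner_exp.
  apply: (derive_itvn_rat R _ _ pp) => [x|x|]; last exact: Az.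
  - by rewrite in_itv /=; exact: famD_neq0.
  - by rewrite in_itv /=; exact: ext_rat.
by rewrite !E; exact: bd.
Qed.

Lemma ext_analytic :
  analytic_continuous_family p (p + 1) (fun e => ext R p (beta e) (model R s (r e))).
Proof.
exists (cnbhd cradius), (fun e => cfam (beta e) (r e)); split.
- exact: cnbhd_nbhd cradius_gt0.
- by move=> e; split; [exact: cfam_holo|exact: cfam_extends].
move=> e0 K _ KU.
have NF := poly_family_complex _ _ famN_family.
have DF := poly_family_complex _ _ famD_family.
have m0 : 0 < (rc (dmin R s) : Cplx R) by rewrite ltcR.
have Dm e z : K z -> rc (dmin R s) <= `|(map_poly rc (famD R p s (r e))).[z]| :> Cplx R.
  by move=> /KU; exact: famD_complex_low.
have zB z : K z -> `|z| <= rc (`|p| + 1 + 1) :> Cplx R.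
  move=> /KU[x [/andP[a1 a2] xz]]; rewrite -[z](subrK (rc x)).
  apply: le_trans (ler_normD _ _) _; rewrite addrC rmorphD; apply: lerD.
    rewrite normc_real lecR; have := ler_norm p; have := ler_norm (- p).
    by rewrite normrN ler_norml => *; apply/andP; split; lra.
  by apply: le_trans (ltW xz) _; rewrite lecR /cradius ge_min lexx.
have [eta eta0 bd] := rational_cvg_bound _ _ _ _ _ _ _ e0 NF DF m0 Dm zB.
exact: uniform_cvg_bound bd eta0.
Qed.

End ComplexNeighborhood.

(** * Normal form of [g] and assembly of the result *)

Section Conclusion.
Variable R : realType.

(** Three real conditions determine a Moebius map on the segment: its value at [p], the increment 1
    over the segment, and the ratio [(q p / q (p + 1)) ^+ 2 = c] of the end slopes. *)
Lemma mobius_ext (c p : R) (g : R -> R) : 0 < c -> B_omega p c g ->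
  linear_fractional p g -> g = ext R p (g p) (model R (Num.sqrt c) 1).
Proof.
move=> c0 [[gc gh gp] _ _ brk] [a [b [C [d [det gE]]]]].
pose q x := C * x + d.
have qn0 x : p <= x <= p + 1 -> q x != 0.
  by move=> xi; have [] := gE x _; rewrite ?in_itv.
have gq x : p <= x <= p + 1 -> g x = (a * x + b) / q x.
  by move=> xi; have [] := gE x _; rewrite ?in_itv.
have i0 : p <= p <= p + 1 by rewrite lexx lerDl ler01.
have i1 : p <= p + 1 <= p + 1 by rewrite lexx lerDl ler01.
have q0 := qn0 _ i0; have q1 := qn0 _ i1.
(* Otherwise the affine denominator [q] would vanish inside the segment, at [p + y]. *)
have qq : 0 < q p * q (p + 1).
  rewrite lt_neqAle eq_sym mulf_neq0 //= leNgt; apply/negP => neg.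
  pose y := q p / (q p - q (p + 1)).
  have dn : q p - q (p + 1) != 0.
    apply/eqP => h; have e : q p = q (p + 1) by lra.
    by move: neg; rewrite e -expr2 ltNge sqr_ge0.
  have yi : 0 <= y <= 1.
    have [u0|u0] := ltP 0 (q p).
    - have v0 : q (p + 1) < 0 by rewrite -(pmulr_rlt0 _ u0).
      have w0 : 0 < q p - q (p + 1) by lra.
      by rewrite /y divr_ge0 ?(ltW w0) ?(ltW u0) // ler_pdivrMr // mul1r; lra.
    - have u1 : q p < 0 by rewrite lt_neqAle q0.
      have v0 : 0 < q (p + 1) by rewrite -(nmulr_rlt0 _ u1).
      have w0 : 0 < q (p + 1) - q p by lra.
      rewrite /y -[q p - _]opprB invrN mulrN -mulNr divr_ge0 ?(ltW w0) ?oppr_ge0 ?(ltW u1) //.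
      by rewrite ler_pdivrMr // mul1r; lra.
  have /andP[y0 y1] := yi.
  have zi : p <= p + y <= p + 1 by apply/andP; split; lra.
  have := qn0 _ zi; rewrite (_ : q (p + y) = q p - y * (q p - q (p + 1))); last first.
    by rewrite /q; ring.
  by rewrite /y divfK // subrr eqxx.
have detE : a * d - b * C = q p * q (p + 1).
  have := gp p; rewrite !gq // => /eqP; rewrite -subr_eq0 => /eqP h.
  have : ((a * (p + 1) + b) / q (p + 1) - ((a * p + b) / q p + 1)) * (q p * q (p + 1)) = 0.
    by rewrite h mul0r.
  rewrite (_ : _ * _ = a * d - b * C - q p * q (p + 1)); first by move=> e; lra.
  by rewrite /q in q0 q1 *; field; rewrite q0 q1.
have ratio : (q p / q (p + 1)) ^+ 2 = c.
  have := break_limits R g (a%:P * 'X + b%:P) (C%:P * 'X + d%:P) p gp.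
  have hN x : (a%:P * 'X + b%:P).[x] = a * x + b by rewrite !(hornerD, hornerM, hornerC, hornerX).
  have hD x : (C%:P * 'X + d%:P).[x] = q x by rewrite !(hornerD, hornerM, hornerC, hornerX).
  have dN x : (rat_num R (a%:P * 'X + b%:P) (C%:P * 'X + d%:P) 1).[x] = a * d - b * C.
    rewrite rat_num1E !poly.derivE !(hornerD, hornerM, hornerC, hornerX) /=; ring.
  rewrite brk !dN !hD => -> //; last 2 first.
  - by move=> x xi; rewrite hN hD gq.
  - by move=> x xi; rewrite hD qn0.
  by field; rewrite q0 q1 det.
have s0 : 0 < Num.sqrt c by rewrite sqrtr_gt0.
have sE : Num.sqrt c = q p / q (p + 1).
  rewrite -ratio sqrtr_sqr gtr0_norm //.
  have -> : q p / q (p + 1) = q p * q (p + 1) / q (p + 1) ^+ 2 by field.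
  by rewrite divr_gt0 // exprn_even_gt0.
have gmodel y : 0 <= y <= 1 -> g (p + y) = g p + model R (Num.sqrt c) 1 y.
  move=> yi; have /andP[y0 y1] := yi.
  have zi : p <= p + y <= p + 1 by apply/andP; split; lra.
  have qz := qn0 _ zi.
  have quad1E : quad R 1 y = y by rewrite /quad expr1n; field.
  have md : mden R (q p / q (p + 1)) y = q (p + y) / q (p + 1).
    by rewrite /mden; apply: (mulIf q1); rewrite mulrDl mulrAC !divfK // /q; field.
  rewrite /model quad1E mulr1 sE md !gq //.
  have -> : (a * (p + y) + b) / q (p + y) = (a * p + b) / q p +
      (a * d - b * C) * y / (q p * q (p + y)).
    by rewrite /q in q0 qz *; field; rewrite q0 qz.
  by rewrite detE; field; rewrite q0 q1 qz.
apply/funext => x; have [n [y [y0 y1 ->]]] := ext_coord R p x.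
rewrite (ext_val R p _ _ (model0 R _ _) (model1 R _ _)) ?y0 ?ltW //.
by rewrite addrAC per_int // gmodel ?y0 ?ltW //; ring.
Qed.

(** A conjugacy of circle maps lifts only up to an integer that a priori varies with the point. If
    it did vary, a half-integer would be taken as a value. *)
Lemma int_valued_const (phi : R -> R) : continuous phi ->
  (forall x, exists k : int, phi x = k%:~R) -> exists k : int, forall x, phi x = k%:~R.
Proof.
move=> pc pint; have [k kE] := pint 0; exists k => x; rewrite -kE.
have nohalf (m : int) y : phi y <> m%:~R + 1 / 2.
  have [l ->] := pint y => h.
  have : (2 * l)%:~R = (2 * m + 1)%:~R :> R by rewrite !(rmorphM, rmorphD) /= h; field.
  by move/intr_inj; lia.
have ivt u v : u <= v -> phi u = phi v.
  move=> uv; have [i iE] := pint u; have [j jE] := pint v.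
  rewrite iE jE; congr (_%:~R); apply/eqP; rewrite -[_ == _]negbK; apply/negP => ij.
  have [y _ yE] : exists2 y, y \in `[u, v] & phi y = (Num.min i j)%:~R + 1 / 2.
    apply: IVT => //; first exact: continuous_subspaceT.
    rewrite iE jE ge_min le_max; have [ij'|ji] := ltP i j.
    - have : i%:~R + 1 <= j%:~R :> R by rewrite -[1]/(1%:~R) -rmorphD ler_int lezD1.
      by move=> h; apply/andP; split; apply/orP; [left|right]; lra.
    - have ji' : (j < i)%R by rewrite lt_neqAle eq_sym ij.
      have : j%:~R + 1 <= i%:~R :> R by rewrite -[1]/(1%:~R) -rmorphD ler_int lezD1.
      by move=> h; apply/andP; split; apply/orP; [right|left]; lra.
  exact: nohalf yE.
by case: (leP x 0) => [/ivt|/ltW/ivt].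
Qed.

Lemma holder_slope (alpha M : R) (k : R -> R) : 0 < alpha ->
  (forall x, derivable k x 1) ->
  (forall x y, `|derive1 k x - derive1 k y| <= M * `|x - y| `^ alpha) ->
  forall a e u v u' v', a <= u -> u < v -> v <= e -> a <= u' -> u' < v' -> v' <= e ->
  `|slope R k u v - slope R k u' v'| <= `|M| * (e - a) `^ alpha.
Proof.
move=> a0 dk hol.
have mvt u v : u < v -> exists2 w, u <= w <= v & slope R k u v = derive1 k w.
  move=> uv; have dk' (x : R) : is_derive x (1 : R) k (derive1 k x).
    by rewrite derive1E; exact: DeriveDef.
  have [|w] := @MVT R k (derive1 k) u v uv (fun x _ => dk' x).
    apply: continuous_subspaceT => x.
    exact/differentiable_continuous/derivable1_diffP.
  rewrite in_itv /= => /andP[uw wv] e; exists w; first by rewrite !ltW.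
  by rewrite /slope e mulfK // subr_eq0 gt_eqF.
move=> a e u v u' v' au uv ve au' uv' ve'.
have [w /andP[w1 w2] ->] := mvt _ _ uv; have [w' /andP[w1' w2'] ->] := mvt _ _ uv'.
apply: le_trans (hol w w') _.
apply: le_trans (_ : `|M| * `|w - w'| `^ alpha <= _).
  by rewrite ler_wpM2r ?powR_ge0 // ler_norm.
rewrite ler_wpM2l //; apply: ge0_ler_powR; rewrite ?nnegrE ?(ltW a0) //; first by lra.
by rewrite ler_norml; apply/andP; split; lra.
Qed.

(** The derivative is periodic, so the Hoelder bound over one period starting at 0 bounds it
    everywhere. *)
Lemma diffeo_lipschitz (alpha : R) (h : R -> R) : 0 < alpha -> circle_homeo h ->
  C1_holder alpha h -> exists2 L, 0 < L & forall x y, x < y -> h y - h x <= L * (y - x).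
Proof.
move=> a0 [hc hh hp] [dh _ [M hol]].
have d_per (n : int) x : derive1 h (x + n%:~R) = derive1 h x.
  rewrite /derive1 (_ : (fun z : R => z^-1 *: (h (z + (x + n%:~R)) - h (x + n%:~R))) =
    (fun z => z^-1 *: (h (z + x) - h x))) //.
  apply/funext => z; rewrite addrA (per_int R h hp n (z + x)) (per_int R h hp n x).
  by rewrite (_ : forall u v w : R, u + w - (v + w) = u - v) // => *; ring.
have bd x : derive1 h x <= `|derive1 h 0| + `|M|.
  pose n := Num.floor x.
  have h1 : n%:~R <= x := floor_le _.
  have h2 : x < n%:~R + 1 by rewrite -[1]/(1%:~R) -rmorphD floorD1_gt.
  have := d_per n (x - n%:~R); rewrite subrK => ->.
  have := hol (x - n%:~R) 0; rewrite subr0 [`|x - _|]ger0_norm; last by lra.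
  have p1 : (x - n%:~R) `^ alpha <= 1.
    rewrite [leRHS](_ : 1 = 1 `^ alpha); last by rewrite powR1.
    by apply: ge0_ler_powR; rewrite ?nnegrE ?(ltW a0) //; lra.
  have m1 : M * (x - n%:~R) `^ alpha <= `|M|.
    apply: le_trans (_ : `|M| * (x - n%:~R) `^ alpha <= _).
      by rewrite ler_wpM2r ?powR_ge0 ?ler_norm.
    by rewrite ler_piMr.
  have := ler_norm (derive1 h 0); rewrite ler_norml => q1 /andP[_ q2]; lra.
exists (`|derive1 h 0| + `|M| + 1); first by rewrite ltr_wpDl // addr_ge0.
move=> x y xy.
have dh' (z : R) : is_derive z (1 : R) h (derive1 h z) by rewrite derive1E; exact: DeriveDef.
have [|w _ ->] := @MVT R h (derive1 h) x y xy (fun z _ => dh' z).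
  apply: continuous_subspaceT => z.
  exact/differentiable_continuous/derivable1_diffP.
by rewrite ler_pM2r ?subr_gt0 //; have := bd w; lra.
Qed.

(** Equal to 1 only at [e = 0], so that all other members have a curved quadratic factor, and
    bounded by 2 as a neighborhood common to all [e] requires. *)
Definition warp (e : R) : R := 1 + e ^+ 2 / (1 + e ^+ 2).

Lemma warp_itv e : 1 <= warp e <= 2.
Proof.
have h := sqr_ge0 e; have p1 : 0 < 1 + e ^+ 2 by lra.
rewrite /warp lerDl divr_ge0 ?(ltW p1) //= (_ : 2 = 1 + 1) // lerD2l.
by rewrite ler_pdivrMr // mul1r; lra.
Qed.

Lemma warp_gt1 e : e != 0 -> 1 < warp e.
Proof.
move=> e0; have h : 0 < e ^+ 2 by rewrite exprn_even_gt0.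
by rewrite /warp ltrDl divr_gt0 //; lra.
Qed.

Lemma warp0 : warp 0 = 1.
Proof. by rewrite /warp expr0n /= mul0r addr0. Qed.

Lemma warp_cont : continuous warp.
Proof.
have sq : continuous (fun e : R => e ^+ 2) by move=> x; apply: cvgM; exact: cvg_id.
move=> x; apply: cvgD; first exact: cvg_cst.
apply: cvgM; first exact: sq.
apply: cvgV; first by rewrite gt_eqF // ltr_pwDl ?sqr_ge0.
by apply: cvgD; [exact: cvg_cst|exact: sq].
Qed.

Lemma ext_not_conjugate (s p b b' t r alpha : R) : 0 < s -> s != 1 ->
  1 < r -> 0 < alpha ->
  (forall n (k : int), (0 < n)%N -> n%:R * t <> k%:~R) ->
  (forall n, `|iter n (ext R p b' (model R s 1)) 0 - n%:R * t| <= 1) ->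
  1 < (1 + decay_exp R (slope_cst R s) (curvlow_cst R s) (curvhigh_cst R s)) * alpha ->
  ~ C1_holder_conjugate alpha (ext R p b (model R s r)) (ext R p b' (model R s 1)).
Proof.
move=> s0 s1 r1 a0 tirr bd exp1 [h [[hH [k [hK kK Hh Hk]]] conj]].
pose F := ext R p b (model R s r); pose g := ext R p b' (model R s 1).
have FH : circle_homeo F := ext_circle_homeo R p b s r s0 (ltW r1).
have gH : circle_homeo g := ext_circle_homeo R p b' s 1 s0 (lexx 1).
have [Fc Fh Fp] := FH; have [gc gh gp] := gH; have [hc hh hp] := hH.
have [j jE] : exists j : int, forall x, h (F x) - g (h x) = j%:~R.
  apply: int_valued_const => [x|x]; last first.
    by have [m mE] := conj x; exists m; rewrite -[m%:~R](addrK (g (h x))) [m%:~R + _]addrC -[g (h x) + _]mE.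
  apply: cvgB.
    by apply: (@continuous_comp _ _ _ F h); [exact: Fc|exact: hc].
  by apply: (@continuous_comp _ _ _ h g); [exact: hc|exact: gc].
(* The integer [j] is absorbed into the lift of [g], whose translation number becomes [t + j]; the
   exponent is unaffected, as the break law constants do not see the additive constant. *)
pose G := ext R p (b' + j%:~R) (model R s 1).
have GE x : G x = g x + j%:~R by rewrite /G /g /ext; ring.
have GH : circle_homeo G := ext_circle_homeo R p _ s 1 s0 (lexx 1).
have Giter n : iter n G 0 = iter n g 0 + n%:R * j%:~R.
  elim: n => [|n ih]; first by rewrite mul0r addr0.
  rewrite /= ih GE -[n%:R * j%:~R]/(_) [n%:R]pmulrn -rmorphM per_int //.
  by rewrite rmorphM /= -pmulrn -natr1; ring.
have tirr' n (i : int) : (0 < n)%N -> n%:R * (t + j%:~R) <> i%:~R.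
  move=> n0 e; apply: (tirr n (i - n%:Z * j) n0).
  by rewrite rmorphB rmorphM /= -e -pmulrn; ring.
have [Gc Gh Gp] := GH.
have [Gi [GK GiK]] := lift_inverse R G Gc Gh Gp.
have GL : irrational_lift R G Gi (t + j%:~R).
  apply: (irrational_liftP R G GH _ tirr' Gi 1 GK GiK) => n.
  by rewrite Giter (_ : _ - _ = iter n g 0 - n%:R * t); [exact: bd|ring].
have BL := mobius_break_law R p (b' + j%:~R) s s0 s1.
have [V0 K00 K10] := curv_csts R s s0 s1.
have kG x : k (G x) = F (k x).
  by rewrite -[F _]hK; congr k; have := jE (k x); rewrite kK GE; lra.
have [L L0 Llip] := diffeo_lipschitz _ _ a0 hH Hh.
have khomo : {homo k : x y / x < y}.
  move=> x y xy; rewrite ltNge; apply/negP; rewrite le_eqVlt => /orP[/eqP/(can_inj kK) e|/hh].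
    by rewrite e ltxx in xy.
  by rewrite !kK ltNge (ltW xy).
have klow x y : x < y -> (y - x) / L <= k y - k x.
  move=> xy; rewrite ler_pdivrMr // mulrC.
  by have := Llip _ _ (khomo _ _ xy); rewrite !kK.
have [dk _ [M hol]] := Hk.
have kdist a e u v u' v' : a <= u -> u < v -> v <= e -> a <= u' -> u' < v' -> v' <= e ->
    `|lnslope R k u v - lnslope R k u' v'| <= (L * `|M|) * (e - a) `^ alpha.
  move=> au uv ve au' uv' ve'.
  have low x y : x < y -> L^-1 <= slope R k x y.
    by move=> xy; rewrite /slope ler_pdivlMr ?subr_gt0 // mulrC klow.
  have iL : 0 < L^-1 by rewrite invr_gt0.
  have := ln_dist_le _ _ _ _ iL (low _ _ uv) (low _ _ uv').
  rewrite mulrC ler_pdivrMr // => /le_trans; apply; rewrite mulrC -mulrA ler_pM2l //.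
  exact: holder_slope a0 dk hol _ _ _ _ _ _ au uv ve au' uv' ve'.
have tl0 : 0 < tilt R r.
  have r2 : 1 < r ^+ 2 by rewrite exprn_egt1.
  by rewrite /tilt divr_gt0 //; lra.
have kap0 : 0 < tilt R r ^+ 2 / (1 + tilt R r) ^+ 2.
  by rewrite divr_gt0 ?exprn_gt0 //; lra.
apply: (no_conjugacy R _ _ _ GL p _ _ _ V0 K00 K10 BL
  (fun y1 y2 y3 y4 => ext_lncross0 R p _ s s0 y1 y2 y3 y4) F _ Fh kap0
  (fun y1 y2 y3 y4 => ext_lncross_le R p b s s0 r y1 y2 y3 y4 (ltW r1))
  h k alpha L (L * `|M|) hK kK hh hp kG L0 _ a0 klow kdist exp1).
by rewrite mulr_ge0 // ltW.
Qed.

End Conclusion.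

Theorem corollary1 (R : realType) (c : R) (c_gt0 : 0 < c) (c_neq1 : c <> 1) :
  exists nu : R, 0 < nu /\ nu < 1 /\
    forall (p : R) (g : R -> R) (rho : R),
      B_omega p c g -> linear_fractional p g ->
      rotation_number g = rho -> irrational rho ->
      exists f : R -> R -> R,
        (forall e, B_omega p c (f e)) /\
        same_circle_map (f 0) g /\
        Cinfty_continuous_family p (p + 1) f /\
        (forall e, rotation_number (f e) = rho) /\
        (forall e, e <> 0 -> forall alpha : R, 1 - nu < alpha -> alpha <= 1 ->
           ~ C1_holder_conjugate alpha (f e) g) /\
        analytic_continuous_family p (p + 1) f.
Proof.
pose s := Num.sqrt c.
have s0 : 0 < s by rewrite sqrtr_gt0.
have sc : s ^+ 2 = c by rewrite sqr_sqrtr // ltW.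
have s1 : s != 1.
  by apply/eqP => s1; apply: c_neq1; rewrite -sc s1 expr1n.
have [V0 K00 K10] := curv_csts R s s0 s1.
pose e0 := decay_exp R (slope_cst R s) (curvlow_cst R s) (curvhigh_cst R s).
have e00 : 0 < e0 := decay_exp_gt0 _ _ _ _ K00.
have e01 : 0 < 1 + e0 by lra.
(* Then [1 - nu = 1 / (1 + e0)]; it is fixed before [p] and [g], since [e0] is computed from [s]
   alone. *)
exists (e0 / (1 + e0)); split; first by rewrite divr_gt0.
split; first by rewrite ltr_pdivrMr // mul1r; lra.
move=> p g rho gB gL grho rirr.
have gE : g = ext R p (g p) (model R s 1) := mobius_ext R c p g c_gt0 gB gL.
have gH : circle_homeo g by case: gB.
have [t tP] := translation_ex R g gH.
have rhoE : rho = t - (Num.floor t)%:~R by rewrite -grho (rotation_numberE R g t 1).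
have tirr n (k : int) : (0 < n)%N -> n%:R * t <> k%:~R.
  move=> n0 e; apply: rirr; apply/rationalP.
  exists (k - n%:Z * Num.floor t), n; rewrite rhoE rmorphB rmorphM /= -e -pmulrn.
  by field; rewrite pnatr_eq0 -lt0n.
pose Psi e := ext R p 0 (model R s (warp R e)).
have wi e : 1 <= warp R e <= 2 := warp_itv R e.
have w1 e : 1 <= warp R e by have /andP[] := wi e.
pose Mu := s * 2 * 2 / dmin R s ^+ 2.
have PsiH e : circle_homeo (Psi e) := ext_circle_homeo R p 0 s _ s0 (w1 e).
have d0 := dmin_gt0 _ _ s0.
have PsiL e x y : `|Psi e x - Psi e y| <= Mu * `|x - y|.
  apply: le_trans (ext_lip R p 0 _ (model0 R s _) (model1 R s _) _ _
    (model_bd R s _ s0 (w1 e)) (model_low_gt0 R s _ s0 (w1 e)) x y) _.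
  apply: ler_wpM2r => //; have /andP[_ w2] := wi e.
  have /andP[t0 t1] := tilt_itv R _ (w1 e).
  have ms : dmin R s <= dmin R (s * warp R e).
    rewrite /dmin le_min ge_min ge_min lexx orbT andbT; apply/orP; left.
    by rewrite ler_peMr // ltW.
  have sw0 : 0 <= s * warp R e by apply: mulr_ge0; [exact: ltW|have := w1 e; lra].
  rewrite /Mu; apply: ler_pM.
  - by rewrite mulr_ge0 //; lra.
  - by rewrite invr_ge0 exprn_ge0 // (le_trans (ltW d0)).
  - apply: ler_pM => //; [by lra| |by lra].
    by rewrite ler_pM2l.
  - rewrite lef_pV2 ?posrE ?exprn_gt0 //; last exact: lt_le_trans d0 ms.
    by apply: lerXn2r; rewrite ?nnegrE ?(ltW d0) ?(le_trans (ltW d0)).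
have PsiC x : continuous (fun e => Psi e x).
  have [n [y [y0 y1 xE]]] := ext_coord R p x.
  have yi : 0 <= y <= 1 by rewrite y0 ltW.
  have -> : (fun e => Psi e x) = (fun e => 0 + n%:~R + model R s (warp R e) y).
    by apply/funext => e; rewrite xE /Psi (ext_val R p 0 _ (model0 R s _) (model1 R s _)).
  move=> e; apply: cvgD; first exact: cvg_cst.
  have w2 : continuous (fun e => warp R e ^+ 2).
    by move=> z; apply: cvgM; exact: warp_cont.
  have qc : continuous (fun e => quad R (warp R e) y).
    move=> z; apply: cvgM; last first.
      apply: cvgV; first by rewrite gt_eqF // ltr_wpDl ?sqr_ge0.
      by apply: cvgD; [exact: w2|exact: cvg_cst].
    apply: cvgB; apply: cvgM; try exact: cvg_cst.
      by apply: cvgM; [exact: cvg_cst|exact: w2].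
    by apply: cvgB; [exact: w2|exact: cvg_cst].
  have sw : continuous (fun e => s * warp R e).
    by move=> z; apply: cvgM; [exact: cvg_cst|exact: warp_cont].
  apply: cvgM; first exact: qc.
  apply: cvgV.
    by rewrite gt_eqF //; exact: (den_gt0 R s (warp R e) s0 (w1 e)).
  apply: cvgD; first exact: sw.
  apply: cvgM; last exact: qc.
  by apply: cvgB; [exact: cvg_cst|exact: sw].
pose beta := tune R t Psi.
pose f e := ext R p (beta e) (model R s (warp R e)).
have fE e : f e = shifted R Psi e (beta e).
  by apply/funext => x; rewrite /f /shifted /Psi /ext; ring.
have ftr e : tracks R t (f e) by rewrite fE; exact: tune_tracks tirr _ Mu PsiH PsiL PsiC e.
have g0 : shifted R Psi 0 (g p) = g.
  by rewrite [RHS]gE; apply/funext => x; rewrite /shifted /Psi warp0 /ext; ring.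
have beta0 : beta 0 = g p.
  apply: (tune_unique R t tirr Psi Mu PsiH PsiL PsiC); rewrite g0.
  have [gc gh gp] := gH.
  have [gi [gK giK]] := lift_inverse R g gc gh gp.
  have GL := irrational_liftP R g gH t tirr gi 1 gK giK tP.
  move=> n k x n0; split=> kt; apply: ltW.
  - exact: (il_lt _ _ _ _ GL).
  - exact: (il_gt _ _ _ _ GL).
have bc : continuous beta := tune_cont R t tirr Psi Mu PsiH PsiL PsiC.
exists f; split; first by move=> e; rewrite -sc; exact: ext_B_omega.
split.
  by move=> x; exists 0; rewrite addr0 fE beta0 g0.
split; first exact: (ext_Cinfty R p s s0 beta (warp R) bc (warp_cont R) wi).
split.
  move=> e; rewrite (rotation_numberE R (f e) t 1) // => n.
  by have := tracks_bd R t tirr _ (ftr e) n 0; rewrite subr0.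
split; last exact: (ext_analytic R p s s0 beta (warp R) bc (warp_cont R) wi).
move=> e /eqP en0 alpha anu _.
have a0 : 0 < alpha.
  apply: lt_trans anu; rewrite subr_gt0 ltr_pdivrMr // mul1r; lra.
have exp1 : 1 < (1 + e0) * alpha.
  rewrite -ltr_pdivrMl // mulr1; apply: le_lt_trans anu.
  by rewrite le_eqVlt; apply/orP; left; apply/eqP; field; rewrite gt_eqF.
rewrite [g]gE.
apply: (ext_not_conjugate R s p _ _ t _ alpha s0 s1 (warp_gt1 R e en0) a0 tirr _ exp1).
by move=> n; rewrite -gE.
Qed.
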